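(* Let $p,r,n$ be integers with $1\le r\le p-2$, $n\ge 1$ and $n\ge \frac{4-r}{p-r-1}$, and let $\Omega$ be a planar multi-patch domain with an analysis-suitable $G^1$ multi-patch spline parametrization, with patch, edge and vertex index sets $\mathcal I_\Omega,\mathcal I_\Sigma,\mathcal I_{\mathcal X}$. Let $\mathcal A=\big(\bigoplus_{i\in\mathcal I_\Omega}\mathcal A^\circ_{\Omega^{(i)}}\big)\oplus\big(\bigoplus_{i\in\mathcal I_\Sigma}\mathcal A^\circ_{\Sigma^{(i)}}\big)\oplus\big(\bigoplus_{i\in\mathcal I_{\mathcal X}}\mathcal A_{\mathbf x^{(i)}}\big)$ be the Argyris isogeometric space defined in the context. Then the dimensions of the subspaces do not depend on the geometry and satisfy $$\dim\mathcal A^\circ_{\Omega^{(i)}}=\big((p-r)(n-1)+p-3\big)^2\quad (i\in\mathcal I_\Omega),$$ $$\dim\mathcal A^\circ_{\Sigma^{(i)}}=2(p-r-1)(n-1)+2p-9\quad (i\in\mathcal I_\Sigma),\qquad \dim\mathcal A_{\mathbf x^{(i)}}=6\quad (i\in\mathcal I_{\mathcal X}).$$ Hence $$\dim\mathcal A=|\mathcal I_\Omega|\big((p-r)(n-1)+p-3\big)^2+|\mathcal I_\Sigma|\big(2(p-r-1)(n-1)+2p-9\big)+6\,|\mathcal I_{\mathcal X}|.$$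
   Context: **Splines.** For integers $p,r,n$, $h=1/n$, $\mathcal S^{p,r}_h$ is the space of $C^r$ piecewise polynomials of degree $p$ on $[0,1]$ with $n$ uniform elements (open knot vector, interior knots of multiplicity $p-r$), with standard B-spline basis $b_0,\dots,b_{N-1}$, $N=(p-r)(n-1)+p+1$. $\mathcal S^{\mathbf p,\mathbf r}_h=\mathcal S^{p,r}_h\otimes\mathcal S^{p,r}_h$ on $[0,1]^2$ has the basis $b_{\mathbf j}(\xi_1,\xi_2)=b_{j_1}(\xi_1)b_{j_2}(\xi_2)$. Also $\{b^+_j\}_{j=0}^{N^+-1}$ and $\{b^-_j\}_{j=0}^{N^--1}$ are the B-spline bases of $\mathcal S^{p,r+1}_h$ and $\mathcal S^{p-1,r}_h$ (same mesh), $N^-=(p-r-1)(n-1)+p$, $N^+=N^-+1$. Put $c_0=b_0+b_1$, $c_1=\frac hp b_1$. **Domain.** $\Omega\subset\mathbb R^2$ is open, connected, regular, $\Gamma=\partial\Omega$, $\overline\Omega=\bigcup_{i\in\mathcal I_\Omega}\overline{\Omega^{(i)}}$ (finite), where the $\Omega^{(i)}$ are disjoint open patches, $\overline{\Omega^{(i)}}$ is parametrized one-to-one by $\mathbf F^{(i)}:[0,1]^2\to\overline{\Omega^{(i)}}$, $\mathbf F^{(i)}\in\mathcal S^{\mathbf p,\mathbf r}_h\times\mathcal S^{\mathbf p,\mathbf r}_h$, $\det[\partial_1\mathbf F^{(i)},\partial_2\mathbf F^{(i)}]>0$ on $[0,1]^2$. Edges (open) and vertices are the images of the sides and corners of $[0,1]^2$.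 No hanging nodes: distinct closed patches are disjoint, or share exactly one vertex, or exactly one closed edge, along which the two parametrizations agree up to orientation. $\mathcal I_\Sigma=\mathcal I^\circ_\Sigma\,\dot\cup\,\mathcal I^\Gamma_\Sigma$ indexes edges $\Sigma^{(i)}$ (interfaces, i.e. edges inside $\Omega$ shared by two patches; boundary edges); $\mathcal I_{\mathcal X}$ indexes all vertices $\mathbf x^{(i)}$, interior and boundary. **Standard form.** Patches may be reparametrized by rotations of $[0,1]^2$ by multiples of $\pi/2$, separately for each edge or vertex considered. An interface $\Sigma^{(i)}$ between $\Omega^{(\imath_1)},\Omega^{(\imath_2)}$ is in standard form if $\mathbf F^{(\imath_1)}(0,\xi)=\mathbf F^{(\imath_2)}(\xi,0)$ for $\xi\in[0,1]$, this being the parametrization of $\overline{\Sigma^{(i)}}$. A boundary edge of $\Omega^{(\imath_1)}$ is in standard form if it is $\{\mathbf F^{(\imath_1)}(0,\xi):0<\xi<1\}$. **Analysis-suitable $G^1$.** For each interface in standard form there are polynomials $\alpha^{(i,\imath_1)},\alpha^{(i,\imath_2)},\beta^{(i,\imath_1)},\beta^{(i,\imath_2)}$ of degree at most $1$ (gluing data, fixed once and for all), with $\alpha^{(i,\imath_1)},\alpha^{(i,\imath_2)}$ relatively prime, such that on $[0,1]$: $\alpha^{(i,\imath_1)}\alpha^{(i,\imath_2)}>0$ and, with $\beta^{(i)}=\alpha^{(i,\imath_1)}\beta^{(i,\imath_2)}+\alpha^{(i,\imath_2)}\beta^{(i,\imath_1)}$, $$\alpha^{(i,\imath_1)}(\xi)\,\partial_2\mathbf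 F^{(\imath_2)}(\xi,0)+\alpha^{(i,\imath_2)}(\xi)\,\partial_1\mathbf F^{(\imath_1)}(0,\xi)+\beta^{(i)}(\xi)\,\partial_2\mathbf F^{(\imath_1)}(0,\xi)=\mathbf 0.$$ If the roles of the two patches are swapped (opposite orientation of the interface), the data are transported by $\alpha(\xi)\mapsto\alpha(1-\xi)$, $\beta(\xi)\mapsto-\beta(1-\xi)$. **Patch-interior space.** $\mathrm B^{(i)}_{\mathbf j}:\overline{\Omega^{(i)}}\to\mathbb R$ is defined by $\mathrm B^{(i)}_{\mathbf j}\circ\mathbf F^{(i)}=b_{\mathbf j}$; $\mathcal A^\circ_{\Omega^{(i)}}=\mathrm{span}\{\mathrm B^{(i)}_{\mathbf j}:\mathbf j\in\{2,\dots,N-3\}^2\}$. **Edge space.** For an interface in standard form, $\overline{\mathrm B}^{(i)}_{\mathbf j}:\overline{\Omega^{(\imath_1)}}\cup\overline{\Omega^{(\imath_2)}}\to\mathbb R$ is defined, for $0\le j\le N^+-1$, by $$\overline{\mathrm B}^{(i)}_{(j,0)}\circ\mathbf F^{(\imath_1)}=b^+_j(\xi_2)c_0(\xi_1)-\beta^{(i,\imath_1)}(\xi_2)(b^+_j)'(\xi_2)c_1(\xi_1),\quad \overline{\mathrm B}^{(i)}_{(j,0)}\circ\mathbf F^{(\imath_2)}=b^+_j(\xi_1)c_0(\xi_2)-\beta^{(i,\imath_2)}(\xi_1)(b^+_j)'(\xi_1)c_1(\xi_2),$$ and, for $0\le j\le N^--1$, by $$\overline{\mathrm B}^{(i)}_{(j,1)}\circ\mathbf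 F^{(\imath_1)}=\alpha^{(i,\imath_1)}(\xi_2)b^-_j(\xi_2)b_1(\xi_1),\quad \overline{\mathrm B}^{(i)}_{(j,1)}\circ\mathbf F^{(\imath_2)}=-\alpha^{(i,\imath_2)}(\xi_1)b^-_j(\xi_1)b_1(\xi_2).$$ For a boundary edge in standard form: $\overline{\mathrm B}^{(i)}_{(j,0)}\circ\mathbf F^{(\imath_1)}=b^+_j(\xi_2)c_0(\xi_1)$, $\overline{\mathrm B}^{(i)}_{(j,1)}\circ\mathbf F^{(\imath_1)}=b^-_j(\xi_2)b_1(\xi_1)$ (with $\xi_1,\xi_2$ exchanged if the edge is at $\xi_2=0$). $\mathcal A^\circ_{\Sigma^{(i)}}$ is the span of the $\overline{\mathrm B}^{(i)}_{(j_1,j_2)}$, $j_2\in\{0,1\}$, with $j_1+j_2\ge3$ and $j_1\le N^--3$. **Vertex space.** Let $\mathbf x^{(i)}$ be a vertex contained in $\nu$ patches $\Omega^{(\imath_2)},\Omega^{(\imath_4)},\dots,\Omega^{(\imath_{2\nu})}$, in counterclockwise order, in standard form: $\mathbf F^{(\imath_{2\ell})}(0,0)=\mathbf x^{(i)}$ and $\mathbf F^{(\imath_{2\ell})}(0,\xi)=\mathbf F^{(\imath_{2\ell+2})}(\xi,0)$ for $\ell=1,\dots,\nu$ (interior vertex, sub-indices modulo $2\nu$) or $\ell=1,\dots,\nu-1$ (boundary vertex). $\Sigma^{(\imath_{2\ell+1})}$ is the interface between $\Omega^{(\imath_{2\ell})}$ (first patch) and $\Omega^{(\imath_{2\ell+2})}$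 (second patch); at a boundary vertex, $\Sigma^{(\imath_1)}$ and $\Sigma^{(\imath_{2\nu+1})}$ are the boundary edges $\{\mathbf F^{(\imath_2)}(\xi,0)\}$ and $\{\mathbf F^{(\imath_{2\nu})}(0,\xi)\}$. $C^2(\mathbf x^{(i)})$ is the set of piecewise smooth functions whose derivatives up to order 2 are continuous at $\mathbf x^{(i)}$. For even $k$, $\Pi_k\varphi$ is the unique element of $\mathrm{span}\{\mathrm B^{(\imath_k)}_{\mathbf j}:\mathbf j\in\{0,1\}^2\}$ with $\partial_1^{m_1}\partial_2^{m_2}(\Pi_k\varphi\circ\mathbf F^{(\imath_k)})(0,0)=\partial_1^{m_1}\partial_2^{m_2}(\varphi\circ\mathbf F^{(\imath_k)})(0,0)$ for $0\le m_1,m_2\le1$. For odd $k$, $\Pi_k\varphi$ is the unique element of $\mathrm{span}\{\overline{\mathrm B}^{(\imath_k)}_{\mathbf j}:0\le j_1,\,0\le j_2\le1,\,j_1+j_2\le2\}$ such that $\partial_1^{m_1}\partial_2^{m_2}$ of $\Pi_k\varphi\circ\mathbf F^{(\imath_{k\pm1})}$ and $\varphi\circ\mathbf F^{(\imath_{k\pm1})}$ agree at $(0,0)$ for $m_1+m_2\le2$, with $m_1\le1$ on the patch $\imath_{k-1}$ and $m_2\le1$ on the patch $\imath_{k+1}$ (for those of the two patches that exist). All functions are extended by zero outside their patches. Then $\Pi_{\mathcal A_{\mathbf x^{(i)}}}=\sum_k(-1)^{k+1}\Pi_k$, with $k=1,\dots,2\nu$ (interior vertex) or $k=1,\dots,2\nu+1$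 (boundary vertex), and $\mathcal A_{\mathbf x^{(i)}}$ is the image of $C^2(\mathbf x^{(i)})$ under $\Pi_{\mathcal A_{\mathbf x^{(i)}}}$. *)

(* Defs.v *)
From HB Require Import structures.
From mathcomp Require Import all_boot all_order all_algebra.
From mathcomp Require Import all_classical all_reals all_analysis.
Import Order.TTheory GRing.Theory Num.Theory.
Import numFieldNormedType.Exports.

Set Implicit Arguments.
Unset Strict Implicit.
Unset Printing Implicit Defensive.

Local Open Scope classical_set_scope.
Local Open Scope ring_scope.

Section LinearAlgebra.
Context {R : realType} {V : lmodType R}.

Definition lspan (S : set V) : set V :=
  [set v | exists m (c : 'I_m -> R) (u : 'I_m -> V),
     (forall i, S (u i)) /\ v = \sum_i c i *: u i].

Definition has_dim (S : set V) (d : nat) : Prop :=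
  exists b : 'I_d -> V,
    (forall c : 'I_d -> R, \sum_i c i *: b i = 0 -> forall i, c i = 0) /\
    S = lspan (range b).

Definition subspace_sum (J : finType) (S : J -> set V) : set V :=
  [set v | exists2 u : J -> V, (forall j, S j (u j)) & v = \sum_j u j].

Definition independent_subspaces (J : finType) (S : J -> set V) : Prop :=
  forall u : J -> V, (forall j, S j (u j)) ->
    \sum_j u j = 0 -> forall j, u j = 0.

End LinearAlgebra.

Definition plane (R : realType) : Type := (R^o * R^o)%type.
HB.instance Definition _ (R : realType) := NormedModule.on (plane R).

Section Calculus.
Context {R : realType}.
Notation plane := (plane R).

Definition unit_square : set plane :=
  [set xi | 0 <= xi.1 <= 1 /\ 0 <= xi.2 <= 1].
Definition open_unit_square : set plane :=
  [set xi | 0 < xi.1 < 1 /\ 0 < xi.2 < 1].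

Section ParameterDerivatives.
Context {V : normedModType R}.

(* Derivatives of functions on [0,1] or [0,1]^2 are derivatives relative to
   [0,1], hence one-sided at the end points. *)
Definition has_deriv01 (f : R -> V) (x : R) : Prop :=
  cvg ((y - x)^-1 *: (f y - f x) @[y --> within `[0, 1] x^']).
Definition deriv01 (f : R -> V) (x : R) : V :=
  lim ((y - x)^-1 *: (f y - f x) @[y --> within `[0, 1] x^']).

Definition d1 (f : plane -> V) : plane -> V :=
  fun xi => deriv01 (fun t => f (t, xi.2)) xi.1.
Definition d2 (f : plane -> V) : plane -> V :=
  fun xi => deriv01 (fun t => f (xi.1, t)) xi.2.
Definition dmix (m1 m2 : nat) (f : plane -> V) : plane -> V :=
  iter m1 d1 (iter m2 d2 f).

End ParameterDerivatives.

Definition jacobian (G : plane -> plane) (xi : plane) : R :=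
  (d1 G xi).1 * (d2 G xi).2 - (d1 G xi).2 * (d2 G xi).1.

Definition cartesian_dir (b : bool) : plane := if b then (0, 1) else (1, 0).
Definition partials (s : seq bool) (f : plane -> R^o) : plane -> R^o :=
  foldr (fun b g => fun x => 'D_(cartesian_dir b) g x) f s.

(* C^oo: every iterated partial derivative is (Frechet) differentiable. *)
Definition smooth (f : plane -> R^o) : Prop :=
  forall s x, differentiable (partials s f) x.

End Calculus.

Section Splines.
Context {R : realType}.
Notation plane := (plane R).

Definition Cr01 (r : nat) (f : R -> R^o) : Prop :=
  (forall m, (m < r)%N -> forall x : R, 0 <= x <= 1 ->
     has_deriv01 (iter m deriv01 f) x) /\
  {within `[0, 1], continuous (iter r deriv01 f)}.

(* the space S^{p,r}_h with h = 1/n *)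
Definition spline (p r n : nat) : set (R -> R^o) :=
  [set f | (forall k, (k < n)%N -> exists2 q : {poly R}, (size q <= p.+1)%N &
              forall x, k%:R / n%:R <= x <= k.+1%:R / n%:R -> f x = q.[x]) /\
           Cr01 r f].

Definition tensor_spline (p r n : nat) : set (plane -> R^o) :=
  lspan [set u | exists f g, [/\ spline p r n f, spline p r n g &
                   u = fun xi : plane => f xi.1 * g xi.2]].

Definition open_knots (p r n : nat) : seq R :=
  nseq p.+1 0 ++ flatten [seq nseq (p - r) (k%:R / n%:R) | k <- iota 1 n.-1]
  ++ nseq p.+1 1.

(* Cox-de Boor recursion; the usual convention 0/0 = 0 at repeated knots holds
   because 0^-1 = 0.  The last nonempty knot span is closed at 1. *)
Fixpoint cox_de_boor (t : nat -> R) (q j : nat) (x : R) : R :=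
  match q with
  | 0 => if (t j <= x < t j.+1) || [&& t j < x, x == t j.+1 & x == 1]
         then 1 else 0
  | q'.+1 =>
      (x - t j) / (t (j + q)%N - t j) * cox_de_boor t q' j x
      + (t (j + q).+1 - x) / (t (j + q).+1 - t j.+1) * cox_de_boor t q' j.+1 x
  end.

Definition bspline (p r n j : nat) : R -> R^o :=
  cox_de_boor (nth 1 (open_knots p r n)) p j.

Definition spline_dim (p r n : nat) : nat := ((p - r) * (n - 1) + p + 1)%N.

End Splines.

(* A patch together with a rotation of its parameter square. *)
Definition rpatch (I : finType) : Type := (I * 'I_4)%type.

Record gluing (R : realType) := Gluing {
  al1 : {poly R}; al2 : {poly R}; be1 : {poly R}; be2 : {poly R} }.

(* Edges in standard form: the interface G1(0,.) = G2(.,0), or a boundary edge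
   G(0,.) resp. G(.,0), where the G's are the rotated parametrizations. *)
Inductive edge_form (I : finType) :=
  | Interface of rpatch I & rpatch I
  | Boundary1 of rpatch I
  | Boundary2 of rpatch I.

(* The patches around a vertex in counterclockwise order: vpatch l, for
   l < valence, is the (l+1)-st one. *)
Record vertex_form (I : finType) := VertexForm {
  interior_vertex : bool; valence : nat; vpatch : nat -> rpatch I }.

Section Domain.
Context {R : realType} {I : finType}.
Notation plane := (plane R).
Variables (Omega : set plane) (F : I -> plane -> plane).

Definition quarter_turn (xi : plane) : plane := (1 - xi.2, xi.1).

Definition param (h : rpatch I) (xi : plane) : plane :=
  F h.1 (iter h.2 quarter_turn xi).

Definition patch (i : I) : set plane := F i @` open_unit_square.
Definition closed_patch (i : I) : set plane := F i @` unit_square.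

Definition side1 (h : rpatch I) : set plane :=
  [set param h (0, t) | t in `]0, 1[].
Definition side2 (h : rpatch I) : set plane :=
  [set param h (t, 0) | t in `]0, 1[].
Definition closed_side1 (h : rpatch I) : set plane :=
  [set param h (0, t) | t in `[0, 1]].
Definition corner (h : rpatch I) : plane := param h (0, 0).

Definition boundary : set plane := closure Omega `\` Omega.

(* (i, k), with k ranging over the four rotations, reaches every corner and, as
   side1, every side of the patch i. *)
Definition conforming (i i' : I) : Prop :=
  let M := closed_patch i `&` closed_patch i' in
  [\/ M = set0,
      exists k k', corner (i, k) = corner (i', k') /\ M = [set corner (i, k)] |
      exists k k', M = closed_side1 (i, k) /\
        ((forall t : R, 0 <= t <= 1 ->
            param (i, k) (0, t) = param (i', k') (t, 0))
         \/
         (forall t : R, 0 <= t <= 1 ->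
            param (i, k) (0, t) = param (i', k') (1 - t, 0)))].

Definition multipatch_domain (p r n : nat) : Prop :=
  [/\ [/\ open Omega, connected Omega & Omega = interior (closure Omega)],
      closure Omega = \bigcup_i closed_patch i,
      (forall i, open (patch i)) /\
      (forall i i', i != i' -> patch i `&` patch i' = set0),
      (forall i,
         [/\ (exists2 s, tensor_spline p r n s &
                forall xi, unit_square xi -> (F i xi).1 = s xi),
             (exists2 s, tensor_spline p r n s &
                forall xi, unit_square xi -> (F i xi).2 = s xi),
             {in unit_square &, injective (F i)} &
             forall xi, unit_square xi -> 0 < jacobian (F i) xi]) &
      forall i i', i != i' -> conforming i i'].

Definition indexes_edges (E : finType) (edge : E -> set plane) : Prop :=
  injective edge /\ range edge = range side1.

Definition indexes_vertices (X : finType) (vert : X -> plane) : Prop :=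
  injective vert /\ range vert = range corner.

Definition standard_interface (h1 h2 : rpatch I) : Prop :=
  [/\ h1.1 <> h2.1, side1 h1 `<=` Omega &
      forall t : R, 0 <= t <= 1 -> param h1 (0, t) = param h2 (t, 0)].

Definition standard_edge (S : set plane) (e : edge_form I) : Prop :=
  match e with
  | Interface h1 h2 => S = side1 h1 /\ standard_interface h1 h2
  | Boundary1 h => S = side1 h /\ side1 h `<=` boundary
  | Boundary2 h => False
  end.

Definition standard_vertex (x : plane) (v : vertex_form I) : Prop :=
  let nu := valence v in
  let h := vpatch v in
  [/\ (forall l l', (l < nu)%N -> (l' < nu)%N -> (h l).1 = (h l').1 -> l = l'),
      (forall i, closed_patch i x <-> exists2 l, (l < nu)%N & (h l).1 = i),
      (forall l, (l < nu)%N -> corner (h l) = x) &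
      if interior_vertex v then
        Omega x /\
        forall l, (l < nu)%N -> standard_interface (h l) (h (l.+1 %% nu)%N)
      else
        [/\ boundary x,
            (forall l, (l.+1 < nu)%N -> standard_interface (h l) (h l.+1)),
            side2 (h 0%N) `<=` boundary & side1 (h nu.-1) `<=` boundary]].

Section Gluing.
Variable gd : rpatch I -> rpatch I -> gluing R.

Definition gluing_beta (g : gluing R) : {poly R} :=
  al1 g * be2 g + al2 g * be1 g.

(* Data of the same interface with the roles of the two patches swapped. *)
Definition swap_gluing (g : gluing R) : gluing R :=
  Gluing (al2 g \Po (1 - 'X)) (al1 g \Po (1 - 'X))
         (- (be2 g \Po (1 - 'X))) (- (be1 g \Po (1 - 'X))).

(* Swapping the two patches of a standard interface (h1, h2) puts it in the
   standard form (h2 + quarter turn, h1 - quarter turn). *)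
Definition analysis_suitable_G1 : Prop :=
  forall h1 h2, standard_interface h1 h2 ->
  let g := gd h1 h2 in
  [/\ [/\ (size (al1 g) <= 2)%N, (size (al2 g) <= 2)%N,
          (size (be1 g) <= 2)%N & (size (be2 g) <= 2)%N],
      coprimep (al1 g) (al2 g),
      (forall t : R, 0 <= t <= 1 -> 0 < (al1 g).[t] * (al2 g).[t]),
      (forall t : R, 0 <= t <= 1 ->
         (al1 g).[t] *: d2 (param h2) (t, 0)
         + (al2 g).[t] *: d1 (param h1) (0, t)
         + (gluing_beta g).[t] *: d2 (param h1) (0, t) = 0) &
      gd (h2.1, h2.2 + 1) (h1.1, h1.2 - 1) = swap_gluing g].

(* Functions given separately on every closed patch.  Zero extensions of patch
   and edge functions are two-valued on interfaces, and sums of them are taken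
   patch by patch; summing pointwise values on the closed patches would give
   the vertex functions the value 0 at an interior vertex. *)
Notation broken := (I -> plane -> R^o).

(* The function on param h (unit_square) with pull-back g, zero elsewhere. *)
Definition push (h : rpatch I) (g : plane -> R) : plane -> R^o := fun x =>
  if `[< (param h @` unit_square) x >]
  then g (xget (0, 0) [set xi | unit_square xi /\ param h xi = x]) else 0.

Definition on_patch (h : rpatch I) (g : plane -> R) : broken := fun i =>
  if i == h.1 then push h g else 0.

Definition pull (u : broken) (h : rpatch I) : plane -> R^o := fun xi =>
  u h.1 (param h xi).

(* The function on the closure of Omega with the given restrictions; for
   restrictions that agree on interfaces the choice of patch is immaterial. *)
Definition glue (u : broken) : plane -> R^o := fun x =>
  if [pick i | `[< closed_patch i x >]] is Some i then u i x else 0.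

Variables (p r n : nat).

Local Notation N := (spline_dim p r n).
Local Notation Nminus := (spline_dim p.-1 r n).
Local Notation b := (@bspline R p r n).
Local Notation bplus := (@bspline R p r.+1 n).
Local Notation bminus := (@bspline R p.-1 r n).

Definition c0 (t : R) : R := b 0 t + b 1 t.
Definition c1 (t : R) : R := n%:R^-1 / p%:R * b 1 t.

Definition patch_fun (h : rpatch I) (j : nat * nat) : broken :=
  on_patch h (fun xi => b j.1 xi.1 * b j.2 xi.2).

Definition edge_fun (e : edge_form I) (j : nat * nat) : broken :=
  match e with
  | Interface h1 h2 =>
      let g := gd h1 h2 in
      if j.2 == 0%N then
        on_patch h1 (fun xi => bplus j.1 xi.2 * c0 xi.1
          - (be1 g).[xi.2] * deriv01 (bplus j.1) xi.2 * c1 xi.1)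
        + on_patch h2 (fun xi => bplus j.1 xi.1 * c0 xi.2
          - (be2 g).[xi.1] * deriv01 (bplus j.1) xi.1 * c1 xi.2)
      else
        on_patch h1 (fun xi => (al1 g).[xi.2] * bminus j.1 xi.2 * b 1 xi.1)
        + on_patch h2
            (fun xi => - ((al2 g).[xi.1] * bminus j.1 xi.1 * b 1 xi.2))
  | Boundary1 h =>
      if j.2 == 0%N then on_patch h (fun xi => bplus j.1 xi.2 * c0 xi.1)
      else on_patch h (fun xi => bminus j.1 xi.2 * b 1 xi.1)
  | Boundary2 h =>
      if j.2 == 0%N then on_patch h (fun xi => bplus j.1 xi.1 * c0 xi.2)
      else on_patch h (fun xi => bminus j.1 xi.1 * b 1 xi.2)
  end.

Definition patch_space (i : I) : set (plane -> R^o) :=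
  lspan [set f | exists j : nat * nat,
    [/\ (2 <= j.1 <= N - 3)%N, (2 <= j.2 <= N - 3)%N &
        f = glue (patch_fun (i, 0) j)]].

Definition edge_space (e : edge_form I) : set (plane -> R^o) :=
  lspan [set f | exists j : nat * nat,
    [/\ (j.2 <= 1)%N, (3 <= j.1 + j.2)%N, (j.1 <= Nminus - 3)%N &
        f = glue (edge_fun e j)]].

(* Functions on the closure of Omega that are smooth up to the boundary of
   each closed patch, with matching derivatives up to order 2 at x. *)
Definition C2_at (x : plane) : set (plane -> R^o) :=
  [set phi | exists psi : I -> plane -> R^o,
     [/\ (forall i, smooth (psi i)),
         (forall i y, closed_patch i y -> phi y = psi i y) &
         forall i i' s, closed_patch i x -> closed_patch i' x ->
           (size s <= 2)%N -> partials s (psi i) x = partials s (psi i') x]].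

Definition same_corner_derivs (f g : plane -> R^o) (m1 m2 : nat) : Prop :=
  dmix m1 m2 f (0, 0) = dmix m1 m2 g (0, 0).

Definition patch_proj (h : rpatch I) (phi : plane -> R^o) : broken :=
  xget 0 [set u |
    lspan [set w | exists j : nat * nat,
      [/\ (j.1 <= 1)%N, (j.2 <= 1)%N & w = patch_fun h j]] u /\
    forall m1 m2, (m1 <= 1)%N -> (m2 <= 1)%N ->
      same_corner_derivs (pull u h) (phi \o param h) m1 m2].

Definition first_patch (e : edge_form I) : option (rpatch I) :=
  match e with
  | Interface h1 _ => Some h1 | Boundary1 h => Some h | Boundary2 _ => None
  end.
Definition second_patch (e : edge_form I) : option (rpatch I) :=
  match e with
  | Interface _ h2 => Some h2 | Boundary1 _ => None | Boundary2 h => Some h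
  end.

Definition edge_proj (e : edge_form I) (phi : plane -> R^o) : broken :=
  xget 0 [set u |
    [/\ lspan [set w | exists j : nat * nat,
          [/\ (j.2 <= 1)%N, (j.1 + j.2 <= 2)%N & w = edge_fun e j]] u,
        (forall h m1 m2, first_patch e = Some h ->
           (m1 + m2 <= 2)%N -> (m1 <= 1)%N ->
           same_corner_derivs (pull u h) (phi \o param h) m1 m2) &
        (forall h m1 m2, second_patch e = Some h ->
           (m1 + m2 <= 2)%N -> (m2 <= 1)%N ->
           same_corner_derivs (pull u h) (phi \o param h) m1 m2)]].

Definition vertex_edges (v : vertex_form I) : seq (edge_form I) :=
  let nu := valence v in
  let h := vpatch v in
  if interior_vertex v then
    [seq Interface (h l) (h (l.+1 %% nu)%N) | l <- iota 0 nu]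
  else
    Boundary2 (h 0%N) ::
    rcons [seq Interface (h l) (h l.+1) | l <- iota 0 nu.-1]
          (Boundary1 (h nu.-1)).

(* In the alternating sum the edges have odd and the patches even index. *)
Definition vertex_proj (v : vertex_form I) (phi : plane -> R^o) : broken :=
  \sum_(e <- vertex_edges v) edge_proj e phi
  - \sum_(l < valence v) patch_proj (vpatch v l) phi.

Definition vertex_space (x : plane) (v : vertex_form I) : set (plane -> R^o) :=
  [set glue (vertex_proj v phi) | phi in C2_at x].

Definition argyris_summand (E X : finType) (vert : X -> plane)
    (eform : E -> edge_form I) (vform : X -> vertex_form I)
    (s : I + E + X) : set (plane -> R^o) :=
  match s with
  | inl (inl i) => patch_space i
  | inl (inr e) => edge_space (eform e)
  | inr x => vertex_space (vert x) (vform x)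
  end.

Definition argyris_space (E X : finType) (vert : X -> plane)
    (eform : E -> edge_form I) (vform : X -> vertex_form I) :
    set (plane -> R^o) :=
  subspace_sum (argyris_summand vert eform vform).

End Gluing.

End Domain.

(* Main.v *)
Require Import Defs.
From mathcomp Require Import all_boot all_order all_algebra.
From mathcomp Require Import all_classical all_reals all_analysis.
From mathcomp Require Import ring lra zify.
Import Order.TTheory GRing.Theory Num.Theory.
Import numFieldNormedType.Exports.

(* Every function is pulled back to the unit square along each of the four
   rotations of each patch.  At a corner of the square a vertex function is
   determined by its 2-jet: the gluing identity and its tangential derivative,
   together with the symmetry of the second derivatives, show that the edge
   element interpolating on one side of an interface interpolates on the other
   side as well, and the alternating sum of edge and patch interpolants then has
   the 2-jet of the interpolated function at its own vertex and the zero 2-jet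
   at all others.  The remaining functions have vanishing 2-jets at all corners,
   so the 2-jets of quadratic polynomials give the six vertex coefficients.
   Once the vertex part is removed, trace and transversal derivative along an
   edge determine the coefficients of that edge, as the patch functions and the
   other edge functions vanish there to second order; what is left is a tensor
   product B-spline expansion on every patch. *)

Set Implicit Arguments.
Unset Strict Implicit.
Unset Printing Implicit Defensive.
Local Open Scope classical_set_scope.
Local Open Scope ring_scope.

(** * Linear algebra *)

(** The vertex interpolants work by inclusion and exclusion. At a corner one edge interpolant
    matches the derivatives with [m1 <= 1], the other those with [m2 <= 1], and the patch
    interpolant those with both at most 1. Only the pure second derivatives are left over, and they
    cancel: [c0] and [c1] span the same functions as the first two B-splines, so for an edge and for
    a patch function alike the second transversal derivative is the same combination of the value
    and the first derivative. The bound on [n] says exactly that the dimension of the spline space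
    of degree [p - 1] is at least 5. Then the functions attached to one end of an edge vanish to the
    required order at the other end, so that different vertices do not interact. The obstacle is
    that [glue] chooses a patch at points of several closed patches, so a vanishing sum can be used
    patch by patch only over open squares. Jets, traces and transversal derivatives therefore have
    to be recovered from the inside; jets are carried by functions on the whole plane that agree
    with the given ones only in the closed quadrant near the corner. *)

Section FreeFamilies.
Context {R : realType} {V : lmodType R}.

Lemma lspan_sum (K : finType) (S : set V) (b : K -> V) (c : K -> R) :
  (forall k, S (b k)) -> lspan S (\sum_k c k *: b k).
Proof.
move=> H; exists #|K|, (fun i => c (enum_val i)), (fun i => b (enum_val i)); split=> //.
by rewrite (reindex (@enum_val K K)) //=; apply: onW_bij; exact: enum_val_bij.
Qed.

Lemma lspan_range (K : finType) (b : K -> V) (v : V) :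
  lspan (range b) v <-> exists c : K -> R, v = \sum_k c k *: b k.
Proof.
split=> [[m [c [u [Hu ->]]]]|[c ->]].
  have /choice[f Hf] : forall i, exists k, b k = u i.
    by move=> i; have [k _ <-] := Hu i; exists k.
  exists (fun k => \sum_(i | f i == k) c i).
  rewrite (partition_big f xpredT) //=; apply: eq_bigr => k _.
  by rewrite scaler_suml; apply: eq_bigr => i /eqP <-; rewrite Hf.
by apply: lspan_sum => k; exists k.
Qed.

Lemma has_dim_range (K : finType) (b : K -> V) (S : set V) (d : nat) :
  S = lspan (range b) ->
  (forall c : K -> R, \sum_k c k *: b k = 0 -> forall k, c k = 0) ->
  #|K| = d -> has_dim S d.
Proof.
move=> -> free <-; exists (fun i => b (enum_val i)); split.
  move=> c Hc i; rewrite -(enum_valK i).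
  apply: (free (fun k => c (enum_rank k))).
  rewrite (reindex (@enum_val K K)) /=; last by apply: onW_bij; exact: enum_val_bij.
  by rewrite -[RHS]Hc; apply: eq_bigr => j _; rewrite enum_valK.
congr lspan; apply/seteqP; split=> _ [k _ <-].
  by exists (enum_rank k) => //=; rewrite enum_rankK.
by exists (enum_val k).
Qed.

Lemma sum_tagged (J : finType) (K : J -> finType) (f : forall j, K j -> V) :
  \sum_j \sum_k f j k = \sum_(p : {j : J & K j}) f (tag p) (tagged p).
Proof. by rewrite (sig_big_dep _ (fun _ => xpredT)). Qed.

Section Direct.
Context {J : finType} (K : J -> finType) (b : forall j, K j -> V).
Hypothesis free : forall c : (forall j, K j -> R),
  \sum_j \sum_k c j k *: b k = 0 -> forall j k, c j k = 0.

Lemma independent_lspan : independent_subspaces (fun j => lspan (range (@b j))).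
Proof.
move=> u Su u0 j.
have c0 j' : {c : K j' -> R | u j' = \sum_k c k *: b k}.
  by apply: cid; apply/lspan_range; exact: Su.
rewrite (svalP (c0 j)).
have E : \sum_j0 \sum_k sval (c0 j0) k *: b k = 0.
  by rewrite -[RHS]u0; apply: eq_bigr => j0 _; rewrite {2}(svalP (c0 j0)).
by rewrite big1 // => k _; rewrite (free E) scale0r.
Qed.

Lemma free_block j (c : K j -> R) : \sum_k c k *: b k = 0 -> forall k, c k = 0.
Proof.
move=> c0 k.
(* The family extends [c] by zero to the other blocks. The blocks have different index types, so an
   equality of block indices is needed to transport [k]. *)
pose c' j' : K j' -> R := match pselect (j = j') with
  | left e => fun k => c (eq_rect_r (fun j => K j) k e) | right _ => fun=> 0 end.
have c'j : c' j = c.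
  rewrite /c'; case: pselect => // e; rewrite (Prop_irrelevance e erefl); exact/funext.
rewrite -c'j; apply: free; rewrite (bigD1 j) //= c'j c0 add0r big1 // => j' jj'.
rewrite big1 // => k' _; rewrite /c'; case: pselect => [e|_]; last by rewrite scale0r.
by rewrite e eqxx in jj'.
Qed.

Lemma has_dim_sum d : (\sum_j #|K j|)%N = d ->
  has_dim (subspace_sum (fun j => lspan (range (@b j)))) d.
Proof.
move=> <-.
pose B (p : {j : J & K j}) := b (tagged p).
apply: (@has_dim_range _ B).
- apply/seteqP; split=> v.
  + move=> [u Su ->].
    have /(_ _)/cid c0 := fun j => (lspan_range (@b j) (u j)).1 (Su j).
    apply/lspan_range; exists (fun p => sval (c0 (tag p)) (tagged p)).
    rewrite -(sum_tagged (fun j k => sval (c0 j) k *: b k)).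
    by apply: eq_bigr => j _; rewrite {1}(svalP (c0 j)).
  + move=> /lspan_range[c ->].
    exists (fun j => \sum_k c (Tagged (fun j => K j) k) *: @b j k).
      by move=> j; apply/lspan_range; exists (fun k => c (Tagged (fun j => K j) k)).
    rewrite (sum_tagged (fun j k => c (Tagged (fun j => K j) k) *: @b j k)).
    by apply: eq_bigr => -[].
- move=> c c0 [j k].
  apply: (free (c := fun j k => c (Tagged (fun j => K j) k))).
  rewrite -[RHS]c0 (sum_tagged (fun j k => c (Tagged (fun j => K j) k) *: @b j k)).
  by apply: eq_bigr => -[].
- by rewrite card_tagged sumnE big_map big_enum.
Qed.

End Direct.
End FreeFamilies.

(** * Second order jets at a corner *)

Section Deriv01.
Context {R : realType} {V : normedModType R}.
Implicit Types (f g : R -> V).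

(** Properness makes limits along this filter unique, which every evaluation of [deriv01] relies
    on. *)
Lemma within01_proper (x : R) : 0 <= x <= 1 ->
  ProperFilter (within `[0, 1] x^').
Proof.
move=> /andP[x0 x1]; apply: Build_ProperFilter => /nbhs_ballP[e /= e0 He].
(* Every point of [0,1] has room of length 1/2 on one side, so a step of at most 1/2 to that side
   stays inside. *)
pose d := Num.min (e / 2) (1 / 2).
have d0 : 0 < d by rewrite lt_min; apply/andP; split; lra.
have de : d < e by rewrite /d gt_min; apply/orP; left; lra.
have d1 : d <= 1 / 2 by rewrite /d ge_min lexx orbT.
have [xh|xh] := leP x (1 / 2).
- apply: (He (x + d)).
  + by rewrite /ball /= opprD addrA subrr sub0r normrN gtr0_norm.
  + by apply/eqP; lra.
  + by rewrite /= in_itv /=; apply/andP; split; lra.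
- apply: (He (x - d)).
  + by rewrite /ball /= opprB addrC subrK gtr0_norm.
  + by apply/eqP; lra.
  + by rewrite /= in_itv /=; apply/andP; split; lra.
Qed.

(** The limit only sees points of [0,1], where [f] and [g] agree near [x]; the two-sided derivative
    of [g] thus gives the relative one of [f], at the end points too. Parametric derivatives are
    evaluated below through such an extension [g]. *)
Lemma deriv01_eq f g (x : R) (l : V) : 0 <= x <= 1 ->
  (exists2 e, 0 < e & forall y, 0 <= y <= 1 -> `|y - x| < e -> f y = g y) ->
  is_derive x (1 : R) g l -> deriv01 f x = l.
Proof.
move=> x01 [e e0 fg] [gd gl].
have := within01_proper x01 => PF.
apply: cvg_lim => //.
apply/cvgrPdist_lt => k k0.
move: gd; rewrite /derivable => /cvg_ex[/= l' hl'].
have ll' : l' = l by rewrite -gl /derive; apply/esym/cvg_lim.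
move: hl'; rewrite {}ll' => /cvgrPdist_lt/(_ k k0).
move=> /nbhs_ballP[d /= d0 Hd].
apply/nbhs_ballP; exists (Num.min d e) => /=; first by rewrite lt_min d0 e0.
move=> y; rewrite /ball /= lt_min => /andP[yd ye] yx.
rewrite /= in_itv /= => y01.
rewrite fg//; last by rewrite distrC.
rewrite fg//; last by rewrite subrr normr0.
have := Hd (y - x); rewrite /ball /= sub0r normrN distrC => /(_ yd).
by rewrite subr_eq0 => /(_ yx); rewrite /shift /= scaler1 subrK.
Qed.

(** Reflected form, for corners at which a coordinate is 1; the reflection produces the sign. *)
Lemma deriv01_eq_rev f g (x : R) (l : V) : 0 <= x <= 1 ->
  (exists2 e, 0 < e & forall y, 0 <= y <= 1 -> `|y - x| < e -> f (1 - y) = g y) ->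
  is_derive x (1 : R) g l -> deriv01 f (1 - x) = - l.
Proof.
move=> /andP[x0 x1] [e e0 fg] [gd gl].
have PF : ProperFilter (within `[0, 1] (1 - x)^').
  by apply: within01_proper; apply/andP; split; lra.
apply: cvg_lim => //.
apply/cvgrPdist_lt => k k0.
move: gd; rewrite /derivable => /cvg_ex[/= l' hl'].
have ll' : l' = l by rewrite -gl /derive; apply/esym/cvg_lim.
move: hl'; rewrite {}ll' => /cvgrPdist_lt/(_ k k0).
move=> /nbhs_ballP[d /= d0 Hd].
apply/nbhs_ballP; exists (Num.min d e) => /=; first by rewrite lt_min d0 e0.
move=> y; rewrite /ball /= lt_min => /andP[yd ye] yx.
rewrite /= in_itv /= => /andP[y0 y1].
have yz : y - (1 - x) = - (1 - y - x) by rewrite !opprB; lra.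
rewrite -[y in f y](subKr 1) !fg; last 4 first.
- by rewrite x0 x1.
- by rewrite subrr normr0.
- by apply/andP; split; lra.
- by rewrite addrAC.
rewrite yz invrN scaleNr opprK addrC distrC.
have := Hd (1 - y - x); rewrite /ball /= sub0r normrN addrAC => /(_ yd).
have w0 : 1 - x - y != 0 by rewrite subr_eq0 eq_sym.
by move=> /(_ w0); rewrite /shift /= scaler1 addrAC subrK.
Qed.

End Deriv01.

(** * The chain rule in the plane and the symmetry of second partial derivatives *)

Section Chain.
Context {R : realType}.
Implicit Types (psi : plane R -> R^o) (p q : R -> R).

Lemma is_derive_pair p q (t dp dq : R) :
  is_derive t (1 : R) p dp -> is_derive t (1 : R) q dq ->
  is_derive t (1 : R) (fun s => (p s, q s) : plane R) ((dp, dq) : plane R).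
Proof.
move=> [pd pl] [qd ql].
have pD : differentiable (p : R -> R^o) t by apply/derivable1_diffP.
have qD : differentiable (q : R -> R^o) t by apply/derivable1_diffP.
have D : differentiable (fun s => (p s, q s) : plane R) t.
  exact: differentiable_pair.
split; first exact/derivable1_diffP.
rewrite deriveE //.
have -> : 'd (fun s : R => (p s, q s) : plane R) t = (fun y => ('d (p : R -> R^o) t y,
  'd (q : R -> R^o) t y)) :> (R -> plane R).
  exact: diff_pair.
by rewrite -!deriveE // pl ql.
Qed.

Lemma is_derive_comp psi p q (t dp dq : R) :
  differentiable psi (p t, q t) ->
  is_derive t (1 : R) p dp -> is_derive t (1 : R) q dq ->
  is_derive t (1 : R) (fun s => psi (p s, q s))
    (dp * 'D_(cartesian_dir false) psi (p t, q t)
     + dq * 'D_(cartesian_dir true) psi (p t, q t)).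
Proof.
move=> psiD pD qD.
have [gD gl] := is_derive_pair pD qD.
have gdiff : differentiable (fun s => (p s, q s) : plane R) t.
  exact/derivable1_diffP.
have cD : differentiable (psi \o (fun s => (p s, q s))) t.
  exact: differentiable_comp.
split; first exact/derivable1_diffP.
rewrite deriveE // (_ : (fun s => _) = psi \o (fun s => (p s, q s))) //.
rewrite diff_comp //= -(deriveE _ gdiff) gl.
rewrite (deriveE (cartesian_dir false) psiD) (deriveE (cartesian_dir true) psiD).
have -> : (dp, dq) = dp *: cartesian_dir false + dq *: cartesian_dir true :> plane R.
  congr (_, _) => /=.
    by rewrite /cartesian_dir /GRing.scale /= mulr1 mulr0 addr0.
  by rewrite /cartesian_dir /GRing.scale /= mulr1 mulr0 add0r.
by rewrite linearD !linearZ.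
Qed.

Lemma is_derive_axis1 psi (x y : R) : differentiable psi (x, y) ->
  is_derive x (1 : R) (fun s => psi (s, y)) ('D_(cartesian_dir false) psi (x, y)).
Proof.
move=> D; have := @is_derive_comp psi id (cst y) x 1 0 D (is_derive_id _ _) (is_derive_cst _ _ _).
by rewrite mul1r mul0r addr0.
Qed.

Lemma is_derive_axis2 psi (x y : R) : differentiable psi (x, y) ->
  is_derive y (1 : R) (fun s => psi (x, s)) ('D_(cartesian_dir true) psi (x, y)).
Proof.
move=> D; have := @is_derive_comp psi (cst x) id y 0 1 D (is_derive_cst _ _ _) (is_derive_id _ _).
by rewrite mul1r mul0r add0r.
Qed.

Lemma MVT_all (f df : R -> R) (a b : R) : a < b ->
  (forall x, is_derive x (1 : R) f (df x)) ->
  exists2 c, a < c < b & f b - f a = df c * (b - a).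
Proof.
move=> ab fd.
have cf : {within `[a, b], continuous f}.
  apply: continuous_subspaceT => x.
  have [D _] := fd x.
  by apply: differentiable_continuous; apply/derivable1_diffP.
have [c] := @MVT R f df a b ab (fun x _ => fd x) cf.
by rewrite in_itv /= => cab E; exists c.
Qed.

(** The second difference over a square of side [h], by the mean value theorem in the first and then
    in the second variable. The twin with the opposite order completes the classical proof of
    Schwarz's theorem. *)
Lemma mixed_increment psi (u v h : R) : 0 < h ->
  (forall x, differentiable psi x) ->
  (forall x, differentiable ('D_(cartesian_dir false) psi : plane R -> R^o) x) ->
  exists2 z : plane R, (u < z.1 < u + h) && (v < z.2 < v + h) &
    psi (u + h, v + h) - psi (u, v + h) - (psi (u + h, v) - psi (u, v))
    = 'D_(cartesian_dir true) ('D_(cartesian_dir false) psi) z * h * h.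
Proof.
move=> h0 D1 D2.
pose g := fun s => psi (s, v + h) - psi (s, v).
pose dg := fun s => 'D_(cartesian_dir false) psi (s, v + h) - 'D_(cartesian_dir false) psi (s, v).
have uh : u < u + h by lra.
have vh : v < v + h by lra.
have [|c cu E] := @MVT_all g dg _ _ uh.
  by move=> x; apply: is_deriveB; apply: is_derive_axis1.
have [|d dv E2] := @MVT_all (fun s => 'D_(cartesian_dir false) psi (c,
  s)) (fun s => 'D_(cartesian_dir true) ('D_(cartesian_dir false) psi) (c, s)) _ _ vh.
  by move=> x; apply: is_derive_axis2.
exists (c, d); first by rewrite /= cu dv.
move: E; rewrite /g /dg E2 !(addrC _ h) !addrK => <-; lra.
Qed.

Lemma mixed_increment' psi (u v h : R) : 0 < h ->
  (forall x, differentiable psi x) ->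
  (forall x, differentiable ('D_(cartesian_dir true) psi : plane R -> R^o) x) ->
  exists2 z : plane R, (u < z.1 < u + h) && (v < z.2 < v + h) &
    psi (u + h, v + h) - psi (u, v + h) - (psi (u + h, v) - psi (u, v))
    = 'D_(cartesian_dir false) ('D_(cartesian_dir true) psi) z * h * h.
Proof.
move=> h0 D1 D2.
pose g := fun s => psi (u + h, s) - psi (u, s).
pose dg := fun s => 'D_(cartesian_dir true) psi (u + h, s) - 'D_(cartesian_dir true) psi (u, s).
have uh : u < u + h by lra.
have vh : v < v + h by lra.
have [|c cv E] := @MVT_all g dg _ _ vh.
  by move=> x; apply: is_deriveB; apply: is_derive_axis2.
have [|d du E2] := @MVT_all (fun s => 'D_(cartesian_dir true) psi (s,
  c)) (fun s => 'D_(cartesian_dir false) ('D_(cartesian_dir true) psi) (s, c)) _ _ uh.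
  by move=> x; apply: is_derive_axis1.
exists (d, c); first by rewrite /= cv du.
move: E; rewrite /g /dg E2 !(addrC _ h) !addrK => <-; lra.
Qed.

Lemma smooth_partial psi b : smooth psi -> smooth ('D_(cartesian_dir b) psi : plane R -> R^o).
Proof.
move=> S s x; have := S (rcons s b) x.
by rewrite /partials foldr_rcons.
Qed.

Lemma smooth_diff psi x : smooth psi -> differentiable psi x.
Proof. by move=> /(_ [::] x). Qed.

Lemma mulI2 (a b h : R) : 0 < h -> a * h * h = b * h * h -> a = b.
Proof. by move=> h0 /(mulIf (lt0r_neq0 h0))/(mulIf (lt0r_neq0 h0)). Qed.

Lemma pos_below2 (a b : R) : 0 < a -> 0 < b ->
  exists2 h, 0 < h & (h < a) /\ (h < b).
Proof.
move=> a0 b0; exists (Num.min a b / 2).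
  by rewrite divr_gt0 // lt_min a0.
have ha : Num.min a b <= a by rewrite ge_min lexx.
have hb : Num.min a b <= b by rewrite ge_min lexx orbT.
by split; lra.
Qed.

Lemma ball_increment (u h a z : R) : h < a -> u < z < u + h -> `|u - z| < a.
Proof. by move=> ha /andP[uz zu]; rewrite ltr_norml; apply/andP; split; lra. Qed.

(** If the values at [(u, v)] differed, continuity would keep all values of [A] away from those of
    [B] on a small box. The points [z] and [w] are separate because the two orders of the mean value
    theorem produce different ones. *)
Lemma eq_of_box_values (A B : plane R -> R^o) (u v : R) :
  {for ((u, v) : plane R), continuous A} -> {for ((u, v) : plane R), continuous B} ->
  (forall h, 0 < h -> exists z w : plane R,
     [/\ (u < z.1 < u + h) && (v < z.2 < v + h),
         (u < w.1 < u + h) && (v < w.2 < v + h) & A z = B w]) ->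
  A (u, v) = B (u, v).
Proof.
move=> cA cB H.
apply/eqP; rewrite -subr_eq0; apply: contraT => AB.
have e0 : 0 < `|A (u, v) - B (u, v)| / 2 by rewrite divr_gt0 // normr_gt0.
move/cvgrPdist_lt : cA => /(_ _ e0) /nbhs_ballP[a /= a0 HA].
move/cvgrPdist_lt : cB => /(_ _ e0) /nbhs_ballP[b /= b0 HB].
have [h h0 [ha hb]] := pos_below2 a0 b0.
have [[z1 z2] [[w1 w2] [/= /andP[zh1 zh2] /andP[wh1 wh2] E]]] := H h h0.
have /= h1 := HA (z1, z2).
have /= h2 := HB (w1, w2).
suff : `|A (u, v) - B (u, v)| < `|A (u, v) - B (u, v)| by rewrite ltxx.
have {1}-> : A (u, v) - B (u, v) = (A (u, v) - A (z1, z2)) - (B (u, v) - B (w1, w2)).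
  by rewrite E opprB addrA subrK.
apply: le_lt_trans (ler_normB _ _) _.
rewrite [ltRHS]splitr; apply: ltrD; [apply: h1|apply: h2];
  by split; apply: ball_increment; eassumption.
Qed.

Lemma partial_commute psi (z : plane R) : smooth psi ->
  'D_(cartesian_dir true) ('D_(cartesian_dir false) psi) z
  = 'D_(cartesian_dir false) ('D_(cartesian_dir true) psi) z.
Proof.
move=> S; case: z => u v.
have D0 x := smooth_diff x S.
have D1 b x := smooth_diff x (smooth_partial b S).
have D2 b b' x := smooth_diff x (smooth_partial b (smooth_partial b' S)).
apply: (@eq_of_box_values ('D_(cartesian_dir true) ('D_(cartesian_dir false) psi))
  ('D_(cartesian_dir false) ('D_(cartesian_dir true) psi)) u v).
- exact: differentiable_continuous (D2 true false _).
- exact: differentiable_continuous (D2 false true _).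
move=> h h0.
have [z zh Ez] := mixed_increment u v h0 D0 (D1 false).
have [w wh Ew] := mixed_increment' u v h0 D0 (D1 true).
exists z, w; split; [exact: zh|exact: wh|].
exact: mulI2 h0 (etrans (esym Ez) Ew).
Qed.

End Chain.

(** * Polynomial germs at 0 and 2-jets at the corner of the quadrant *)

Section Jets.
Context {R : realType}.
Implicit Types (u v f : R -> R) (g : plane R -> R^o) (J : nat -> nat -> R)
  (D : nat -> nat -> R -> R -> R) (q : {poly R}).

(** Splines are polynomials just to the right of 0, so a polynomial records the one-sided germ; the
    germ at 1 is that of [fun t => f (1 - t)]. *)
Definition germ (f : R -> R) q :=
  exists2 e, 0 < e & forall t, 0 <= t < e -> f t = q.[t].

Lemma pos_min (a b : R) : 0 < a -> 0 < b ->
  exists c, [/\ 0 < c, c <= a & c <= b].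
Proof.
move=> a0 b0; exists (Num.min a b).
by rewrite lt_min a0 b0 !ge_min !lexx orbT.
Qed.

Lemma pos_minP (a b : R) : 0 < a -> 0 < b ->
  exists2 c, 0 < c & forall t, t < c -> t < a /\ t < b.
Proof.
move=> a0 b0; exists (Num.min a b); first by rewrite lt_min a0 b0.
by move=> t; rewrite lt_min => /andP[].
Qed.

Lemma germ_lin (a : R) f f' q q' : germ f q -> germ f' q' ->
  germ (fun t => a * f t + f' t) (a *: q + q').
Proof.
move=> [e e0 H] [e' e'0 H'].
have [c c0 Hc] := pos_minP e0 e'0.
exists c => // t /andP[t0 /Hc[te te']].
by rewrite H ?t0 // H' ?t0 // hornerD hornerZ.
Qed.

Lemma germ_poly q : germ (horner q) q.
Proof. by exists 1. Qed.

Lemma germ0 : germ (fun _ => 0) 0.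
Proof. by exists 1 => // t _; rewrite horner0. Qed.

Lemma germM f f' q q' : germ f q -> germ f' q' ->
  germ (fun t => f t * f' t) (q * q').
Proof.
move=> [e e0 H] [e' e'0 H'].
have [c c0 Hc] := pos_minP e0 e'0.
exists c => // t /andP[t0 /Hc[te te']].
by rewrite H ?t0 // H' ?t0 // hornerM.
Qed.

Lemma eq_germ f f' q : f =1 f' -> germ f q -> germ f' q.
Proof. by move=> ff [e e0 H]; exists e => // t te; rewrite -ff H. Qed.

Lemma germ_sum (I : Type) (r : seq I) (P : pred I) (c : I -> R) (F : I -> R -> R) (q : I -> {poly
  R}) :
  (forall i, P i -> germ (F i) (q i)) ->
  germ (fun t => \sum_(i <- r | P i) c i * F i t) (\sum_(i <- r | P i) c i *: q i).
Proof.
move=> H; elim: r => [|i r IH].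
  by rewrite big_nil; apply: eq_germ germ0 => t; rewrite big_nil.
rewrite big_cons; case: ifP => Pi; last by apply: eq_germ IH => t; rewrite big_cons Pi.
by apply: eq_germ (germ_lin (c i) (H i Pi) IH) => t; rewrite big_cons Pi.
Qed.

Lemma germ_deriv01 f q : germ f q -> germ (deriv01 (f : R -> R^o)) (q^`()).
Proof.
move=> [e e0 H].
have [c c0 Hc] := pos_minP e0 (@ltr01 R).
exists c => // t /andP[t0 /Hc[te t1]].
apply: (@deriv01_eq R R^o f (horner q)).
- by rewrite t0 ltW.
- exists (e - t); first by rewrite subr_gt0.
  move=> y /andP[y0 _]; rewrite ltr_norml => /andP[_ yt].
  by rewrite H // y0 /=; lra.
Qed.

Lemma germ_deriv01_rev f q : germ (fun t => f (1 - t)) q ->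
  germ (fun t => deriv01 (f : R -> R^o) (1 - t)) (- q^`()).
Proof.
move=> [e e0 H].
have [c c0 Hc] := pos_minP e0 (@ltr01 R).
exists c => // t /andP[t0 /Hc[te t1]].
rewrite (@deriv01_eq R R^o f (horner (q \Po (1 - 'X))) _ (q \Po (1 - 'X))^`().[1 - t]).
- rewrite deriv_comp !hornerE /= derivB derivX derivC sub0r !hornerE.
  by rewrite horner_comp !hornerE opprB addrC subrK mulrN1.
- by apply/andP; split; lra.
- exists (e - t); first by rewrite subr_gt0.
  move=> y /andP[y0 y1]; rewrite ltr_norml => /andP[yt yt'].
  rewrite horner_comp !hornerE -H; first by rewrite opprB addrC subrK.
  by apply/andP; split; lra.
Qed.

(** [D m1 m2] plays the partial derivative of order [(m1, m2)]. Since [D 1 1] is derived both from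
    [D 1 0] and from [D 0 1], the symmetry of mixed derivatives is part of the structure. *)
Definition C2fun D := forall m1 m2, (m1 + m2 < 2)%N -> forall x y,
  is_derive x (1 : R) (D m1 m2 ^~ y) (D m1.+1 m2 x y) /\
  is_derive y (1 : R) (D m1 m2 x) (D m1 m2.+1 x y).

Definition near_corner (e : R) (g : plane R -> R^o) (G : R -> R -> R) :=
  forall x y, 0 <= x < e -> 0 <= y < e -> g (x, y) = G x y.

(* The second order jet at the corner (0, 0) of a function that is C^2 near
   the corner in the closed quadrant. *)
Definition cjet g J := exists D, [/\ C2fun D,
  (exists2 e, 0 < e & near_corner e g (D 0%N 0%N)) &
  forall m1 m2, (m1 + m2 <= 2)%N -> J m1 m2 = D m1 m2 0 0].

Lemma near_corner_d1 (e : R) g D m1 m2 : e <= 1 -> C2fun D -> (m1 + m2 < 2)%N ->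
  near_corner e g (D m1 m2) -> near_corner e (d1 g) (D m1.+1 m2).
Proof.
move=> e1 DC m12 H x y /andP[x0 xe] ye.
have [dx _] := DC _ _ m12 x y.
apply: (deriv01_eq _ _ dx).
- by rewrite /= x0 /=; apply/ltW/(lt_le_trans xe).
- exists (e - x); first by rewrite subr_gt0.
  move=> z /andP[z0 _] /=; rewrite ltr_norml => /andP[_ zx].
  by rewrite /= H // z0 /=; lra.
Qed.

Lemma near_corner_d2 (e : R) g D m1 m2 : e <= 1 -> C2fun D -> (m1 + m2 < 2)%N ->
  near_corner e g (D m1 m2) -> near_corner e (d2 g) (D m1 m2.+1).
Proof.
move=> e1 DC m12 H x y xe /andP[y0 ye].
have [_ dy] := DC _ _ m12 x y.
apply: (deriv01_eq _ _ dy).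
- by rewrite /= y0 /=; apply/ltW/(lt_le_trans ye).
- exists (e - y); first by rewrite subr_gt0.
  move=> z /andP[z0 _] /=; rewrite ltr_norml => /andP[_ zx].
  by rewrite /= H // z0 /=; lra.
Qed.

Lemma near_corner_dmix (e : R) g D m1 m2 : e <= 1 -> C2fun D -> (m1 + m2 <= 2)%N ->
  near_corner e g (D 0%N 0%N) -> near_corner e (dmix m1 m2 g) (D m1 m2).
Proof.
move=> e1 DC m12 H.
have H2 : near_corner e (iter m2 d2 g) (D 0%N m2).
  have : (m2 <= 2)%N by lia.
  elim: m2 {m12} => [//|m2 IH] m2l /=.
  by apply: near_corner_d2 => //; apply: IH; lia.
rewrite /dmix; elim: m1 m12 => [//|m1 IH] m12 /=.
by apply: near_corner_d1 => //; apply: IH; lia.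
Qed.

(** This turns the conditions [same_corner_derivs], by which the projections are defined, into
    equations between jets. *)
Lemma cjet_dmix g J m1 m2 : cjet g J -> (m1 + m2 <= 2)%N ->
  dmix m1 m2 g (0, 0) = J m1 m2.
Proof.
move=> [D [DC [e e0 H] HJ]] m12; rewrite HJ //.
have [c [c0 ce c1]] := pos_min e0 (@ltr01 R).
apply: (@near_corner_dmix c) => //; rewrite ?lexx ?c0 //.
move=> x y /andP[x0 xc] /andP[y0 yc].
by apply: H; rewrite ?x0 ?y0 /=; [exact: lt_le_trans xc ce|exact: lt_le_trans yc ce].
Qed.

Lemma cjet_uniq g J J' m1 m2 : cjet g J -> cjet g J' -> (m1 + m2 <= 2)%N ->
  J m1 m2 = J' m1 m2.
Proof. by move=> H H' m; rewrite -(cjet_dmix H m) (cjet_dmix H' m). Qed.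

Lemma eq_cjet g g' J J' : cjet g J ->
  {in unit_square, g =1 g'} -> (forall m1 m2, (m1 + m2 <= 2)%N -> J m1 m2 = J' m1 m2) ->
  cjet g' J'.
Proof.
move=> [D [DC [e e0 H] HJ]] gg JJ; exists D; split=> //; last first.
  by move=> m1 m2 m; rewrite -JJ // HJ.
have [c [c0 ce c1]] := pos_min e0 (@ltr01 R).
exists c => // x y /andP[x0 xc] /andP[y0 yc].
rewrite -gg; last first.
  by rewrite inE; split => /=; rewrite ?x0 ?y0 /=; apply/ltW;
    [exact: lt_le_trans xc c1|exact: lt_le_trans yc c1].
by apply: H; rewrite ?x0 ?y0 /=; [exact: lt_le_trans xc ce|exact: lt_le_trans yc ce].
Qed.

Lemma cjet_lin (a : R) g g' J J' : cjet g J -> cjet g' J' ->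
  cjet (fun xi => a * g xi + g' xi) (fun m1 m2 => a * J m1 m2 + J' m1 m2).
Proof.
move=> [D [DC [e e0 H] HJ]] [D' [DC' [e' e'0 H'] HJ']].
exists (fun m1 m2 x y => a * D m1 m2 x y + D' m1 m2 x y); split.
- move=> m1 m2 m x y; have [d1x d1y] := DC _ _ m x y.
  have [d2x d2y] := DC' _ _ m x y.
  by split; apply: is_deriveD.
- have [c c0 Hc] := pos_minP e0 e'0.
  exists c => // x y /andP[x0 /Hc[xe xe']] /andP[y0 /Hc[ye ye']].
  by rewrite H ?H' ?x0 ?y0.
- by move=> m1 m2 m; rewrite HJ ?HJ'.
Qed.

Lemma cjet0 : cjet (fun _ => 0) (fun _ _ => 0).
Proof.
exists (fun _ _ _ _ => 0); split => //; last by exists 1.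
by move=> *; split; apply: is_derive_cst.
Qed.

Lemma cjet_sum (I : Type) (r : seq I) (P : pred I) (c : I -> R) (F : I -> plane R -> R^o) (J : I ->
  nat -> nat -> R) :
  (forall i, P i -> cjet (F i) (J i)) ->
  cjet (fun t => \sum_(i <- r | P i) c i * F i t) (fun m1 m2 => \sum_(i <- r | P i) c i * J i m1
    m2).
Proof.
move=> H; elim: r => [|i r IH].
  by apply: (eq_cjet cjet0) => [t _|m1 m2 _]; rewrite big_nil.
case Pi: (P i); last first.
  by apply: (eq_cjet IH) => [t _|m1 m2 _]; rewrite big_cons Pi.
by apply: (eq_cjet (cjet_lin (c i) (H i Pi) IH)) => [t _|m1 m2 _]; rewrite big_cons Pi.
Qed.

Lemma cjet_tensor u v q q' : germ u q -> germ v q' ->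
  cjet (fun xi => u xi.1 * v xi.2) (fun m1 m2 => q^`(m1).[0] * q'^`(m2).[0]).
Proof.
move=> [e e0 H] [e' e'0 H'].
exists (fun m1 m2 x y => q^`(m1).[x] * q'^`(m2).[y]); split.
- move=> m1 m2 _ x y; split.
  + have -> : (fun x0 : R => q^`(m1).[x0] * q'^`(m2).[y]) = q'^`(m2).[y] *: horner q^`(m1).
      by apply/funext => t; rewrite /GRing.scale /= mulrC.
    by rewrite mulrC derivnS; apply: is_deriveZ.
  + have -> : (fun y0 : R => q^`(m1).[x] * q'^`(m2).[y0]) = q^`(m1).[x] *: horner q'^`(m2) by [].
    by rewrite derivnS; apply: is_deriveZ.
- have [c c0 Hc] := pos_minP e0 e'0.
  exists c => // x y /andP[x0 /Hc[xe xe']] /andP[y0 /Hc[ye ye']] /=.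
  by rewrite H ?H' ?x0 ?y0.
- by [].
Qed.

Lemma is_derive_right_eq0 (f : R -> R) (a l e : R) : 0 < e -> is_derive a (1 : R) f l ->
  (forall y, a < y < a + e -> f y = 0) -> f a = 0.
Proof.
move=> e0 [/derivable1_diffP/differentiable_continuous fc _] H.
apply/eqP; apply: contraT => fa.
have k0 : 0 < `|f a| by rewrite normr_gt0.
move/cvgrPdist_lt : fc => /(_ _ k0)/nbhs_ballP[d /= d0 Hd].
have [h h0 [hd he]] := pos_below2 d0 e0.
have := Hd (a + h); rewrite /ball /= opprD addrA subrr sub0r normrN gtr0_norm // => /(_ hd).
have -> : f (a + h) = 0 by apply: H; apply/andP; split; lra.
by rewrite subr0 ltxx.
Qed.

Lemma zero_germ_deriv (f : R -> R) (l e : R) : 0 < e -> is_derive (0 : R) (1 : R) f l ->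
  (forall y, 0 <= y < e -> f y = 0) -> l = 0.
Proof.
move=> e0 fd H.
rewrite -(@deriv01_eq R R^o f f 0 l) ?lexx ?ler01 //; last by exists 1.
rewrite (@deriv01_eq R R^o f (cst 0) 0 0) ?lexx ?ler01 //.
  exists e => // y /andP[y0 _]; rewrite subr0 ger0_norm // => ye.
  by rewrite H // y0.
Qed.

(* Separate differentiability gives separate continuity, which extends the
   vanishing from the open quadrant to its closure, one variable at a time. *)
Lemma cjet_open0 g J m1 m2 : cjet g J ->
  {in open_unit_square, g =1 (fun=> 0)} -> (m1 + m2 <= 2)%N -> J m1 m2 = 0.
Proof.
move=> gJ g0 m; have [D [DC [e e0 H] HJ]] := gJ.
have [c [c0 ce c1]] := pos_min e0 (@ltr01 R).
have D0 x y : 0 < x < c -> 0 < y < c -> D 0%N 0%N x y = 0.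
  move=> /andP[x0 xc] /andP[y0 yc].
  rewrite -H ?(ltW x0) ?(ltW y0) /= ?(lt_le_trans xc ce) ?(lt_le_trans yc ce) //.
  rewrite g0 // inE; split => /=; rewrite ?x0 ?y0 /=.
    exact: lt_le_trans xc c1.
  exact: lt_le_trans yc c1.
have D1 x y : 0 <= x < c -> 0 < y < c -> D 0%N 0%N x y = 0.
  move=> /andP[]; rewrite le_eqVlt => /orP[/eqP<- _ yc|x0 xc yc]; last by rewrite D0 ?x0.
  have [dx _] := DC 0%N 0%N isT 0 y.
  by apply: (is_derive_right_eq0 c0 dx) => z; rewrite add0r => zc; exact: D0.
have D2 x y : 0 <= x < c -> 0 <= y < c -> D 0%N 0%N x y = 0.
  move=> xc /andP[]; rewrite le_eqVlt => /orP[/eqP<- _|y0 yc]; last by rewrite D1 ?y0.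
  have [_ dy] := DC 0%N 0%N isT x 0.
  by apply: (is_derive_right_eq0 c0 dy) => z; rewrite add0r => zc; exact: D1.
(* The system [D] now also witnesses [J] as a jet of the zero function, and jets are unique. *)
have := cjet0 => C0.
rewrite (@cjet_uniq (fun _ => 0) J (fun _ _ => 0)) //.
by exists D; split=> //; exists c => // x y xc yc; rewrite D2.
Qed.

End Jets.

(** * 2-jets of compositions and of the gluing identity *)

Section JetChain.
Context {R : realType}.
Implicit Types (g : plane R -> R^o) (J S P Q : nat -> nat -> R)
  (D : nat -> nat -> R -> R -> R) (q : {poly R}).

(* Second order chain rule: S, P, Q are the jets of the outer function and of
   the two components of the inner one. *)
Definition chain S P Q (m1 m2 : nat) : R :=
  match m1, m2 with
  | 0, 0 => S 0%N 0%N
  | 1, 0 => P 1%N 0%N * S 1%N 0%N + Q 1%N 0%N * S 0%N 1%N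
  | 0, 1 => P 0%N 1%N * S 1%N 0%N + Q 0%N 1%N * S 0%N 1%N
  | 2, 0 => P 2%N 0%N * S 1%N 0%N + Q 2%N 0%N * S 0%N 1%N
            + P 1%N 0%N ^+ 2 * S 2%N 0%N + 2 * P 1%N 0%N * Q 1%N 0%N * S 1%N 1%N + Q 1%N 0%N ^+ 2 *
              S 0%N 2%N
  | 1, 1 => P 1%N 1%N * S 1%N 0%N + Q 1%N 1%N * S 0%N 1%N
            + P 1%N 0%N * P 0%N 1%N * S 2%N 0%N
            + (P 1%N 0%N * Q 0%N 1%N + P 0%N 1%N * Q 1%N 0%N) * S 1%N 1%N
            + Q 1%N 0%N * Q 0%N 1%N * S 0%N 2%N
  | 0, 2 => P 0%N 2%N * S 1%N 0%N + Q 0%N 2%N * S 0%N 1%N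
            + P 0%N 1%N ^+ 2 * S 2%N 0%N + 2 * P 0%N 1%N * Q 0%N 1%N * S 1%N 1%N + Q 0%N 1%N ^+ 2 *
              S 0%N 2%N
  | _, _ => 0
  end.

Definition C2plane (S : nat -> nat -> plane R -> R^o) :=
  forall m1 m2, (m1 + m2 < 2)%N -> forall z,
  [/\ differentiable (S m1 m2) z,
      'D_(cartesian_dir false) (S m1 m2) z = S m1.+1 m2 z &
      'D_(cartesian_dir true) (S m1 m2) z = S m1 m2.+1 z].

Definition iterated_partial (psi : plane R -> R^o) (m1 m2 : nat) : plane R -> R^o :=
  partials (nseq m1 false ++ nseq m2 true) psi.

Lemma smooth_C2plane psi : smooth psi -> C2plane (iterated_partial psi).
Proof.
move=> S m1 m2 m z; split; first exact: (S _ z).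
- by [].
(* [iterated_partial] differentiates in the second variable first, so only the passage from order
   [(1, 0)] to [(1, 1)] needs the symmetry of second partials. *)
case: m1 m2 m => [|[|m1]] [|[|m2]] m; try by exfalso; move: m; rewrite ?addnS ?addSn.
- exact: erefl.
- exact: erefl.
- exact: partial_commute.
Qed.

Lemma is_derive_outer (S : nat -> nat -> plane R -> R^o) (p q dp dq : R -> R) m1 m2 (t : R) :
  C2plane S -> (m1 + m2 < 2)%N ->
  is_derive t (1 : R) p (dp t) -> is_derive t (1 : R) q (dq t) ->
  is_derive t (1 : R) (fun s => S m1 m2 (p s, q s))
    (dp t * S m1.+1 m2 (p t, q t) + dq t * S m1 m2.+1 (p t, q t)).
Proof.
move=> C m pd qd; have [d <- <-] := C _ _ m (p t, q t).
exact: is_derive_comp.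
Qed.

(** The first order entries of [chain] have the form [a * s + b * t]; this product rule yields all
    second order entries from them. *)
Lemma is_derive_dot (a b s t : R -> R) (x da db ds dt : R) :
  is_derive x (1 : R) a da -> is_derive x (1 : R) b db ->
  is_derive x (1 : R) s ds -> is_derive x (1 : R) t dt ->
  is_derive x (1 : R) (fun u => a u * s u + b u * t u)
    (da * s x + a x * ds + (db * t x + b x * dt)).
Proof.
move=> ha hb hs ht.
have h1 := @is_deriveM R R a s x 1 da ds ha hs.
have h2 := @is_deriveM R R b t x 1 db dt hb ht.
have := @is_deriveD R R R _ _ x 1 _ _ h1 h2.
rewrite (_ : a * s + b * t = (fun u => a u * s u + b u * t u)) // => h.
by apply: (is_derive_eq h); rewrite /GRing.scale /=; ring.
Qed.

Lemma cjet_comp psi (S : nat -> nat -> plane R -> R^o) g g' P Q : C2plane S -> S 0%N 0%N = psi ->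
  cjet g P -> cjet g' Q ->
  cjet (fun xi => psi (g xi, g' xi))
    (chain (fun m1 m2 => S m1 m2 (P 0%N 0%N, Q 0%N 0%N)) P Q).
Proof.
move=> CS <- [D [DC [e e0 H] HJ]] [D' [DC' [e' e'0 H'] HJ']].
pose Z x y : plane R := (D 0%N 0%N x y, D' 0%N 0%N x y).
(* The witness is the chain rule at every point, not only at the corner, as [C2fun] asks for
   derivatives everywhere. *)
exists (fun m1 m2 x y => chain (fun a b => S a b (Z x y)) (fun a b => D a b x y) (fun a b => D' a b
  x y) m1 m2); split; last first.
- move=> m1 m2; have /= H0 := HJ 0%N 0%N isT; have /= H0' := HJ' 0%N 0%N isT.
  have /= H1 := HJ 1%N 0%N isT; have /= H1' := HJ' 1%N 0%N isT.
  have /= H2 := HJ 0%N 1%N isT; have /= H2' := HJ' 0%N 1%N isT.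
  have /= H3 := HJ 2%N 0%N isT; have /= H3' := HJ' 2%N 0%N isT.
  have /= H4 := HJ 1%N 1%N isT; have /= H4' := HJ' 1%N 1%N isT.
  have /= H5 := HJ 0%N 2%N isT; have /= H5' := HJ' 0%N 2%N isT.
  by case: m1 m2 => [|[|[|m1]]] [|[|[|m2]]] //= _;
     rewrite ?H0 ?H0' ?H1 ?H1' ?H2 ?H2' ?H3 ?H3' ?H4 ?H4' ?H5 ?H5'.
- have [c c0 Hc] := pos_minP e0 e'0.
  exists c => // x y /andP[x0 /Hc[xe xe']] /andP[y0 /Hc[ye ye']] /=.
  by rewrite H ?H' ?x0 ?y0.
move=> m1 m2 m x y.
have [a00 b00] := DC 0%N 0%N isT x y; have [a00' b00'] := DC' 0%N 0%N isT x y.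
have [a10 b10] := DC 1%N 0%N isT x y; have [a10' b10'] := DC' 1%N 0%N isT x y.
have [a01 b01] := DC 0%N 1%N isT x y; have [a01' b01'] := DC' 0%N 1%N isT x y.
have sx k1 k2 : (k1 + k2 < 2)%N -> is_derive x (1 : R) (fun s => S k1 k2 (Z s y)) _ :=
  fun k => @is_derive_outer S _ _ (D 1%N 0%N ^~ y) (D' 1%N 0%N ^~ y) k1 k2 x CS k a00 a00'.
have sy k1 k2 : (k1 + k2 < 2)%N -> is_derive y (1 : R) (fun s => S k1 k2 (Z x s)) _ :=
  fun k => @is_derive_outer S _ _ (D 0%N 1%N x) (D' 0%N 1%N x) k1 k2 y CS k b00 b00'.
have sx10 := sx 1%N 0%N isT; have sx01 := sx 0%N 1%N isT.
have sy10 := sy 1%N 0%N isT; have sy01 := sy 0%N 1%N isT.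
case: m1 m2 m => [|[|m1]] [|[|m2]] m; try (by exfalso; move: m; rewrite ?addnS ?addSn); split => /=.
- exact: sx.
- exact: sy.
- by apply: (is_derive_eq (is_derive_dot a01 a01' sx10 sx01)); rewrite -/(Z x y); ring.
- by apply: (is_derive_eq (is_derive_dot b01 b01' sy10 sy01)); rewrite -/(Z x y); ring.
- by apply: (is_derive_eq (is_derive_dot a10 a10' sx10 sx01)); rewrite -/(Z x y); ring.
- by apply: (is_derive_eq (is_derive_dot b10 b10' sy10 sy01)); rewrite -/(Z x y); ring.
Qed.

Lemma zero_germ_deriv_at (f : R -> R) (t l e : R) : e <= 1 -> 0 <= t < e ->
  is_derive t (1 : R) f l -> (forall y, 0 <= y < e -> f y = 0) -> l = 0.
Proof.
move=> e1 /andP[t0 te] fd H.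
have t01 : 0 <= t <= 1 by rewrite t0 /= ltW // (lt_le_trans te).
have <- : deriv01 (f : R -> R^o) t = l by apply: (deriv01_eq t01 _ fd); exists 1.
apply: (deriv01_eq t01 _ (is_derive_cst (0 : R^o) t 1)).
exists (e - t); first by rewrite subr_gt0.
move=> y /andP[y0 _]; rewrite ltr_norml => /andP[_ yt].
by apply: H; rewrite y0 /=; lra.
Qed.

Lemma cjet_edge_match g1 g2 J1 J2 m : cjet g1 J1 -> cjet g2 J2 ->
  (forall t, 0 <= t <= 1 -> g1 (0, t) = g2 (t, 0)) -> (m <= 2)%N ->
  J1 0%N m = J2 m 0%N.
Proof.
move=> [D [DC [e e0 H] HJ]] [D' [DC' [e' e'0 H'] HJ']] E m2.
rewrite HJ // HJ' ?addn0 //.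
have [c0 [c00 c0e c0e']] := pos_min e0 e'0.
have [c [cp cc c1]] := pos_min c00 (@ltr01 R).
(* The difference is shown to vanish along a whole segment, which is what permits one more
   differentiation at each step. *)
suff K k : (k <= 2)%N -> forall t, 0 <= t < c -> D 0%N k 0 t - D' k 0%N t 0 = 0.
  by apply/eqP; rewrite -subr_eq0; apply/eqP/K; rewrite ?lexx.
elim: k => [_|k IH k2] t /andP[t0 tc].
  rewrite -H ?lexx ?e0 ?t0 ?(lt_le_trans tc (le_trans cc c0e)) //.
  rewrite -H' ?lexx ?e'0 ?t0 ?(lt_le_trans tc (le_trans cc c0e')) //.
  by rewrite E ?subrr // t0 ltW // (lt_le_trans tc).
have k1 : (0 + k < 2)%N by [].
have k1' : (k + 0 < 2)%N by rewrite addn0.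
have [_ d] := DC _ _ k1 0 t; have [d' _] := DC' _ _ k1' t 0.
apply: (@zero_germ_deriv_at (fun s => D 0%N k 0 s - D' k 0%N s 0) t _ c) => //.
- by rewrite t0.
- by move=> y yc; apply: IH => //; exact: ltnW.
Qed.

Lemma near_corner_plane (G : plane R -> plane R) D D' (e : R) : e <= 1 ->
  C2fun D -> C2fun D' ->
  near_corner e (fun xi => (G xi).1) (D 0%N 0%N) ->
  near_corner e (fun xi => (G xi).2) (D' 0%N 0%N) ->
  forall x y, 0 <= x < e -> 0 <= y < e ->
  d1 G (x, y) = (D 1%N 0%N x y, D' 1%N 0%N x y) /\
  d2 G (x, y) = (D 0%N 1%N x y, D' 0%N 1%N x y).
Proof.
move=> e1 C C' H H' x y /andP[x0 xe] /andP[y0 ye].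
have [a b] := C 0%N 0%N isT x y; have [a' b'] := C' 0%N 0%N isT x y.
have GE u v : 0 <= u < e -> 0 <= v < e -> G (u, v) = (D 0%N 0%N u v, D' 0%N 0%N u v).
  by move=> ue ve; rewrite [LHS]surjective_pairing; congr (_, _); [exact: H|exact: H'].
split.
- apply: (deriv01_eq _ _ (is_derive_pair a a')) => /=.
    by rewrite x0 ltW // (lt_le_trans xe).
  exists (e - x); first by rewrite subr_gt0.
  move=> z /andP[z0 _]; rewrite ltr_norml => /andP[_ zx].
  by apply: GE; rewrite ?y0 ?z0 //=; lra.
- apply: (deriv01_eq _ _ (is_derive_pair b b')) => /=.
    by rewrite y0 ltW // (lt_le_trans ye).
  exists (e - y); first by rewrite subr_gt0.
  move=> z /andP[z0 _]; rewrite ltr_norml => /andP[_ zx].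
  by apply: GE; rewrite ?x0 ?z0 //=; lra.
Qed.

(* The gluing identity along the edge and its tangential derivative, both
   evaluated at the vertex. *)
Definition gluing_jet (a1 a2 b : {poly R}) J1 J2 : Prop :=
  a1.[0] * J2 0%N 1%N + a2.[0] * J1 1%N 0%N + b.[0] * J1 0%N 1%N = 0 /\
  a1^`().[0] * J2 0%N 1%N + a1.[0] * J2 1%N 1%N
  + (a2^`().[0] * J1 1%N 0%N + a2.[0] * J1 1%N 1%N)
  + (b^`().[0] * J1 0%N 1%N + b.[0] * J1 0%N 2%N) = 0.

Lemma gluing_jet_of_germ (a1 a2 b : {poly R}) D1 D2 (e : R) : 0 < e -> e <= 1 ->
  C2fun D1 -> C2fun D2 ->
  (forall t, 0 <= t < e ->
    a1.[t] * D2 0%N 1%N t 0 + a2.[t] * D1 1%N 0%N 0 t + b.[t] * D1 0%N 1%N 0 t = 0) ->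
  gluing_jet a1 a2 b (fun m1 m2 => D1 m1 m2 0 0) (fun m1 m2 => D2 m1 m2 0 0).
Proof.
move=> e0 e1 C1 C2 H; split; first by apply: H; rewrite lexx.
have [d1 _] := C2 0%N 1%N isT 0 0.
have [_ d2] := C1 1%N 0%N isT 0 0.
have [_ d3] := C1 0%N 1%N isT 0 0.
have p1 := is_derive_poly a1 0; have p2 := is_derive_poly a2 0.
have p3 := is_derive_poly b 0.
have h1 := is_derive_dot p1 p2 d1 d2.
have h2 := @is_deriveM R R (horner b) (D1 0%N 1%N 0) 0 1 _ _ p3 d3.
have h := @is_deriveD R R R _ _ 0 1 _ _ h1 h2.
have := zero_germ_deriv e0 h.
move=> h0; rewrite -[RHS]h0; first by rewrite /GRing.scale /=; ring.
exact: H.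
Qed.

Lemma gluing_jet_plane (G1 G2 : plane R -> plane R) P1 Q1 P2 Q2 (a1 a2 b : {poly R}) :
  cjet (fun xi => (G1 xi).1) P1 -> cjet (fun xi => (G1 xi).2) Q1 ->
  cjet (fun xi => (G2 xi).1) P2 -> cjet (fun xi => (G2 xi).2) Q2 ->
  (forall t : R, 0 <= t <= 1 ->
     a1.[t] *: d2 G2 (t, 0) + a2.[t] *: d1 G1 (0, t) + b.[t] *: d2 G1 (0, t) = 0) ->
  gluing_jet a1 a2 b P1 P2 /\ gluing_jet a1 a2 b Q1 Q2.
Proof.
move=> [D1 [C1 [e1 e10 H1] HJ1]] [D1' [C1' [e1' e10' H1'] HJ1']].
move=> [D2 [C2 [e2 e20 H2] HJ2]] [D2' [C2' [e2' e20' H2'] HJ2']] E.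
have [c0 [c00 c0e c0e']] := pos_min e10 e10'.
have [c1 [c10 c1e c1e']] := pos_min e20 e20'.
have [c2 [c20 c2e c2e']] := pos_min c00 c10.
have [c [cp cc cl]] := pos_min c20 (@ltr01 R).
have sub G F (e : R) : c <= e -> near_corner e G F -> near_corner c G F.
  move=> ce N x y /andP[x0 xc] /andP[y0 yc]; apply: N; rewrite ?x0 ?y0 /=;
  exact: lt_le_trans ce.
have := near_corner_plane cl C1 C1' (sub _ _ _ (le_trans cc (le_trans c2e c0e)) H1)
  (sub _ _ _ (le_trans cc (le_trans c2e c0e')) H1').
have := near_corner_plane cl C2 C2' (sub _ _ _ (le_trans cc (le_trans c2e' c1e)) H2)
  (sub _ _ _ (le_trans cc (le_trans c2e' c1e')) H2').
move=> N2 N1.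
have E2 t : 0 <= t < c ->
  a1.[t] * D2 0%N 1%N t 0 + a2.[t] * D1 1%N 0%N 0 t + b.[t] * D1 0%N 1%N 0 t = 0 /\
  a1.[t] * D2' 0%N 1%N t 0 + a2.[t] * D1' 1%N 0%N 0 t + b.[t] * D1' 0%N 1%N 0 t = 0.
  move=> /[dup] tc /andP[t0 /ltW tl].
  have := E t; rewrite t0 (le_trans tl) // => /(_ isT).
  have z0 : 0 <= (0 : R) < c by rewrite lexx.
  have [_ ->] := N2 t 0 tc z0.
  have [-> ->] := N1 0 t z0 tc.
  by move=> X; split; [have := congr1 fst X|have := congr1 snd X].
have g1 := gluing_jet_of_germ cp cl C1 C2 (fun t tc => proj1 (E2 t tc)).
have g2 := gluing_jet_of_germ cp cl C1' C2' (fun t tc => proj2 (E2 t tc)).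
by split; rewrite /gluing_jet ?HJ1 ?HJ1' ?HJ2 ?HJ2'.
Qed.

(** A certificate for linear elimination: [ring] checks the coefficients [c1] to [c4], and spare
    slots repeat an equation with coefficient 0. *)
Lemma lin_comb_eq0 (c1 c2 c3 c4 e1 e2 e3 e4 t : R) :
  e1 = 0 -> e2 = 0 -> e3 = 0 -> e4 = 0 ->
  t = c1 * e1 + c2 * e2 + c3 * e3 + c4 * e4 -> t = 0.
Proof. by move=> -> -> -> -> ->; rewrite !mulr0 !addr0. Qed.

Arguments lin_comb_eq0 c1 c2 c3 c4 {e1 e2 e3 e4 t}.

(** Both relations are linear in the first order part of [S]. In the differentiated one, the second
    order terms of [S] pair the common tangent vector of the edge with the undifferentiated
    relation, which vanishes; this uses that both patches have the same tangent and that [S 1 1] is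
    symmetric. *)
Lemma gluing_jet_chain (a1 a2 b : {poly R}) S P1 Q1 P2 Q2 :
  (forall m, (m <= 2)%N -> P1 0%N m = P2 m 0%N) ->
  (forall m, (m <= 2)%N -> Q1 0%N m = Q2 m 0%N) ->
  gluing_jet a1 a2 b P1 P2 -> gluing_jet a1 a2 b Q1 Q2 ->
  gluing_jet a1 a2 b (chain S P1 Q1) (chain S P2 Q2).
Proof.
move=> MP MQ [p p'] [q q'].
have mp := MP 1%N isT; have mq := MQ 1%N isT.
split => /=.
  apply: (lin_comb_eq0 (S 1%N 0%N) (S 0%N 1%N) 0 0 p q p q); ring.
rewrite -mp -mq.
apply: (lin_comb_eq0 (S 1%N 0%N) (S 0%N 1%N)
   (S 2%N 0%N * P1 0%N 1%N + S 1%N 1%N * Q1 0%N 1%N)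
   (S 1%N 1%N * P1 0%N 1%N + S 0%N 2%N * Q1 0%N 1%N) p' q' p q); ring.
Qed.

(** First derivatives follow by Cramer's rule. The second order part is transformed by the symmetric
    square of the Jacobian matrix; the coefficients below form the symmetric square of its adjugate,
    whence the factor [det ^+ 2]. *)
Lemma chain_eq0 S P Q : P 1%N 0%N * Q 0%N 1%N - P 0%N 1%N * Q 1%N 0%N != 0 ->
  (forall m1 m2, (m1 + m2 <= 2)%N -> chain S P Q m1 m2 = 0) ->
  forall m1 m2, (m1 + m2 <= 2)%N -> S m1 m2 = 0.
Proof.
set det := (X in X != 0) => d0 H.
have /= h00 := H 0%N 0%N isT; have /= h10 := H 1%N 0%N isT.
have /= h01 := H 0%N 1%N isT; have /= h20 := H 2%N 0%N isT.
have /= h11 := H 1%N 1%N isT; have /= h02 := H 0%N 2%N isT.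
have s10 : S 1%N 0%N = 0.
  apply: (mulfI d0); rewrite mulr0.
  by apply: (lin_comb_eq0 (Q 0%N 1%N) (- Q 1%N 0%N) 0 0 h10 h01 h10 h01); rewrite /det; ring.
have s01 : S 0%N 1%N = 0.
  apply: (mulfI d0); rewrite mulr0.
  by apply: (lin_comb_eq0 (- P 0%N 1%N) (P 1%N 0%N) 0 0 h10 h01 h10 h01); rewrite /det; ring.
rewrite s10 s01 !mulr0 !add0r in h20 h11 h02.
have d20 : det ^+ 2 != 0 by rewrite expf_neq0.
have s20 : S 2%N 0%N = 0.
  apply: (mulfI d20); rewrite mulr0.
  by apply: (lin_comb_eq0 (Q 0%N 1%N ^+ 2) (- 2 * Q 0%N 1%N * Q 1%N 0%N) (Q 1%N 0%N ^+ 2) 0 h20 h11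
    h02 h02); rewrite /det; ring.
have s02 : S 0%N 2%N = 0.
  apply: (mulfI d20); rewrite mulr0.
  by apply: (lin_comb_eq0 (P 0%N 1%N ^+ 2) (- 2 * P 0%N 1%N * P 1%N 0%N) (P 1%N 0%N ^+ 2) 0 h20 h11
    h02 h02); rewrite /det; ring.
have s11 : S 1%N 1%N = 0.
  apply: (mulfI d20); rewrite mulr0.
  by apply: (lin_comb_eq0 (- (P 0%N 1%N * Q 0%N 1%N)) (P 1%N 0%N * Q 0%N 1%N + P 0%N 1%N * Q 1%N
    0%N) (- (P 1%N 0%N * Q 1%N 0%N)) 0 h20 h11 h02 h02); rewrite /det; ring.
by case=> [|[|[|m1]]] [|[|[|m2]]].
Qed.

End JetChain.

(** * Prescribing the 2-jet at a vertex *)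

Section Quadratic.
Context {R : realType}.
Implicit Types (x z : plane R) (S : nat -> nat -> R).

(** The Taylor polynomial of degree two at [x] with derivatives [S] there. *)
Definition quad x S : plane R -> R^o := fun y =>
  S 0%N 0%N + S 1%N 0%N * (y.1 - x.1) + S 0%N 1%N * (y.2 - x.2)
  + S 2%N 0%N / 2 * ((y.1 - x.1) * (y.1 - x.1)) + S 1%N 1%N * ((y.1 - x.1) * (y.2 - x.2))
  + S 0%N 2%N / 2 * ((y.2 - x.2) * (y.2 - x.2)).

(** Partial differentiation shifts the orders of a jet; entries of total order two and more become
    zero because [quad] has no cubic terms. *)
Definition shift_jet (b : bool) S (m1 m2 : nat) : R :=
  if (m1 + m2 < 2)%N then (if b then S m1 m2.+1 else S m1.+1 m2) else 0.

Lemma differentiable_coord1 z (a : R) : differentiable (fun y : plane R => y.1 - a : R^o) z.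
Proof.
apply: (@differentiableB R (plane R) R^o fst (cst a)); last exact: differentiable_cst.
apply: (@linear_differentiable R (plane R) R^o fst).
by move=> w; exact: cvg_fst.
Qed.

Lemma differentiable_coord2 z (a : R) : differentiable (fun y : plane R => y.2 - a : R^o) z.
Proof.
apply: (@differentiableB R (plane R) R^o snd (cst a)); last exact: differentiable_cst.
apply: (@linear_differentiable R (plane R) R^o snd).
by move=> w; exact: cvg_snd.
Qed.

Lemma differentiable_quad x S z : differentiable (quad x S) z.
Proof.
have c1 := differentiable_coord1 z x.1; have c2 := differentiable_coord2 z x.2.
have M f g : differentiable (f : plane R -> R) z -> differentiable (g : plane R -> R) z ->
  differentiable ((fun y => f y * g y) : plane R -> R) z.
  by move=> *; exact: differentiableM.
have C (c : R) f : differentiable (f : plane R -> R) z ->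
  differentiable ((fun y => c * f y) : plane R -> R) z.
  by move=> *; exact: differentiableZ.
have A f g : differentiable (f : plane R -> R) z -> differentiable (g : plane R -> R) z ->
  differentiable ((fun y => f y + g y) : plane R -> R) z.
  by move=> *; exact: differentiableD.
exact: (A _ _ (A _ _ (A _ _ (A _ _ (A _ _ (differentiable_cst _ _)
  (C _ _ c1)) (C _ _ c2)) (C _ _ (M _ _ c1 c1))) (C _ _ (M _ _ c1 c2)))
  (C _ _ (M _ _ c2 c2))).
Qed.

Lemma quad_horner_fst (a b c w v t : R) :
  a - b * t + c * w + b / 2 * (v + v)
  = a + c * w + b * (v - t) + 0 / 2 * (w * w) + 0 * (w * (v - t)) + 0 / 2 * ((v - t) * (v - t)).
Proof. by field. Qed.

Lemma quad_horner_snd (a b c w v t : R) :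
  a - b * t + c * w + b / 2 * (v + v)
  = a + b * (v - t) + c * w + 0 / 2 * ((v - t) * (v - t)) + 0 * ((v - t) * w) + 0 / 2 * (w * w).
Proof. by field. Qed.

Lemma partial_quad b x S : 'D_(cartesian_dir b) (quad x S) = quad x (shift_jet b S).
Proof.
apply/funext => -[u0 v0]; move: (u0 : R) (v0 : R) x => u v [x1 x2] {u0 v0}.
move: (x1 : R) (x2 : R) => {}x1 {}x2; pose x := (x1, x2) : plane R.
rewrite -[(x1, x2)]/x.
case: b.
- have [_ <-] := is_derive_axis2 (differentiable_quad x S (u, v)).
  (* Along a coordinate line [quad] is a polynomial in one variable, which can be differentiated
     formally. *)
  have -> : (fun s => quad x S (u, s)) = horner ((quad x S (u, 0))%:P +
     (S 0%N 1%N - S 0%N 2%N * x.2 + S 1%N 1%N * (u - x.1)) *: 'X + (S 0%N 2%N / 2) *: 'X^2).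
    by apply/funext => s; rewrite !hornerE /quad /=; field.
  have [_ ->] := is_derive_poly ((quad x S (u, 0))%:P +
     (S 0%N 1%N - S 0%N 2%N * x.2 + S 1%N 1%N * (u - x.1)) *: 'X + (S 0%N 2%N / 2) *: 'X^2) v.
  rewrite !derivD !derivZ derivC derivX derivXn !hornerE /quad /shift_jet /=.
  exact: quad_horner_fst.
- have [_ <-] := is_derive_axis1 (differentiable_quad x S (u, v)).
  have -> : (fun s => quad x S (s, v)) = horner ((quad x S (0, v))%:P +
     (S 1%N 0%N - S 2%N 0%N * x.1 + S 1%N 1%N * (v - x.2)) *: 'X + (S 2%N 0%N / 2) *: 'X^2).
    by apply/funext => s; rewrite !hornerE /quad /=; field.
  have [_ ->] := is_derive_poly ((quad x S (0, v))%:P +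
     (S 1%N 0%N - S 2%N 0%N * x.1 + S 1%N 1%N * (v - x.2)) *: 'X + (S 2%N 0%N / 2) *: 'X^2) u.
  rewrite !derivD !derivZ derivC derivX derivXn !hornerE /quad /shift_jet /=.
  exact: quad_horner_snd.
Qed.

Lemma partials_quad s x S : partials s (quad x S) = quad x (foldr shift_jet S s).
Proof.
elim: s => [//|b s IH] /=.
by rewrite -partial_quad -IH.
Qed.

Lemma smooth_quad x S : smooth (quad x S).
Proof. by move=> s z; rewrite partials_quad; exact: differentiable_quad. Qed.

Lemma iterated_partial_quad x S m1 m2 : (m1 + m2 <= 2)%N ->
  iterated_partial (quad x S) m1 m2 x = S m1 m2.
Proof.
move=> m; rewrite /iterated_partial partials_quad /quad !subrr !(mulr0, addr0).
by case: m1 m2 m => [|[|[|m1]]] [|[|[|m2]]].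
Qed.

(** The six multi-indices of order at most two: the origin of the dimension of the vertex spaces. *)
Definition jet_index (k : 'I_6) : nat * nat :=
  nth (0, 0)%N [:: (0, 0); (1, 0); (0, 1); (2, 0); (1, 1); (0, 2)]%N k.

Definition jet_of (c : 'I_6 -> R) (m1 m2 : nat) : R :=
  \sum_k c k * (jet_index k == (m1, m2))%:R.

Lemma jet_of_index (c : 'I_6 -> R) k : jet_of c (jet_index k).1 (jet_index k).2 = c k.
Proof.
rewrite /jet_of -surjective_pairing (bigD1 k) //= eqxx mulr1 big1 ?addr0 // => i ik.
suff /negbTE -> : jet_index i != jet_index k by rewrite mulr0.
apply: contraNneq ik; case: i k => [i i6] [k k6] E; apply/eqP/val_inj => /=.
by move: i i6 k k6 E => [|[|[|[|[|[|i]]]]]] // i6 [|[|[|[|[|[|k]]]]]].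
Qed.

Lemma jet_index_surj m1 m2 : (m1 + m2 <= 2)%N -> exists k, jet_index k = (m1, m2).
Proof.
have K m (h : (m < 6)%N) : jet_index (Ordinal h) = nth (0, 0)%N [:: (0, 0); (1, 0); (0, 1); (2, 0);
  (1, 1); (0, 2)]%N m by [].
case: m1 m2 => [|[|[|m1]]] [|[|[|m2]]] // _.
- by exists (@Ordinal 6 0 isT).
- by exists (@Ordinal 6 2 isT).
- by exists (@Ordinal 6 5 isT).
- by exists (@Ordinal 6 1 isT).
- by exists (@Ordinal 6 4 isT).
- by exists (@Ordinal 6 3 isT).
Qed.

Lemma jet_index_le k : ((jet_index k).1 + (jet_index k).2 <= 2)%N.
Proof. by case: k => [[|[|[|[|[|[|]]]]]]]. Qed.

Lemma jet_of_jet S m1 m2 : (m1 + m2 <= 2)%N ->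
  jet_of (fun k => S (jet_index k).1 (jet_index k).2) m1 m2 = S m1 m2.
Proof.
move=> /jet_index_surj[k kE].
by have := jet_of_index (fun k => S (jet_index k).1 (jet_index k).2) k; rewrite kE.
Qed.

Lemma quad_C2_at (I : finType) (F : I -> plane R -> plane R) x x0 S : C2_at F x (quad x0 S).
Proof.
exists (fun=> quad x0 S); split => //.
by move=> _; exact: smooth_quad.
Qed.

End Quadratic.

(** * B-splines at the ends of the interval *)

Section SpanPolynomials.
Context {R : realType}.
Implicit Types (t : nat -> R) (i j q : nat).

(* The polynomial which cox_de_boor t q j coincides with on the knot span
   [t_i, t_(i+1)). *)
Fixpoint spanpoly t i q j : {poly R} :=
  match q with
  | 0 => (j == i)%:R
  | q'.+1 =>
      (t (j + q)%N - t j)^-1 *: (('X - (t j)%:P) * spanpoly t i q' j)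
      + (t (j + q).+1 - t j.+1)^-1 *: (((t (j + q).+1)%:P - 'X) * spanpoly t i q' j.+1)
  end.

(** The bound by 1 serves the convention of [cox_de_boor] that closes the last nonempty span at
    1. *)
Definition knots t := (forall j, t j <= t j.+1) /\ (forall j, t j <= 1).

Lemma knots_le t i j : knots t -> (i <= j)%N -> t i <= t j.
Proof.
move=> [H _]; elim: j => [|j IH]; first by rewrite leqn0 => /eqP->.
by rewrite leq_eqVlt => /orP[/eqP->//|/IH h]; exact: le_trans (H j).
Qed.

Lemma cox_de_boor_spanpoly t i q j x : knots t ->
  (t i <= x < t i.+1) \/ (t i < t i.+1 /\ x = t i.+1 /\ x = 1) ->
  cox_de_boor t q j x = (spanpoly t i q j).[x].
Proof.
move=> K Hx; elim: q j => [|q IH] j /=; last first.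
  rewrite !IH hornerD !hornerZ !hornerM !hornerD !hornerN !hornerX !hornerC.
  by rewrite !mulrA ![_^-1 * _]mulrC.
(* Exactly one B-spline of degree 0 is nonzero at [x]: the one of the span containing it. *)
have -> : ((t j <= x < t j.+1) || [&& t j < x, x == t j.+1 & x == 1]) = (j == i).
  have [ji|ij|->] := ltngtP j i.
  - have le1 := knots_le K ji.
    have le2 := K.2 i.+1.
    apply/negbTE; rewrite negb_or !negb_and -!leNgt.
    case: Hx => [/andP[x1 x2]|[x1 [x2 x3]]].
      rewrite (le_trans le1 x1) orbT /=; apply/orP; right; apply/orP; right.
      by rewrite lt_eqF // (lt_le_trans x2).
    have lx : t j.+1 < x by rewrite x2; exact: le_lt_trans le1 x1.
    by rewrite (ltW lx) orbT /= (gt_eqF lx) orbT.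
  - have le1 := knots_le K ij.
    have le2 := K.2 j.+1.
    apply/negbTE; rewrite negb_or !negb_and -!leNgt -!ltNge.
    case: Hx => [/andP[x1 x2]|[x1 [x2 x3]]].
      by rewrite (lt_le_trans x2 le1) /= (ltW (lt_le_trans x2 le1)).
    by rewrite x3 le2 orbT /= -x3 x2 le1.
  - case: Hx => [->//|[x1 [x2 x3]]].
    by rewrite -x2 eqxx -x3 eqxx x2 x1 orbT.
by case: (j == i); rewrite hornerE.
Qed.

Lemma spanpoly_supp t i q j : (i < j)%N || (j + q < i)%N -> spanpoly t i q j = 0.
Proof.
elim: q j => [|q IH] j H /=.
  by rewrite (_ : (j == i) = false) //; apply/negbTE; move: H; lia.
by rewrite !IH ?mulr0 ?scaler0 ?addr0 //; move: H; lia.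
Qed.

(* Order of vanishing at the left end of a span: the number of knots equal to
   t_i in the support is i - j + 1. *)
Lemma spanpoly_left t i q j : knots t -> t j = t i -> t i < t i.+1 ->
  (j <= i <= j + q)%N ->
  exists2 P, spanpoly t i q j = ('X - (t i)%:P) ^+ (q - (i - j)) * P & 0 < P.[t i].
Proof.
move=> K tji ti; elim: q j tji => [|q IH] j tji /andP[ji ijq].
  have -> : i = j by lia.
  by exists 1; [rewrite subnn expr0 mul1r /= eqxx|rewrite hornerE].
have tn : t i < t (j + q.+1).+1 by apply: lt_le_trans ti (knots_le K _); lia.
(* Both cofactors are nonnegative at [t i]; the first is positive when [i = j] and the second when
   [i != j], so the sum is always positive. *)
have [P1 E1 H1] : exists2 P, (t (j + q.+1)%N - t j)^-1 *: (('X - (t j)%:P) * spanpoly t i q j)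
    = ('X - (t i)%:P) ^+ (q.+1 - (i - j)) * P & (0 <= P.[t i]) && ((i == j) ==> (0 < P.[t i])).
  have [iq|qi] := leqP i (j + q); last first.
    exists 0; last by rewrite !hornerE lexx /=; apply/implyP; lia.
    by rewrite spanpoly_supp ?qi ?orbT // !mulr0 scaler0.
  have tq : t i < t (j + q.+1)%N by apply: lt_le_trans ti (knots_le K _); lia.
  have c0 : 0 < (t (j + q.+1)%N - t j)^-1 by rewrite invr_gt0 tji subr_gt0.
  have [|P -> P0] := IH j tji; first by rewrite ji.
  exists ((t (j + q.+1)%N - t j)^-1 *: P); last first.
    by rewrite hornerZ mulr_ge0 ?mulr_gt0 ?ltW //= implybT.
  rewrite tji mulrA -exprS -scalerAr; congr (_ *: (_ ^+ _ * _)); lia.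
have [P2 E2 H2] : exists2 P, (t (j + q.+1).+1 - t j.+1)^-1 *: (((t (j + q.+1).+1)%:P - 'X) *
  spanpoly t i q j.+1)
    = ('X - (t i)%:P) ^+ (q.+1 - (i - j)) * P & (0 <= P.[t i]) && ((i != j) ==> (0 < P.[t i])).
  have [ij|ij] := leqP i j.
    exists 0; last by rewrite !hornerE lexx /=; apply/implyP; lia.
    by rewrite spanpoly_supp ?ltnS ?ij // !mulr0 scaler0.
  have tj1 : t j.+1 = t i.
    by apply/eqP; rewrite eq_le (knots_le K ij) -tji K.1.
  have [|P -> P0] := IH j.+1 tj1; first by rewrite ij; lia.
  have c0 : 0 < (t (j + q.+1).+1 - t j.+1)^-1 by rewrite invr_gt0 tj1 subr_gt0.
  exists ((t (j + q.+1).+1 - t j.+1)^-1 *: (((t (j + q.+1).+1)%:P - 'X) * P)); last first.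
    have pos : 0 < ((t (j + q.+1).+1 - t j.+1)^-1 *: (((t (j + q.+1).+1)%:P - 'X) * P)).[t i].
      by rewrite !hornerE mulr_gt0 // mulr_gt0 // subr_gt0.
    by rewrite (ltW pos) pos /= implybT.
  rewrite mulrCA -scalerAr; congr (_ *: (_ ^+ _ * _)); lia.
exists (P1 + P2); first by rewrite [LHS]/= E1 E2 mulrDr.
rewrite hornerD; move: H1 H2 => /andP[h1 h1'] /andP[h2 h2'].
case: eqP h1' h2' => /= _ h h'; [exact: ltr_wpDr|exact: ltr_wpDl].
Qed.

(** Counterpart at the right end of a span: [j + q - i + 1] knots of the support equal [t i.+1],
    which leaves order [i - j]. *)
Lemma spanpoly_right t i q j : knots t -> t (j + q).+1 = t i.+1 ->
  (j <= i <= j + q)%N ->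
  exists P, spanpoly t i q j = ('X - (t i.+1)%:P) ^+ (i - j) * P.
Proof.
move=> K; elim: q j => [|q IH] j tji /andP[ji ijq].
  have -> : i = j by lia.
  by exists 1; rewrite subnn expr0 mul1r /= eqxx.
have [P1 E1] : exists P, spanpoly t i q j = ('X - (t i.+1)%:P) ^+ (i - j) * P.
  have [iq|qi] := leqP i (j + q); last first.
    by exists 0; rewrite mulr0 spanpoly_supp // qi orbT.
  apply: IH; last by rewrite ji.
  apply/eqP; rewrite eq_le -{1}tji; apply/andP; split; apply: knots_le => //; lia.
have [P2 E2] : exists P, ((t (j + q.+1).+1)%:P - 'X) * spanpoly t i q j.+1 = ('X - (t i.+1)%:P) ^+
  (i - j) * P.
  have [ij|ij] := leqP i j.
    by exists 0; rewrite mulr0 spanpoly_supp ?mulr0 // ltnS ij.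
  have [|//|P ->] := IH j.+1; first by rewrite -tji; congr t; lia.
    by rewrite ij; lia.
  exists (- P); rewrite tji mulrN -mulNr mulrA; congr (_ * _).
  by rewrite -opprB mulNr -exprS; congr (- (_ ^+ _)); lia.
exists ((t (j + q.+1)%N - t j)^-1 *: (('X - (t j)%:P) * P1) + (t (j + q.+1).+1 - t j.+1)^-1 *: P2).
by rewrite /= E1 E2 mulrDr -!scalerAr mulrCA.
Qed.

(** Induction on [j]. At the left end of the first nonempty span starting at the knot [t j], spline
    [j] vanishes to a lower order than all later ones, while the earlier coefficients are already
    zero; dividing by this power and evaluating isolates [c j]. *)
Lemma spanpoly_free t q N (c : nat -> R) : knots t ->
  (forall j, (j < N)%N -> exists i, [/\ (j <= i <= j + q)%N, t j = t i & t i < t i.+1]) ->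
  (forall i, t i < t i.+1 -> \sum_(j < N) c j *: spanpoly t i q j = 0) ->
  forall j, (j < N)%N -> c j = 0.
Proof.
move=> K Hi H; elim/ltn_ind => j IH jN.
have [i [/andP[ji ijq] tji ti]] := Hi j jN.
have [P EP P0] := spanpoly_left K tji ti (introT andP (conj ji ijq)).
set e := (q - (i - j))%N in EP.
(* Every other term is zero or divisible by one more factor than term [j]. *)
have rest (j' : 'I_N) : exists Q, j' != Ordinal jN -> c j' *: spanpoly t i q j' = ('X - (t i)%:P)
  ^+ e.+1 * Q.
  have [jj'|jj'|jj'] := ltngtP j' j.
  - by exists 0 => _; rewrite IH // scale0r mulr0.
  - have [ij|ij] := ltnP i j'.
      by exists 0 => _; rewrite spanpoly_supp ?ij // scaler0 mulr0.
    have tj' : t j' = t i.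
      by apply/eqP; rewrite eq_le (knots_le K ij) -tji; apply: knots_le => //; exact: ltnW.
    have [|Q EQ _] := spanpoly_left (q := q) K tj' ti; first by rewrite ij; lia.
    exists (c j' *: (('X - (t i)%:P) ^+ (q - (i - j') - e.+1) * Q)) => _.
    rewrite EQ -scalerAr mulrA -exprD; congr (_ *: (_ ^+ _ * _)); lia.
  - by exists 0; rewrite -val_eqE /= jj' eqxx.
have /choice[Q HQ] := rest.
have := H i ti; rewrite (bigD1 (Ordinal jN)) //= (eq_bigr _ HQ) -mulr_sumr EP.
rewrite scalerAr -[c j *: P]mul1r exprSr -mulrA -mulrDr mul1r => /eqP.
rewrite mulf_eq0 expf_eq0 polyXsubC_eq0 andbF orFb => /eqP/(congr1 (horner^~ (t i))).
rewrite !hornerE subrr mul0r addr0 => /eqP; rewrite mulf_eq0 => /orP[/eqP//|].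
by rewrite (gt_eqF P0).
Qed.

(** The two B-splines with a nonzero 1-jet at the left end. The claims share one induction because
    the second one in degree [q.+1] is built from both of degree [q]. *)
Lemma spanpoly_first t i q j (tau : R) : 0 < tau -> (forall k, (k <= i)%N -> t k = 0) ->
  t i.+1 = tau -> knots t ->
  ((j + q = i)%N -> (spanpoly t i q j).[0] = 1 /\ (spanpoly t i q j)^`().[0] = - (q%:R / tau)) /\
  ((j + q = i.+1)%N -> (spanpoly t i q j).[0] = 0 /\ (spanpoly t i q j)^`().[0] = q%:R / tau).
Proof.
move=> tau0 t0 ti K; elim: q j => [|q IH] j; split => E.
- rewrite /= -E addn0 eqxx; split; first by rewrite hornerE.
  by rewrite derivC hornerE mul0r oppr0.
- rewrite /= (_ : (j == i) = false); last by apply/negbTE; lia.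
  by rewrite deriv0 !horner0 mul0r.
- have E1 : (j.+1 + q = i)%N by lia.
  have [v1 v2] := (IH j.+1).1 E1.
  have e1 : t (j + q.+1)%N = 0 by apply: t0; lia.
  have e2 : t j = 0 by apply: t0; lia.
  have e3 : t (j + q.+1).+1 = tau by rewrite -ti; congr (t _.+1); lia.
  have e4 : t j.+1 = 0 by apply: t0; lia.
  (* The first summand has denominator 0, hence coefficient [0^-1 = 0]. *)
  rewrite /= e1 e2 e3 e4 !subr0 invr0 scale0r add0r.
  rewrite derivZ derivM derivB derivC derivX !(hornerZ, hornerM, hornerD, hornerN, hornerC,
    hornerX) v1 v2.
  split; first by rewrite mulr1 subr0 mulVf // gt_eqF.
  by rewrite -natr1; field; rewrite gt_eqF.
- have E1 : (j + q = i)%N by lia.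
  have [v1 v2] := (IH j).1 E1.
  have E2 : (j.+1 + q = i.+1)%N by lia.
  have [w1 w2] := (IH j.+1).2 E2.
  have e1 : t (j + q.+1)%N = tau by rewrite -ti; congr t; lia.
  have e2 : t j = 0 by apply: t0; lia.
  have tp : 0 < t (j + q.+1).+1 by apply: lt_le_trans tau0 _; rewrite -ti; apply: knots_le => //;
    lia.
  rewrite /= e1 e2 !subr0.
  rewrite derivD !derivZ !derivM !derivB !derivC !derivX !(hornerZ, hornerM, hornerD, hornerN,
    hornerC, hornerX) v1 v2 w1 w2.
  split; first by rewrite !(mul0r, mulr0, addr0).
  (* For [q = 0] the knot [t j.+1] is [tau] and not 0, but then the 1-jet in the second summand is
     zero. *)
  have [q0|q0] := posnP q.
    by rewrite q0 !(mul0r, mulr0, oppr0, addr0, add0r, mulr1) mul1r.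
  have e4 : t j.+1 = 0 by apply: t0; lia.
  rewrite e4 -[in RHS]natr1 !subr0; set T := t _ in tp *.
  by field; rewrite !gt_eqF.
Qed.

End SpanPolynomials.

(** * B-splines of an open uniform knot vector *)

Section OpenKnots.
Context {R : realType}.
Variables (p s n : nat).
Hypotheses (sp : (s < p)%N) (n0 : (0 < n)%N).

Local Notation t := (nth (1 : R) (open_knots p s n)).
Local Notation N := (spline_dim p s n).

Lemma nth_flatten_nseq (f : nat -> R) (d : R) (a m mu k : nat) : (k < m * mu)%N ->
  nth d (flatten [seq nseq mu (f i) | i <- iota a m]) k = f (a + k %/ mu)%N.
Proof.
elim: m a k => [|m IH] a k //= km; have mu0 : (0 < mu)%N by move: km; case: (mu) => //;
  rewrite muln0.
rewrite nth_cat size_nseq; case: ltnP => kmu; first by rewrite nth_nseq kmu divn_small // addn0.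
rewrite IH; last by move: km; rewrite mulSn; lia.
congr f; rewrite -{2}(subnK kmu) divnDr // divnn mu0; lia.
Qed.

Lemma size_flatten_nseq (f : nat -> R) (a m mu : nat) :
  size (flatten [seq nseq mu (f i) | i <- iota a m]) = (m * mu)%N.
Proof. by elim: m a => [|m IH] a //=; rewrite size_cat size_nseq IH mulSn. Qed.

(** The numerator of the [k]-th knot over [n]; with it, comparisons of knots become arithmetic of
    natural numbers. The cut-off at [n] covers the last knots as well as the default value 1 beyond
    the list. *)
Definition knot_num (k : nat) : nat :=
  if (k <= p)%N then 0 else minn n ((k - p.+1) %/ (p - s)).+1.

Lemma open_knotE k : t k = (knot_num k)%:R / n%:R.
Proof.
have nR : (n%:R : R) != 0 by rewrite pnatr_eq0 -lt0n.
have mu0 : (0 < p - s)%N by rewrite subn_gt0.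
rewrite /open_knots nth_cat size_nseq /knot_num ltnS.
case: leqP => kp; first by rewrite nth_nseq ltnS kp mul0r.
rewrite nth_cat size_flatten_nseq.
case: ltnP => k2.
  rewrite nth_flatten_nseq // add1n.
  have : ((k - p.+1) %/ (p - s) < n.-1)%N by rewrite ltn_divLR.
  by move=> h; rewrite (minn_idPr _) //; lia.
have : (n.-1 <= (k - p.+1) %/ (p - s))%N by rewrite leq_divRL.
move=> h; rewrite (minn_idPl _); last by lia.
by rewrite mulfV // nth_nseq; case: ifP.
Qed.

Lemma knot_num_mono k : (knot_num k <= knot_num k.+1)%N.
Proof.
rewrite /knot_num; case: (leqP k p) => // kp.
rewrite (leqNgt k.+1 p) ltnS (ltnW kp) /=.
rewrite leq_min geq_minl /=; apply: leq_trans (geq_minr _ _) _.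
by rewrite ltnS leq_div2r // leq_sub2r.
Qed.

Lemma knot_num_le k : (knot_num k <= n)%N.
Proof. by rewrite /knot_num; case: (leqP k p) => // _; exact: geq_minl. Qed.

Lemma open_knots_knots : knots t.
Proof.
have nR : 0 < (n%:R : R) by rewrite ltr0n.
split=> k; rewrite !open_knotE.
  by rewrite ler_pM2r ?invr_gt0 // ler_nat knot_num_mono.
by rewrite ler_pdivrMr // mul1r ler_nat knot_num_le.
Qed.

Lemma open_knot_lt k l : (t k < t l) = (knot_num k < knot_num l)%N.
Proof. by rewrite !open_knotE ltr_pM2r ?invr_gt0 ?ltr0n // ltr_nat. Qed.

Lemma spline_dim_gt : (p < N)%N.
Proof. by rewrite /spline_dim addn1 ltnS leq_addl. Qed.

Lemma knot_num_first k : (k <= p)%N -> knot_num k = 0%N.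
Proof. by rewrite /knot_num => ->. Qed.

Lemma knot_num_first1 : knot_num p.+1 = 1%N.
Proof. by rewrite /knot_num ltnn subnn div0n; apply/minn_idPr. Qed.

Lemma knot_num_last k : (N <= k)%N -> knot_num k = n.
Proof.
have mu0 : (0 < p - s)%N by rewrite subn_gt0.
move=> Nk; have pk : (p < k)%N by apply: leq_trans Nk; exact: spline_dim_gt.
rewrite /knot_num leqNgt pk /=; apply/minn_idPl.
suff : (n - 1 <= (k - p.+1) %/ (p - s))%N by lia.
rewrite leq_divRL //; move: Nk; rewrite /spline_dim mulnC; move: ((n - 1) * (p - s))%N => m; lia.
Qed.

Lemma knot_num_last1 : knot_num N.-1 = n.-1.
Proof.
have mu0 : (0 < p - s)%N by rewrite subn_gt0.
rewrite /knot_num /spline_dim addn1 /=.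
have [n1|n1] := leqP n 1.
  have -> : n = 1%N by lia.
  by rewrite subnn muln0 add0n leqnn.
have E : (0 < (p - s) * (n - 1))%N by rewrite muln_gt0 mu0; lia.
rewrite ifF; last by apply/negbTE; move: E; move: ((p - s) * (n - 1))%N => m; lia.
have -> : ((p - s) * (n - 1) + p - p.+1 = (n - 2) * (p - s) + (p - s).-1)%N.
  rewrite mulnC; have -> : (n - 1 = (n - 2).+1)%N by lia.
  rewrite mulSn; move: ((n - 2) * (p - s))%N => m; lia.
rewrite divnMDl // divn_small; last by lia.
by rewrite (minn_idPr _); lia.
Qed.

(** Inner knots have multiplicity [p - s <= p] and the end knots [p.+1], so within this range [p.+2]
    consecutive knots never all coincide. *)
Lemma knot_num_support j : (j < N)%N -> (knot_num j < knot_num (j + p.+1))%N.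
Proof.
have mu0 : (0 < p - s)%N by rewrite subn_gt0.
move=> jN; have jp : (j + p.+1 <= p = false)%N by apply/negbTE; lia.
rewrite /knot_num jp addnK; case: (leqP j p) => pj; first by rewrite leq_min n0.
have h1 : ((j - p.+1) %/ (p - s) < n - 1)%N.
  by rewrite ltn_divLR //; move: jN; rewrite /spline_dim mulnC; move: ((n - 1) * (p - s))%N => m;
    lia.
have h2 : ((j - p.+1) %/ (p - s) < j %/ (p - s))%N.
  apply: (@leq_trans ((j - p.+1 + (p - s)) %/ (p - s))); last by apply: leq_div2r; lia.
  by rewrite divnDr // divnn mu0; lia.
by rewrite leq_min; apply/andP; split; rewrite gtn_min; apply/orP; right; lia.
Qed.

Lemma bspline_span j : (j < N)%N ->
  exists i, [/\ (j <= i <= j + p)%N, t j = t i & t i < t i.+1].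
Proof.
move=> /knot_num_support; rewrite -open_knot_lt => H.
have ex : exists i, (j <= i)%N && (t j < t i.+1) by exists (j + p)%N; rewrite leq_addr -addnS.
(* The least such [i] is the last index with knot [t j], so the span to its right is nonempty. *)
have [i /andP[ji ti] mini] := ex_minnP ex.
have tji : t j = t i.
  apply/eqP; rewrite eq_le (knots_le open_knots_knots ji) /= leNgt; apply/negP => lt.
  have ij : (j < i)%N by rewrite ltn_neqAle ji andbT; apply: contraTneq lt => ->; rewrite ltxx.
  have := mini i.-1; rewrite prednK; last by lia.
  rewrite lt andbT => /(_ _); lia.
exists i; split => //; last by rewrite -tji.
rewrite ji /=; apply: mini; apply/andP; split; first exact: leq_addr.
by rewrite addnS in H.
Qed.

Lemma bspline_horner i j x : t i <= x < t i.+1 -> bspline p s n j x = (spanpoly t i p j).[x].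
Proof. by move=> H; apply: cox_de_boor_spanpoly; [exact: open_knots_knots|left]. Qed.

(** The spans [p] and [N.-1] are the first and the last nonempty ones. The polynomial at the right
    end is reflected, so that both ends are studied at 0. *)
Definition bspline_poly0 (j : nat) : {poly R} := spanpoly t p p j.
Definition bspline_poly1 (j : nat) : {poly R} := spanpoly t N.-1 p j \Po (1 - 'X).

Lemma germ_bspline j : germ (bspline p s n j) (bspline_poly0 j).
Proof.
exists n%:R^-1; first by rewrite invr_gt0 ltr0n.
move=> x xn; apply: bspline_horner.
by rewrite !open_knotE knot_num_first // knot_num_first1 mul0r mul1r.
Qed.

Lemma germ_bspline_rev j : germ (fun x => bspline p s n j (1 - x)) (bspline_poly1 j).
Proof.
have nR : (n%:R : R) != 0 by rewrite pnatr_eq0 -lt0n.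
have N0 : N.-1.+1 = N by rewrite prednK // (leq_trans _ spline_dim_gt).
have tN : t N = 1 by rewrite open_knotE knot_num_last // mulfV.
have tN1 : t N.-1 = 1 - n%:R^-1.
  by rewrite open_knotE knot_num_last1 -subn1 natrB // mulrBl mulfV // mul1r.
have nV : 0 < n%:R^-1 :> R by rewrite invr_gt0 ltr0n.
exists n%:R^-1 => // x /andP[x0 xn].
rewrite /bspline_poly1 horner_comp !hornerE.
apply: cox_de_boor_spanpoly; first exact: open_knots_knots.
rewrite N0 tN tN1.
(* Here [x = 0] stands for the end point 1, where the last span is closed. *)
move: x0; rewrite le_eqVlt => /orP[/eqP <-|x0]; first by right; split; [lra|split; lra].
by left; apply/andP; split; lra.
Qed.

Definition order_ge (k : nat) (q : {poly R}) := forall m, (m < k)%N -> q^`(m).[0] = 0.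

Lemma order_geXn k (q : {poly R}) : order_ge k ('X^k * q).
Proof.
move=> m mk; rewrite horner_coef0 coef_derivn addn0.
by rewrite coefXnM mk mul0rn.
Qed.

Lemma bspline_poly0_order j : order_ge j (bspline_poly0 j).
Proof.
have [jp|pj] := leqP j p; last by move=> m mj; rewrite /bspline_poly0 spanpoly_supp ?pj // linear0
  horner0.
have t0 k : (k <= p)%N -> t k = 0 by move=> kp; rewrite open_knotE knot_num_first // mul0r.
have [|||P E _] := @spanpoly_left R t p p j open_knots_knots.
- by rewrite !t0.
- by rewrite open_knot_lt knot_num_first // knot_num_first1.
- by rewrite jp leq_addl.
rewrite /bspline_poly0 E t0 // subr0 subKn //; exact: order_geXn.
Qed.

(** Together with the vanishing of the lower derivatives this makes the interpolation conditions at
    a corner triangular. *)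
Lemma bspline_poly0_lead j : (j <= p)%N -> (bspline_poly0 j)^`(j).[0] != 0.
Proof.
move=> jp.
have t0 k : (k <= p)%N -> t k = 0 by move=> kp; rewrite open_knotE knot_num_first // mul0r.
have [|||P E P0] := @spanpoly_left R t p p j open_knots_knots.
- by rewrite !t0.
- by rewrite open_knot_lt knot_num_first // knot_num_first1.
- by rewrite jp leq_addl.
rewrite /bspline_poly0 E t0 // subr0 subKn //.
rewrite horner_coef0 coef_derivn addn0 ffactnn coefXnM ltnn subnn.
move: P0; rewrite t0 // horner_coef0 => P0.
by rewrite mulrn_eq0 negb_or -lt0n fact_gt0 /= gt_eqF.
Qed.

Lemma bspline_poly1_order j : (j < N)%N -> order_ge (N.-1 - j) (bspline_poly1 j).
Proof.
move=> jN; have N0 : N.-1.+1 = N by rewrite prednK // (leq_trans _ spline_dim_gt).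
have nR : (n%:R : R) != 0 by rewrite pnatr_eq0 -lt0n.
have [jp|pj] := leqP N.-1 (j + p); last first.
  by move=> m mj; rewrite /bspline_poly1 spanpoly_supp ?pj ?orbT // comp_poly0 linear0 horner0.
have t1 k : (N <= k)%N -> t k = 1 by move=> Nk; rewrite open_knotE knot_num_last // mulfV.
have [||P E] := @spanpoly_right R t N.-1 p j open_knots_knots.
- by rewrite !t1 ?N0 // -N0 ltnS.
- by rewrite jp; lia.
rewrite /bspline_poly1 E N0 t1 // rmorphM rmorphXn rmorphB /= comp_polyX comp_polyC.
have -> : 1 - 'X - 1%:P = (-1) * 'X :> {poly R} by rewrite polyC1 addrAC subrr add0r mulN1r.
rewrite exprMn -mulrA mulrCA; exact: order_geXn.
Qed.

Lemma poly0_of_interval (q : {poly R}) (a b : R) : a < b ->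
  (forall x, a < x < b -> q.[x] = 0) -> q = 0.
Proof.
move=> ab H; apply/eqP; apply: contraT => q0.
(* Pairwise distinct points of the interval; [size q] of them are too many roots for a nonzero
   [q]. *)
pose f (k : nat) := a + (b - a) / (k.+2)%:R.
have fin k : a < f k < b.
  have k0 : 0 < (k.+2)%:R :> R by rewrite ltr0n.
  have k1 : 1 < (k.+2)%:R :> R by rewrite ltr1n.
  rewrite /f ltrDl divr_gt0 ?subr_gt0 //= -ltrBrDl ltr_pdivrMr //.
  by rewrite ltr_pMr ?subr_gt0.
have inj : injective f.
  move=> k l /addrI /(mulfI _)-/(_ _)/invr_inj/eqP; rewrite subr_eq0 (gt_eqF ab) => /(_ isT).
  by rewrite eqr_nat => /eqP[].
have := max_poly_roots q0 (rs := [seq f k | k <- iota 0 (size q)]).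
rewrite size_map size_iota ltnn map_inj_uniq ?iota_uniq // => ->//.
by apply/allP => _ /mapP[k _ ->]; apply/rootP/H.
Qed.

Lemma bspline_free (c : nat -> R) :
  (forall x, 0 < x < 1 -> \sum_(j < N) c j * bspline p s n j x = 0) ->
  forall j, (j < N)%N -> c j = 0.
Proof.
move=> H; apply: (@spanpoly_free R t p N c open_knots_knots bspline_span) => i ti.
apply: (poly0_of_interval ti) => x /andP[x1 x2].
have t0 : 0 <= t i by rewrite open_knotE divr_ge0.
have t1 := open_knots_knots.2 i.+1.
rewrite -[RHS](H x); last by apply/andP; split; lra.
rewrite horner_sum; apply: eq_bigr => j _.
by rewrite hornerZ (@bspline_horner i) // (ltW x1).
Qed.

(** The slope [p / h] of the second B-spline is the origin of the factor [h / p] in [c1]. *)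
Lemma bspline_poly0_first : (0 < p)%N ->
  [/\ (bspline_poly0 0).[0] = 1, (bspline_poly0 0)^`().[0] = - (p%:R * n%:R),
      (bspline_poly0 1).[0] = 0 & (bspline_poly0 1)^`().[0] = p%:R * n%:R].
Proof.
move=> p0.
have t0 k : (k <= p)%N -> t k = 0 by move=> kp; rewrite open_knotE knot_num_first // mul0r.
have tp : t p.+1 = n%:R^-1 by rewrite open_knotE knot_num_first1 mul1r.
have nV : 0 < n%:R^-1 :> R by rewrite invr_gt0 ltr0n.
have [/(_ (add0n p)) [h1 h2] _] := @spanpoly_first R t p p 0 _ nV t0 tp open_knots_knots.
have [_ /(_ (add1n p)) [h3 h4]] := @spanpoly_first R t p p 1 _ nV t0 tp open_knots_knots.
by split; rewrite // ?h2 ?h4 invrK.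
Qed.

End OpenKnots.

(** * Orders of vanishing at the two ends and at the four corners *)

Section Orders.
Context {R : realType}.
Implicit Types (q : {poly R}) (f u v : R -> R) (xi : plane R).

Lemma order_geP k q : order_ge k q <-> exists P, q = 'X^k * P.
Proof.
split=> [H|[P ->]]; last exact: order_geXn.
exists (drop_poly k q); rewrite mulrC -[LHS](poly_take_drop k) -[RHS]add0r.
congr (_ + _); apply/polyP => i; rewrite coef_take_poly coef0; case: ifP => // ik.
have := H i ik; rewrite horner_coef0 coef_derivn addn0 ffactnn => /eqP.
by rewrite mulrn_eq0 -leqn0 leqNgt fact_gt0 => /eqP.
Qed.

Lemma order_ge_lin k (a : R) q q' : order_ge k q -> order_ge k q' -> order_ge k (a *: q + q').
Proof. by move=> H H' m mk; rewrite derivnD derivnZ hornerD hornerZ H // H' // mulr0 addr0. Qed.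

Lemma order_ge_le k k' q : (k' <= k)%N -> order_ge k q -> order_ge k' q.
Proof. by move=> kk H m mk; apply: H; exact: leq_trans kk. Qed.

Lemma order_geM k q q' : order_ge k q -> order_ge k (q' * q).
Proof. by move=> /order_geP[P ->]; rewrite mulrCA; exact: order_geXn. Qed.

Lemma order_ge_deriv k q : order_ge k q -> order_ge k.-1 q^`().
Proof. by case: k => [|k] H m mk //; rewrite -derivSn; exact: H. Qed.

Lemma order_ge0 k : order_ge k (0 : {poly R}).
Proof. by move=> m _; rewrite linear0 horner0. Qed.

(** Being polynomial near 0 and near 1, with orders of vanishing at least [a] and [b]. A tensor
    product has zero 2-jet at a corner once the orders of its factors there add up to 3, so these
    two numbers decide which corners a basis function can reach. *)
Definition end_orders (a b : nat) f := exists q0 q1,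
  [/\ germ f q0, germ (fun t => f (1 - t)) q1, order_ge a q0 & order_ge b q1].

Lemma end_orders_le a b a' b' f : (a' <= a)%N -> (b' <= b)%N ->
  end_orders a b f -> end_orders a' b' f.
Proof.
by move=> aa bb [q0 [q1 [g0 g1 o0 o1]]]; exists q0, q1; split => //;
  [exact: order_ge_le o0|exact: order_ge_le o1].
Qed.

Lemma eq_end_orders a b f f' : f =1 f' -> end_orders a b f -> end_orders a b f'.
Proof. by move=> /funext ->. Qed.

Lemma end_orders0 a b : end_orders a b (fun=> 0).
Proof. by exists 0, 0; split; [exact: germ0|exact: germ0|exact: order_ge0|exact: order_ge0]. Qed.

Lemma end_orders_lin a b (c : R) f f' : end_orders a b f -> end_orders a b f' ->
  end_orders a b (fun t => c * f t + f' t).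
Proof.
move=> [q0 [q1 [g0 g1 o0 o1]]] [r0 [r1 [h0 h1 p0 p1]]].
exists (c *: q0 + r0), (c *: q1 + r1); split; try exact: order_ge_lin.
  exact: germ_lin.
exact: (germ_lin c g1 h1).
Qed.

Lemma end_orders_sum a b (I : Type) (r : seq I) (P : pred I) (c : I -> R) (F : I -> R -> R) :
  (forall i, P i -> c i != 0 -> end_orders a b (F i)) ->
  end_orders a b (fun t => \sum_(i <- r | P i) c i * F i t).
Proof.
move=> H; elim: r => [|i r IH].
  by apply: eq_end_orders (end_orders0 a b) => t; rewrite big_nil.
case Pi: (P i); last by apply: eq_end_orders IH => t; rewrite big_cons Pi.
have [c0|c0] := eqVneq (c i) 0.
  by apply: eq_end_orders IH => t; rewrite big_cons Pi c0 mul0r add0r.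
by apply: eq_end_orders (end_orders_lin (c i) (H i Pi c0) IH) => t; rewrite big_cons Pi.
Qed.

Lemma end_orders_mulp a b q f : end_orders a b f -> end_orders a b (fun t => q.[t] * f t).
Proof.
move=> [q0 [q1 [g0 g1 o0 o1]]].
exists (q * q0), ((q \Po (1 - 'X)) * q1); split; try exact: order_geM.
  by apply: germM => //; exact: germ_poly.
apply: germM => //; apply: eq_germ (germ_poly _) => t.
by rewrite horner_comp !hornerE.
Qed.

Lemma end_orders_rev a b f : end_orders a b f -> end_orders b a (fun t => f (1 - t)).
Proof.
move=> [q0 [q1 [g0 g1 o0 o1]]]; exists q1, q0; split => //.
by apply: eq_germ g0 => t; rewrite subKr.
Qed.

Lemma end_orders_deriv a b f : end_orders a b f -> end_orders a.-1 b.-1 (deriv01 (f : R -> R^o)).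
Proof.
move=> [q0 [q1 [g0 g1 o0 o1]]]; exists q0^`(), (- q1^`()); split.
- exact: germ_deriv01.
- exact: germ_deriv01_rev.
- exact: order_ge_deriv.
- by rewrite -mulN1r; apply: order_geM; exact: order_ge_deriv.
Qed.

Lemma end_orders_bspline p s n j : (s < p)%N -> (0 < n)%N -> (j < spline_dim p s n)%N ->
  end_orders j ((spline_dim p s n).-1 - j) (@bspline R p s n j).
Proof.
move=> sp n0 jN; exists (bspline_poly0 p s n j), (bspline_poly1 p s n j); split.
- exact: germ_bspline.
- exact: germ_bspline_rev.
- exact: bspline_poly0_order.
- exact: bspline_poly1_order.
Qed.

Lemma end_orders_spline p r n f : (0 < n)%N -> spline p r n f -> end_orders 0 0 f.
Proof.
move=> n0 [H _].
have nR : 0 < n%:R :> R by rewrite ltr0n.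
have [q0 _ H0] := H 0%N n0.
have [|q1 _ H1] := H n.-1; first by rewrite prednK.
exists q0, (q1 \Po (1 - 'X)); split => //.
  exists n%:R^-1; first by rewrite invr_gt0.
  by move=> t /andP[t0 tn]; apply: H0; rewrite mul0r t0 mul1r ltW.
exists n%:R^-1; first by rewrite invr_gt0.
move=> t /andP[t0 tn]; rewrite horner_comp !hornerE; apply: H1.
rewrite prednK // mulfV ?gt_eqF // lerBlDr lerDl t0 andbT.
rewrite -subn1 natrB // mulrBl mulfV ?gt_eqF // mul1r.
by rewrite lerD2l lerN2 ltW.
Qed.

Definition tens u v : plane R -> R^o := fun xi => u xi.1 * v xi.2.

Lemma tens_turn u v xi : tens u v (quarter_turn xi) = tens v (fun t => u (1 - t)) xi.
Proof. by rewrite /tens /= mulrC. Qed.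

Lemma cjet_tens0 a a' b b' u v : end_orders a a' u -> end_orders b b' v -> (3 <= a + b)%N ->
  cjet (tens u v) (fun _ _ => 0).
Proof.
move=> [q0 [_ [g0 _ o0 _]]] [r0 [_ [h0 _ p0 _]]] ab.
apply: (eq_cjet (cjet_tensor g0 h0)) => // m1 m2 m.
have [m1a|am1] := ltnP m1 a; first by rewrite o0 // mul0r.
by rewrite p0 ?mulr0 //; lia.
Qed.

Lemma tens_turn3 u v xi : tens u v (iter 3 quarter_turn xi) =
  tens (fun t => v (1 - t)) u xi.
Proof. by rewrite /tens /= subKr mulrC. Qed.

(* The four alternatives are the orders of u ⊗ v at the four corners. *)
Lemma cjet_tens_corner a a' b b' u v m : end_orders a a' u -> end_orders b b' v ->
  (m < 4)%N -> (3 <= nth 0 [:: a + b; b + a'; a' + b'; b' + a] m)%N ->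
  cjet (fun xi => tens u v (iter m quarter_turn xi)) (fun _ _ => 0).
Proof.
move=> ou ov; case: m => [|[|[|[|//]]]] _ /= ab.
- exact: cjet_tens0 ou ov ab.
- apply: (eq_cjet (cjet_tens0 ov (end_orders_rev ou) ab)) => // xi _.
  by rewrite tens_turn.
- exact: (cjet_tens0 (end_orders_rev ou) (end_orders_rev ov) ab).
- apply: (eq_cjet (cjet_tens0 (end_orders_rev ov) ou ab)) => // xi _.
  by rewrite tens_turn3.
Qed.

Lemma cjet_tens_ex a b u v m : end_orders 0 0 u -> end_orders a b v ->
  exists J, cjet (fun xi => tens u v (iter m quarter_turn xi)) J.
Proof.
elim: m a b u v => [|m IH] a b u v ou ov.
  have [q0 [_ [g0 _ _ _]]] := ou; have [r0 [_ [h0 _ _ _]]] := ov.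
  by eexists; exact: (cjet_tensor g0 h0).
have [J HJ] := IH 0%N 0%N v _ (end_orders_le (leq0n _) (leq0n _) ov) (end_orders_rev ou).
by exists J; apply: (eq_cjet HJ) => // xi _; rewrite -tens_turn.
Qed.

End Orders.

(** * Pulling back to the patches *)

Section Patches.
Context {R : realType} {I : finType}.
Variables (Omega : set (plane R)) (F : I -> plane R -> plane R).
Variables (p r n : nat).
Implicit Types (xi : plane R) (i : I) (k : 'I_4) (h : rpatch I)
  (U : I -> plane R -> R^o) (g : plane R -> R).

Lemma quarter_turn4 xi : iter 4 quarter_turn xi = xi.
Proof. by case: xi => x y; rewrite /= /quarter_turn /= !subKr. Qed.

Lemma iter_turn_mod m xi : iter (m %% 4) quarter_turn xi = iter m quarter_turn xi.
Proof.
rewrite {2}(divn_eq m 4) addnC iterD; congr iter.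
elim: (m %/ 4)%N => [//|q IH]; by rewrite mulSn iterD -IH quarter_turn4.
Qed.

Lemma unit_square_turn m xi : unit_square xi -> unit_square (iter m quarter_turn xi).
Proof.
move=> H; elim: m => [//|m [/andP[a b] /andP[c d]]] /=.
by split; rewrite /= ?a ?b // subr_ge0 d gerBl c.
Qed.

Lemma open_unit_square_turn m xi : open_unit_square xi -> open_unit_square (iter m quarter_turn xi).
Proof.
move=> H; elim: m => [//|m [/andP[a b] /andP[c d]]] /=.
by split; rewrite /= ?a ?b // subr_gt0 d gtrBl c.
Qed.

Lemma open_unit_square_unit xi : open_unit_square xi -> unit_square xi.
Proof. by move=> [/andP[a b] /andP[c d]]; split; rewrite ?(ltW a) ?(ltW b) ?(ltW c) ?(ltW d). Qed.

(** The quarter turns that lead from the coordinates of rotation [k] to those of [k']; adding 4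
    avoids truncated subtraction. *)
Definition turns k' k : nat := ((k + 4 - k') %% 4)%N.

Lemma turns_lt k' k : (turns k' k < 4)%N.
Proof. by rewrite ltn_mod. Qed.

Lemma turns_eq0 k' k : turns k' k = 0%N -> k' = k.
Proof.
rewrite /turns => H; apply: val_inj => /=.
by have := ltn_ord k; have := ltn_ord k'; move: H; lia.
Qed.

Lemma turnsxx k : turns k k = 0%N.
Proof. by rewrite /turns addnC addnK. Qed.

Lemma param_turns i k' k xi : param F (i, k) xi = param F (i,
  k') (iter (turns k' k) quarter_turn xi).
Proof.
rewrite /param /turns iter_turn_mod -iterD subnKC; last by rewrite (leq_trans (ltnW (ltn_ord k')))
  // leq_addl.
by rewrite iterD quarter_turn4.
Qed.

Hypotheses (n0 : (0 < n)%N) (hdom : multipatch_domain Omega F p r n).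

Lemma F_inj i xi xi' : unit_square xi -> unit_square xi' -> F i xi = F i xi' -> xi = xi'.
Proof.
by have [_ _ _ /(_ i)[_ _ inj _] _] := hdom; move=> u u'; apply: inj; rewrite inE.
Qed.

Lemma iter_turn_inj m xi xi' : iter m quarter_turn xi = iter m quarter_turn xi' -> xi = xi'.
Proof.
elim: m => [//|m IH] /= E; apply: IH; move: E.
case: (iter m _ xi) (iter m _ xi') => a b [c d] [/eqP].
by rewrite (inj_eq (addrI _)) eqr_opp => /eqP -> ->.
Qed.

Lemma param_inj h xi xi' : unit_square xi -> unit_square xi' ->
  param F h xi = param F h xi' -> xi = xi'.
Proof.
move=> u u' /(F_inj (unit_square_turn _ u) (unit_square_turn _ u')).
exact: iter_turn_inj.
Qed.

Lemma push_param h g xi : unit_square xi -> push F h g (param F h xi) = g xi.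
Proof.
move=> u; rewrite /push asboolT; last by exists xi.
congr g; apply: (@param_inj h).
- by case: xgetP => [x _ [] //|/(_ xi)[]].
- by [].
- by case: xgetP => [x _ []//|/(_ xi)[]].
Qed.

Lemma pull_on_patch i' k' g i k xi : unit_square xi ->
  pull F (on_patch F (i', k') g) (i, k) xi =
  if i == i' then g (iter (turns k' k) quarter_turn xi) else 0.
Proof.
move=> u; rewrite /pull /on_patch /=; case: eqP => // ->.
by rewrite (param_turns _ k') push_param //; exact: unit_square_turn.
Qed.

Lemma on_patch_lin h (a : R) g g' :
  on_patch F h (fun xi => a * g xi + g' xi) = a *: on_patch F h g + on_patch F h g' :> (I -> plane
    R -> R^o).
Proof.
apply/funext => i; apply/funext => x.
rewrite [RHS](_ : _ = a * on_patch F h g i x + on_patch F h g' i x) // /on_patch.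
case: (i == h.1); last by rewrite [RHS](_ : _ = a * 0 + 0) // mulr0 addr0.
by rewrite /push; case: ifP => // _; rewrite mulr0 addr0.
Qed.

Lemma on_patch0 h : on_patch F h (fun=> 0) = 0 :> (I -> plane R -> R^o).
Proof.
apply/funext => i; apply/funext => x; rewrite /on_patch; case: (i == h.1) => //.
by rewrite /push; case: ifP.
Qed.

Lemma on_patch_sum h (J : Type) (s : seq J) (P : pred J) (c : J -> R) (g : J -> plane R -> R) :
  on_patch F h (fun xi => \sum_(j <- s | P j) c j * g j xi)
  = \sum_(j <- s | P j) c j *: on_patch F h (g j) :> (I -> plane R -> R^o).
Proof.
elim: s => [|j s IH].
  by rewrite big_nil -(on_patch0 h); congr on_patch; apply/funext => xi; rewrite big_nil.
rewrite big_cons; case Pj: (P j); last first.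
  by rewrite -IH; congr on_patch; apply/funext => xi; rewrite big_cons Pj.
by rewrite -IH -on_patch_lin; congr on_patch; apply/funext => xi; rewrite big_cons Pj.
Qed.

(** By conformity distinct closed patches meet only in corners or sides, and injectivity keeps
    interior points off those. Hence [glue] has no choice over an open square. *)
Lemma patch_disjoint i i' xi : open_unit_square xi -> closed_patch F i' (F i xi) -> i' = i.
Proof.
move=> o ci'; apply/eqP; apply: contraT => i'i.
have [_ _ _ _ /(_ i i')] := hdom; rewrite eq_sym => /(_ i'i).
have u := open_unit_square_unit o.
have inter : (closed_patch F i `&` closed_patch F i') (F i xi).
  by split => //; exists xi.
have corner_no k : F i xi <> corner F (i, k).
  move=> /(F_inj u) E.
  have : unit_square (iter k quarter_turn (0 : R, 0 : R)).
    by apply: unit_square_turn; split; rewrite /= lexx ler01.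
  move=> /E {}E; move: o; rewrite E => /(open_unit_square_turn (4 - k)).
  rewrite -iterD subnK; last by rewrite ltnW.
  by rewrite quarter_turn4 => -[]; rewrite /= ltxx.
have side_no k : ~ closed_side1 F (i, k) (F i xi).
  move=> [t /=]; rewrite in_itv /= => t01 E.
  have u' : unit_square (0 : R, t) by split; rewrite //= lexx ler01.
  have := F_inj (unit_square_turn k u') u E => {}E.
  move: o; rewrite -E => /(open_unit_square_turn (4 - k)).
  rewrite -iterD subnK; last by rewrite ltnW.
  by rewrite quarter_turn4 => -[]; rewrite /= ltxx.
case=> [E|[k [k' [_ E]]]|[k [k' [E _]]]]; move: inter; rewrite E.
- by [].
- by move=> /corner_no.
- by move=> /side_no.
Qed.

Lemma glue_pull U i k xi : open_unit_square xi -> Defs.glue F U (param F (i, k) xi) = pull F U (i,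
  k) xi.
Proof.
move=> o; rewrite /Defs.glue /pull /param /=.
have o' := open_unit_square_turn k o.
case: pickP => [i' /asboolP/(patch_disjoint o') -> //|/(_ i)/asboolP[]].
by exists (iter k quarter_turn xi) => //; exact: open_unit_square_unit.
Qed.

(** The patch picked at a point does not depend on the function, so gluing is linear even where the
    restrictions disagree. *)
Lemma glue_lin (J : finType) (c : J -> R) (U : J -> I -> plane R -> R^o) :
  Defs.glue F (\sum_j c j *: U j) = \sum_j c j *: Defs.glue F (U j).
Proof.
apply/funext => x; rewrite [RHS](_ : _ = \sum_j c j * Defs.glue F (U j) x);
  last by rewrite fct_sumE.
rewrite /Defs.glue; case: pickP => [i _|_]; last by rewrite big1 // => j _; rewrite mulr0.
by rewrite !fct_sumE.
Qed.

Lemma pull_sum (J : Type) (s : seq J) (P : pred J) (c : J -> R) (U : J -> I -> plane R -> R^o) h xi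
  :
  pull F (\sum_(j <- s | P j) c j *: U j) h xi = \sum_(j <- s | P j) c j * pull F (U j) h xi.
Proof. by rewrite /pull fct_sumE fct_sumE. Qed.

(** A quarter turn has determinant 1, so the Jacobian may be computed in the turned coordinates. At
    a corner with a coordinate 1 the derivative in that variable comes from the reflected rule. *)
Lemma corner_jacobian (H : plane R -> plane R) m P Q : (m < 4)%N ->
  cjet (fun xi => (H (iter m quarter_turn xi)).1 : R^o) P ->
  cjet (fun xi => (H (iter m quarter_turn xi)).2 : R^o) Q ->
  Defs.jacobian H (iter m quarter_turn (0, 0))
  = P 1%N 0%N * Q 0%N 1%N - P 0%N 1%N * Q 1%N 0%N.
Proof.
move=> m4 [D1 [C1 [e1 e10 H1] J1]] [D2 [C2 [e2 e20 H2] J2]].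
rewrite !J1 // !J2 //.
have [e0 [e00 ea eb]] := pos_min e10 e20.
have GE x y : 0 <= x < e0 -> 0 <= y < e0 ->
    H (iter m quarter_turn (x, y)) = (D1 0%N 0%N x y, D2 0%N 0%N x y).
  move=> /andP[x0 xe] /andP[y0 ye]; rewrite [LHS]surjective_pairing; congr (_, _).
    by apply: H1; rewrite ?x0 ?y0 /=; exact: lt_le_trans ea.
  by apply: H2; rewrite ?x0 ?y0 /=; exact: lt_le_trans eb.
have [a1 b1] := C1 0%N 0%N isT 0 0; have [a2 b2] := C2 0%N 0%N isT 0 0.
have z01 : 0 <= (0 : R) <= 1 by rewrite lexx ler01.
have e0z : 0 <= (0 : R) < e0 by rewrite lexx.
have axis1 : exists2 e, 0 < e & forall y : R, 0 <= y <= 1 -> `|y - 0| < e ->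
    H (iter m quarter_turn (y, 0)) = (D1 0%N 0%N y 0, D2 0%N 0%N y 0).
  by exists e0 => // y /andP[y0 _]; rewrite subr0 ger0_norm // => ye; apply: GE; rewrite ?y0.
have axis2 : exists2 e, 0 < e & forall y : R, 0 <= y <= 1 -> `|y - 0| < e ->
    H (iter m quarter_turn (0, y)) = (D1 0%N 0%N 0 y, D2 0%N 0%N 0 y).
  by exists e0 => // y /andP[y0 _]; rewrite subr0 ger0_norm // => ye; apply: GE; rewrite ?y0.
have da := is_derive_pair a1 a2; have db := is_derive_pair b1 b2.
clear GE H1 H2.
move: axis1 axis2; case: m m4 => [|[|[|[|//]]]] _ /= axis1 axis2; rewrite /Defs.jacobian.
- have -> : d1 H (0, 0) = (D1 1%N 0%N 0 0, D2 1%N 0%N 0 0).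
    by apply: (deriv01_eq z01 _ da); have [e e_ ax] := axis1; exists e => // y y01 ye;
      rewrite -ax // /quarter_turn /= ?subr0 ?subrr ?subKr.
  have -> : d2 H (0, 0) = (D1 0%N 1%N 0 0, D2 0%N 1%N 0 0).
    by apply: (deriv01_eq z01 _ db); have [e e_ ax] := axis2; exists e => // y y01 ye;
      rewrite -ax // /quarter_turn /= ?subr0 ?subrr ?subKr.
  by rewrite /= (mulrC (D2 1%N 0%N 0 0)).
- rewrite /quarter_turn /= !subr0.
  have -> : d2 H (1, 0) = (D1 1%N 0%N 0 0, D2 1%N 0%N 0 0).
    by apply: (deriv01_eq z01 _ da); have [e e_ ax] := axis1; exists e => // y y01 ye;
      rewrite -ax // /quarter_turn /= ?subr0 ?subrr ?subKr.
  have -> : d1 H (1, 0) = - (D1 0%N 1%N 0 0, D2 0%N 1%N 0 0).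
    rewrite /d1 /= -[X in deriv01 _ X](subr0 1).
    by apply: (deriv01_eq_rev z01 _ db); have [e e_ ax] := axis2; exists e => // y y01 ye;
      rewrite -ax // /quarter_turn /= ?subr0 ?subrr ?subKr.
  by rewrite /= !mulNr opprK addrC (mulrC (D2 0%N 1%N 0 0)).
- rewrite /quarter_turn /= !subr0.
  have -> : d1 H (1, 1) = - (D1 1%N 0%N 0 0, D2 1%N 0%N 0 0).
    rewrite /d1 /= -[X in deriv01 _ X](subr0 1).
    by apply: (deriv01_eq_rev z01 _ da); have [e e_ ax] := axis1; exists e => // y y01 ye;
      rewrite -ax // /quarter_turn /= ?subr0 ?subrr ?subKr.
  have -> : d2 H (1, 1) = - (D1 0%N 1%N 0 0, D2 0%N 1%N 0 0).
    rewrite /d2 /= -[X in deriv01 _ X](subr0 1).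
    by apply: (deriv01_eq_rev z01 _ db); have [e e_ ax] := axis2; exists e => // y y01 ye;
      rewrite -ax // /quarter_turn /= ?subr0 ?subrr ?subKr.
  by rewrite /= !mulrNN (mulrC (D2 1%N 0%N 0 0)).
- rewrite /quarter_turn /= !subr0 subrr.
  have -> : d2 H (0, 1) = - (D1 1%N 0%N 0 0, D2 1%N 0%N 0 0).
    rewrite /d2 /= -[X in deriv01 _ X](subr0 1).
    by apply: (deriv01_eq_rev z01 _ da); have [e e_ ax] := axis1; exists e => // y y01 ye;
      rewrite -ax // /quarter_turn /= ?subr0 ?subrr ?subKr.
  have -> : d1 H (0, 1) = (D1 0%N 1%N 0 0, D2 0%N 1%N 0 0).
    by apply: (deriv01_eq z01 _ db); have [e e_ ax] := axis2; exists e => // y y01 ye;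
      rewrite -ax // /quarter_turn /= ?subr0 ?subrr ?subKr.
  by rewrite /= !mulrN opprK addrC (mulrC (D2 0%N 1%N 0 0)).
Qed.

(** Spline coordinates are polynomial near each corner, so jets exist; positivity of the Jacobian
    makes the linear part invertible. *)
Lemma param_jets i k : exists P Q, [/\
  cjet (fun xi => (param F (i, k) xi).1 : R^o) P,
  cjet (fun xi => (param F (i, k) xi).2 : R^o) Q &
  P 1%N 0%N * Q 0%N 1%N - P 0%N 1%N * Q 1%N 0%N != 0].
Proof.
have [_ _ _ /(_ i)[[s1 T1 E1] [s2 T2 E2] _ jac] _] := hdom.
have ex (s : plane R -> R^o) : tensor_spline p r n s ->
    exists J, cjet (fun xi => s (iter k quarter_turn xi)) J.
  move=> [m [c [u [Hu ->]]]].
  have /choice[J HJ] : forall j, exists J, cjet (fun xi => u j (iter k quarter_turn xi)) J.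
    move=> j; have [f [g [sf sg ->]]] := Hu j.
    exact: (cjet_tens_ex k (end_orders_spline n0 sf) (end_orders_spline n0 sg)).
  exists (fun m1 m2 => \sum_j c j * J j m1 m2).
  apply: (eq_cjet (cjet_sum (index_enum _) (P := xpredT) c (fun j _ => HJ j))) => //.
  by move=> xi _; rewrite fct_sumE.
have [P HP] := ex _ T1; have [Q HQ] := ex _ T2.
have HP' : cjet (fun xi => (param F (i, k) xi).1 : R^o) P.
  by apply: (eq_cjet HP) => // xi; rewrite inE => u; rewrite /param E1 //; exact: unit_square_turn.
have HQ' : cjet (fun xi => (param F (i, k) xi).2 : R^o) Q.
  by apply: (eq_cjet HQ) => // xi; rewrite inE => u; rewrite /param E2 //; exact: unit_square_turn.
exists P, Q; split => //.
have u0 : unit_square (0 : R, 0 : R) by split; rewrite /= lexx ler01.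
have := jac _ (unit_square_turn k u0).
by rewrite (corner_jacobian (ltn_ord k) HP' HQ') => jac0; rewrite gt_eqF.
Qed.

End Patches.

(** * Edge functions *)

Section Triangular.
Context {R : realType}.
Variables (K : nat) (Q : nat -> {poly R}).
Hypotheses (ordQ : forall j, (j < K)%N -> order_ge j (Q j))
  (leadQ : forall j, (j < K)%N -> (Q j)^`(j).[0] != 0).

Lemma triangular_solve (y : nat -> R) : exists2 a : nat -> R,
  (forall j, (K <= j)%N -> a j = 0) &
  forall m, (m < K)%N -> \sum_(j < K) a j * (Q j)^`(m).[0] = y m.
Proof.
elim: K ordQ leadQ => [|k IH] o l; first by exists (fun=> 0).
have [||a a0 Ha] := IH.
- by move=> j jk; apply: o; exact: ltnW.
- by move=> j jk; apply: l; exact: ltnW.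
(* [Q k] does not enter the first [k] equations, so its coefficient is fixed by the last one. *)
exists (fun j => if j == k then (y k - \sum_(j < k) a j * (Q j)^`(k).[0]) / (Q k)^`(k).[0] else a
  j).
  by move=> j kj; rewrite gtn_eqF // a0 // ltnW.
have small m : \sum_(j < k) (if j == k :> nat then (y k - \sum_(j < k) a j * (Q j)^`(k).[0]) / (Q
  k)^`(k).[0] else a j) * (Q j)^`(m).[0] = \sum_(j < k) a j * (Q j)^`(m).[0].
  by apply: eq_bigr => j _; rewrite ltn_eqF.
move=> m; rewrite ltnS leq_eqVlt big_ord_recr /= eqxx small => /orP[/eqP ->|mk].
  by rewrite divfK ?l // addrC subrK.
by rewrite (o k (ltnSn k) m mk) mulr0 addr0 Ha.
Qed.

Lemma triangular_uniq (a : nat -> R) :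
  (forall m, (m < K)%N -> \sum_(j < K) a j * (Q j)^`(m).[0] = 0) ->
  forall j, (j < K)%N -> a j = 0.
Proof.
move=> H; elim/ltn_ind => j IH jK.
have := H j jK; rewrite (bigD1 (Ordinal jK)) //= big1 ?addr0.
  by move=> /eqP; rewrite mulf_eq0 (negbTE (leadQ jK)) orbF => /eqP.
move=> i; rewrite -val_eqE /= neq_ltn => /orP[ij|ji]; first by rewrite IH // mul0r.
by rewrite (ordQ (ltn_ord i)) // mulr0.
Qed.

End Triangular.

(** * Functions attached to one side of a patch *)

Section SideFunctions.
Context {R : realType}.
Variables (p r n : nat).

Local Notation N := (spline_dim p r n).
Local Notation Nm := (spline_dim p.-1 r n).
Local Notation Np := (spline_dim p r.+1 n).
Local Notation b := (@bspline R p r n).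
Local Notation bplus := (@bspline R p r.+1 n).
Local Notation bminus := (@bspline R p.-1 r n).
Local Notation c0 := (@c0 R p r n).
Local Notation c1 := (@c1 R p r n).
Implicit Types (a d : nat -> R) (A B : R -> R) (al be q : {poly R}) (J : nat -> nat -> R).

Hypotheses (rp : (r.+1 < p)%N) (n0 : (0 < n)%N) (hN : (5 <= Nm)%N).

Lemma ltrp : (r < p)%N. Proof. exact: ltnW. Qed.
Lemma ltrp1 : (r < p.-1)%N. Proof. by move: rp; lia. Qed.
Lemma p_gt0 : (0 < p)%N. Proof. exact: leq_trans rp. Qed.

Lemma NpE : Np = Nm.+1.
Proof.
rewrite /spline_dim (_ : (p - r.+1 = p.-1 - r)%N); last by lia.
by have := p_gt0; move: (_ * _)%N => m; lia.
Qed.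

Lemma NpE1 : Np.-1 = Nm.
Proof. by rewrite NpE. Qed.

(** This room makes [b 0] and [b 1] vanish to order at least 3 at the far end, which keeps side
    functions away from the opposite side. *)
Lemma N_ge6 : (6 <= N)%N.
Proof.
have h : (N = (p.-1 - r) * (n - 1) + (n - 1) + p + 1)%N.
  by rewrite /spline_dim -mulSnr (_ : ((p.-1 - r).+1 = p - r)%N) //; lia.
by have := p_gt0; move: hN; rewrite h /spline_dim; move: (_ * _)%N => m; lia.
Qed.

(** The inverse [p / h] of the factor in [c1], by which [b 1] becomes a multiple of [c1]. *)
Definition kappa : R := p%:R * n%:R.

Lemma kappa_neq0 : kappa != 0.
Proof. by rewrite mulf_neq0 // pnatr_eq0 -lt0n // p_gt0. Qed.

Lemma b1E t : b 1 t = kappa * c1 t.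
Proof.
have pR : p%:R != 0 :> R by rewrite pnatr_eq0 -lt0n p_gt0.
have nR : n%:R != 0 :> R by rewrite pnatr_eq0 -lt0n.
by rewrite /c1 /kappa; move: (b 1 t : R) => x; field; apply/andP.
Qed.

Definition qc0 : {poly R} := bspline_poly0 p r n 0 + bspline_poly0 p r n 1.
Definition qc1 : {poly R} := (n%:R^-1 / p%:R) *: bspline_poly0 p r n 1.

Lemma germ_c0 : germ c0 qc0.
Proof.
have := germ_lin (1 : R) (germ_bspline ltrp n0 0) (germ_bspline ltrp n0 1); rewrite scale1r.
by apply: eq_germ => t; rewrite mul1r.
Qed.

Lemma germ_c1 : germ c1 qc1.
Proof.
have := germ_lin (n%:R^-1 / p%:R : R) (germ_bspline ltrp n0 1) (germ0 (R := R)); rewrite addr0.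
by apply: eq_germ => t; rewrite addr0.
Qed.

(** [c0] and [c1] are a Hermite pair at 0: their coefficients in a side function are its trace and
    its transversal derivative. *)
Lemma qc_values : [/\ qc0.[0] = 1, qc0^`().[0] = 0, qc1.[0] = 0 & qc1^`().[0] = 1].
Proof.
have [h1 h2 h3 h4] := bspline_poly0_first (R := R) ltrp n0 p_gt0.
rewrite /qc0 /qc1 derivD derivZ !hornerD !hornerZ h1 h2 h3 h4 addr0 mulr0 addNr.
split => //; have := kappa_neq0; rewrite /kappa mulf_eq0 negb_or => /andP[pR nR].
by field; apply/andP.
Qed.

Lemma end_orders_c0 : end_orders 0 3 c0.
Proof.
have h1 : end_orders 0 3 (b 0).
  by apply: end_orders_le (end_orders_bspline (R := R) ltrp n0 _) => //; have := N_ge6; lia.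
have h2 : end_orders 0 3 (b 1).
  by apply: end_orders_le (end_orders_bspline (R := R) ltrp n0 _) => //; have := N_ge6; lia.
by apply: eq_end_orders (end_orders_lin 1 h1 h2) => t; rewrite mul1r.
Qed.

Lemma end_orders_c1 : end_orders 1 3 c1.
Proof.
have h2 : end_orders 1 3 (b 1).
  by apply: end_orders_le (end_orders_bspline (R := R) ltrp n0 _) => //; have := N_ge6; lia.
apply: eq_end_orders (end_orders_lin (n%:R^-1 / p%:R) h2 (end_orders0 (R := R) _ _)) => t.
by rewrite addr0.
Qed.

Definition trace_fun a (t : R) : R := \sum_(j < Np) a j * bplus j t.
Definition dtrace_fun a (t : R) : R := \sum_(j < Np) a j * deriv01 (bplus j) t.
Definition normal_fun d (t : R) : R := \sum_(j < Nm) d j * bminus j t.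
(** The transversal derivative of an edge function along its edge. One formula serves both patches
    and boundary edges, with [- al2] for the second patch and the data 1 and 0 on the boundary. *)
Definition cross_fun al be a d (t : R) : R :=
  - be.[t] * dtrace_fun a t + al.[t] * (kappa * normal_fun d t).

Definition trace_poly a : {poly R} := \sum_(j < Np) a j *: bspline_poly0 p r.+1 n j.
Definition normal_poly d : {poly R} := \sum_(j < Nm) d j *: bspline_poly0 p.-1 r n j.
Definition cross_poly al be a d : {poly R} :=
  - be * (trace_poly a)^`() + al * (kappa *: normal_poly d).

Lemma germ_trace a : germ (trace_fun a) (trace_poly a).
Proof. by apply: germ_sum => j _; exact: germ_bspline. Qed.

Lemma germ_normal d : germ (normal_fun d) (normal_poly d).
Proof. by apply: germ_sum => j _; apply: germ_bspline => //; exact: ltrp1. Qed.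

Lemma germ_dtrace a : germ (dtrace_fun a) (trace_poly a)^`().
Proof.
have -> : (trace_poly a)^`() = \sum_(j < Np) a j *: (bspline_poly0 p r.+1 n j)^`().
  by rewrite /trace_poly linear_sum; apply: eq_bigr => j _; rewrite linearZ.
by apply: germ_sum => j _; apply: germ_deriv01; exact: germ_bspline.
Qed.

Lemma germ_cross al be a d : germ (cross_fun al be a d) (cross_poly al be a d).
Proof.
have h1 := germM (germ_poly (- be)) (germ_dtrace a).
have h2 := germM (germ_poly al) (germ_lin kappa (germ_normal d) (germ0 (R := R))).
have := germ_lin 1 h1 h2; rewrite scale1r addr0 -/(cross_poly _ _ _ _).
by apply: eq_germ => t; rewrite mul1r hornerN addr0.
Qed.

Lemma end_orders_trace s s' a :
  (forall j : 'I_Np, a j != 0 -> (s <= j)%N /\ (s' <= Nm - j)%N) ->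
  end_orders s s' (trace_fun a).
Proof.
move=> H; apply: end_orders_sum => j _ /H[h1 h2].
apply: end_orders_le (end_orders_bspline (R := R) rp n0 (ltn_ord j)) => //.
by rewrite NpE1.
Qed.

Lemma end_orders_normal s s' d :
  (forall j : 'I_Nm, d j != 0 -> (s <= j)%N /\ (s' <= Nm.-1 - j)%N) ->
  end_orders s s' (normal_fun d).
Proof.
move=> H; apply: end_orders_sum => j _ /H[h1 h2].
by apply: end_orders_le (end_orders_bspline (R := R) ltrp1 n0 (ltn_ord j)).
Qed.

(** The trace coefficients need one order more than is claimed, since the derivative of the trace
    loses one; for [s = 0] nothing is asked at the near end. *)
Lemma end_orders_cross s s' al be a d :
  (forall j : 'I_Np, a j != 0 -> (s.+1 <= j)%N || (s == 0)%N /\ (s'.+1 <= Nm - j)%N) ->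
  end_orders s s' (normal_fun d) ->
  end_orders s s' (cross_fun al be a d).
Proof.
move=> Ha Hd.
have h1 : end_orders s s' (dtrace_fun a).
  apply: end_orders_sum => j _ /Ha[h1 h2].
  have := end_orders_deriv (end_orders_bspline (R := R) rp n0 (ltn_ord j)).
  apply: end_orders_le; last by rewrite NpE1; lia.
  by case/orP: h1 => [|/eqP ->//]; lia.
have h2 := end_orders_lin kappa Hd (end_orders0 (R := R) s s').
apply: eq_end_orders (end_orders_lin 1 (end_orders_mulp (- be) h1) (end_orders_mulp al h2)) => t.
by rewrite mul1r hornerN addr0.
Qed.

Definition side1_fun A B : plane R -> R^o := fun xi => tens c0 A xi + tens c1 B xi.
Definition side2_fun A B : plane R -> R^o := fun xi => tens A c0 xi + tens B c1 xi.

(** The first index counts transversal and the second tangential derivatives. *)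
Definition side_jet (qA qB : {poly R}) (m1 m2 : nat) : R :=
  qc0^`(m1).[0] * qA^`(m2).[0] + qc1^`(m1).[0] * qB^`(m2).[0].

Lemma cjet_side1 A B qA qB : germ A qA -> germ B qB ->
  cjet (side1_fun A B) (side_jet qA qB).
Proof.
move=> gA gB.
apply: (eq_cjet (cjet_lin 1 (cjet_tensor germ_c0 gA) (cjet_tensor germ_c1 gB))).
  by move=> xi _; rewrite mul1r.
by move=> m1 m2 _; rewrite mul1r.
Qed.

Lemma cjet_side2 A B qA qB : germ A qA -> germ B qB ->
  cjet (side2_fun A B) (fun m1 m2 => side_jet qA qB m2 m1).
Proof.
move=> gA gB.
apply: (eq_cjet (cjet_lin 1 (cjet_tensor gA germ_c0) (cjet_tensor gB germ_c1))).
  by move=> xi _; rewrite mul1r.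
by move=> m1 m2 _; rewrite mul1r /side_jet ![_ * qc0^`(_).[0]]mulrC ![_ * qc1^`(_).[0]]mulrC.
Qed.

Lemma side_jet0 qA qB m : side_jet qA qB 0 m = qA^`(m).[0].
Proof. by have [h1 h2 h3 h4] := qc_values; rewrite /side_jet !derivn0 h1 h3 mul1r mul0r addr0. Qed.

Lemma side_jet1 qA qB m : side_jet qA qB 1 m = qB^`(m).[0].
Proof. by have [h1 h2 h3 h4] := qc_values; rewrite /side_jet !derivn1 h2 h4 mul1r mul0r add0r. Qed.

(** Only [c0] and [c1] involve the transversal variable. Patch functions obey the same relation, and
    this is why the unmatched second derivatives cancel in the vertex projection. *)
Lemma side_jet_normal2 qA qB m : side_jet qA qB 2 m =
  qc0^`(2).[0] * side_jet qA qB 0 m + qc1^`(2).[0] * side_jet qA qB 1 m.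
Proof. by rewrite side_jet0 side_jet1. Qed.

(** Turns 0 and 3 lead to the two ends of the side, where the orders of [A] and [B] count; at the
    other corners the order 3 of [c0] and [c1] is enough. Since [c1] already vanishes once on the
    side, order 2 is enough for [B]. *)
Lemma cjet_side1_corner A B (a0 a1 b0 b1 m : nat) :
  end_orders a0 a1 A -> end_orders b0 b1 B -> (m < 4)%N ->
  (m = 0%N -> (3 <= a0)%N && (2 <= b0)%N) -> (m = 3%N -> (3 <= a1)%N && (2 <= b1)%N) ->
  cjet (fun xi => side1_fun A B (iter m quarter_turn xi)) (fun _ _ => 0).
Proof.
move=> oA oB m4 m0 m3.
have h1 : cjet (fun xi => tens c0 A (iter m quarter_turn xi)) (fun _ _ => 0).
  by apply: (cjet_tens_corner end_orders_c0 oA m4); case: m m4 m0 m3 => [|[|[|[|//]]]] _ m0 m3 /=;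
    lia.
have h2 : cjet (fun xi => tens c1 B (iter m quarter_turn xi)) (fun _ _ => 0).
  by apply: (cjet_tens_corner end_orders_c1 oB m4); case: m m4 m0 m3 {h1} => [|[|[|[|//]]]] _ m0 m3
    /=; lia.
by apply: (eq_cjet (cjet_lin 1 h1 h2)) => [xi _|m1 m2 _]; rewrite mul1r ?addr0.
Qed.

Lemma cjet_side2_corner A B (a0 a1 b0 b1 m : nat) :
  end_orders a0 a1 A -> end_orders b0 b1 B -> (m < 4)%N ->
  (m = 0%N -> (3 <= a0)%N && (2 <= b0)%N) -> (m = 1%N -> (3 <= a1)%N && (2 <= b1)%N) ->
  cjet (fun xi => side2_fun A B (iter m quarter_turn xi)) (fun _ _ => 0).
Proof.
move=> oA oB m4 m0 m3.
have h1 : cjet (fun xi => tens A c0 (iter m quarter_turn xi)) (fun _ _ => 0).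
  by apply: (cjet_tens_corner oA end_orders_c0 m4); case: m m4 m0 m3 => [|[|[|[|//]]]] _ m0 m3 /=;
    lia.
have h2 : cjet (fun xi => tens B c1 (iter m quarter_turn xi)) (fun _ _ => 0).
  by apply: (cjet_tens_corner oB end_orders_c1 m4); case: m m4 m0 m3 {h1} => [|[|[|[|//]]]] _ m0 m3
    /=; lia.
by apply: (eq_cjet (cjet_lin 1 h1 h2)) => [xi _|m1 m2 _]; rewrite mul1r ?addr0.
Qed.

(* Coefficients of an edge function attached to a vertex: indices j1 + j2 <= 2. *)
Definition vertex_coefs a d :=
  (forall j, (3 <= j)%N -> a j = 0) /\ (forall j, (2 <= j)%N -> d j = 0).

Lemma sum_trunc (V : lmodType R) (M K : nat) (c : nat -> R) (f : nat -> V) : (K <= M)%N ->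
  (forall j, (K <= j)%N -> c j = 0) -> \sum_(j < M) c j *: f j = \sum_(j < K) c j *: f j.
Proof.
move=> KM c0_; rewrite [RHS](big_ord_widen M (fun j => c j *: f j)) //.
rewrite [RHS]big_mkcond; apply: eq_bigr => j _.
by case: ltnP => // Kj; rewrite c0_ // scale0r.
Qed.

Lemma trace_poly_jet a d m : vertex_coefs a d ->
  (trace_poly a)^`(m).[0] = \sum_(j < 3) a j * (bspline_poly0 p r.+1 n j)^`(m).[0].
Proof.
move=> [a0 _]; rewrite /trace_poly (@sum_trunc _ _ 3) //; last by rewrite NpE; lia.
rewrite linear_sum horner_sum; apply: eq_bigr => j _.
by rewrite linearZ hornerZ.
Qed.

Lemma normal_poly_jet a d m : vertex_coefs a d ->
  (normal_poly d)^`(m).[0] = \sum_(j < 2) d j * (bspline_poly0 p.-1 r n j)^`(m).[0].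
Proof.
move=> [_ d0]; rewrite /normal_poly (@sum_trunc _ _ 2) //; last by lia.
rewrite linear_sum horner_sum; apply: eq_bigr => j _.
by rewrite linearZ hornerZ.
Qed.

Lemma cross_poly_jet0 al be a d : (cross_poly al be a d).[0] =
  - be.[0] * (trace_poly a)^`(1).[0] + al.[0] * (kappa * (normal_poly d)^`(0).[0]).
Proof. by rewrite /cross_poly derivn1 derivn0 hornerD !hornerM hornerN hornerZ. Qed.

Lemma cross_poly_jet1 al be a d : (cross_poly al be a d)^`().[0] =
  - be^`().[0] * (trace_poly a)^`(1).[0] - be.[0] * (trace_poly a)^`(2).[0]
  + al^`().[0] * (kappa * (normal_poly d)^`(0).[0]) + al.[0] * (kappa * (normal_poly d)^`(1).[0]).
Proof.
rewrite /cross_poly !derivn1 derivn0 derivnS derivn1.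
rewrite derivD !derivM derivN derivZ !(hornerD, hornerM, hornerN, hornerZ).
by rewrite !mulNr !addrA.
Qed.

(** Five conditions, as many as there are coefficients [a 0], [a 1], [a 2], [d 0], [d 1] attached to
    a vertex. *)
Definition side_matches (J J' : nat -> nat -> R) :=
  forall m1 m2, (m1 <= 1)%N -> (m1 + m2 <= 2)%N -> J m1 m2 = J' m1 m2.

Lemma side_solve al be J : al.[0] != 0 -> exists a d, vertex_coefs a d /\
  side_matches (side_jet (trace_poly a) (cross_poly al be a d)) J.
Proof.
move=> al0.
have [||a a0 Ha] := @triangular_solve R 3 (bspline_poly0 p r.+1 n) _ _ (J 0%N).
- by move=> j _; exact: bspline_poly0_order.
- by move=> j j3; apply: bspline_poly0_lead => //; move: rp; lia.
(* The trace is already fixed; [z] is the 1-jet of the normal part found by solving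
   [cross_poly_jet0] and [cross_poly_jet1] for it. *)
pose z := fun m => if m == 0%N then (J 1%N 0%N + be.[0] * J 0%N 1%N) / (al.[0] * kappa)
  else (J 1%N 1%N + be^`().[0] * J 0%N 1%N + be.[0] * J 0%N 2%N
    - al^`().[0] * (kappa * ((J 1%N 0%N + be.[0] * J 0%N 1%N) / (al.[0] * kappa)))) / (al.[0] *
      kappa).
have [||d d0 Hd] := @triangular_solve R 2 (bspline_poly0 p.-1 r n) _ _ z.
- by move=> j _; apply: bspline_poly0_order => //; exact: ltrp1.
- by move=> j j3; apply: bspline_poly0_lead => //; [exact: ltrp1|move: rp; lia].
have V : vertex_coefs a d by split.
exists a, d; split => // m1 m2; have k0 := kappa_neq0.
have hA m : (m < 3)%N -> (trace_poly a)^`(m).[0] = J 0%N m.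
  by move=> m3; rewrite (trace_poly_jet _ V) Ha.
have hD m : (m < 2)%N -> (normal_poly d)^`(m).[0] = z m.
  by move=> m3; rewrite (normal_poly_jet _ V) Hd.
case: m1 => [|[|//]] _ m12; first by rewrite side_jet0 hA.
rewrite side_jet1; case: m2 m12 => [|[|//]] _.
  rewrite derivn0 cross_poly_jet0 !hA // !hD // /z /=; field.
  by apply/andP.
rewrite derivn1 cross_poly_jet1 !hA // !hD // /z /=; field.
by apply/andP.
Qed.

Lemma side_uniq al be a d : al.[0] != 0 -> vertex_coefs a d ->
  side_matches (side_jet (trace_poly a) (cross_poly al be a d)) (fun _ _ => 0) ->
  (forall j, a j = 0) /\ (forall j, d j = 0).
Proof.
move=> al0 V H; have k0 := kappa_neq0.
have hA m : (m < 3)%N -> (trace_poly a)^`(m).[0] = 0.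
  by move=> m3; rewrite -[RHS](H 0%N m) // side_jet0.
have a0 j : a j = 0.
  have [j3|j3] := ltnP j 3; last by case: V => + _; exact.
  apply: (@triangular_uniq R 3 (bspline_poly0 p r.+1 n)) => //.
  - by move=> k _; exact: bspline_poly0_order.
  - by move=> k k3; apply: bspline_poly0_lead => //; move: rp; lia.
  by move=> m m3; rewrite -(trace_poly_jet _ V) hA.
have hD m : (m < 2)%N -> (normal_poly d)^`(m).[0] = 0.
  have h0 : (normal_poly d)^`(0).[0] = 0.
    have := H 1%N 0%N isT isT; rewrite side_jet1 derivn0 cross_poly_jet0 hA // mulr0 add0r.
    by move=> /eqP; rewrite mulf_eq0 (negbTE al0) mulf_eq0 (negbTE k0) => /eqP.
  case: m => [//|[|//]] _.
  have := H 1%N 1%N isT isT; rewrite side_jet1 derivn1 cross_poly_jet1 !hA // h0 !mulr0 subr0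
    !add0r.
  by move=> X; apply: (mulfI k0); apply: (mulfI al0); rewrite X !mulr0.
split => // j; have [j2|j2] := ltnP j 2; last by case: V => _; exact.
apply: (@triangular_uniq R 2 (bspline_poly0 p.-1 r n)) => //.
- by move=> k _; apply: bspline_poly0_order => //; exact: ltrp1.
- by move=> k k3; apply: bspline_poly0_lead => //; [exact: ltrp1|move: rp; lia].
by move=> m m2; rewrite -(normal_poly_jet _ V) hD.
Qed.

(** Value and derivative of the polynomial identity at 0 give for the 1-jet of [X] the same two
    linear equations as those for [x0] and [x1]; their diagonal entry is [al1.[0]]. *)
Lemma glued_poly_jet (al1 al2 be T X Y : {poly R}) (x0 x1 y0 y1 t1 t2 : R) :
  al1.[0] != 0 -> al1 * X = - (al2 * Y + be * T^`()) ->
  Y.[0] = y0 -> Y^`().[0] = y1 -> T^`().[0] = t1 -> T^`()^`().[0] = t2 ->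
  al1.[0] * x0 + al2.[0] * y0 + be.[0] * t1 = 0 ->
  al1^`().[0] * x0 + al1.[0] * x1 + (al2^`().[0] * y0 + al2.[0] * y1)
    + (be^`().[0] * t1 + be.[0] * t2) = 0 ->
  X.[0] = x0 /\ X^`().[0] = x1.
Proof.
move=> al0 E Y0 Y1 T1 T2 e0 e1.
have X0 : X.[0] = x0.
  apply: (mulfI al0); have := congr1 (horner^~ 0) E.
  rewrite hornerM => ->; rewrite hornerN hornerD !hornerM Y0 T1; lra.
split => //; apply: (mulfI al0).
have := congr1 (fun q => q^`().[0]) E.
rewrite /= derivN derivD !derivM !(hornerN, hornerD, hornerM) X0 Y0 Y1 T1 T2; lra.
Qed.

(* The two sides of an edge function satisfy the gluing relation identically,
   so matching the first side forces the second one to match. *)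
Lemma side_glue al1 al2 be1 be2 a d J1 J2 : al1.[0] != 0 ->
  side_matches (side_jet (trace_poly a) (cross_poly al1 be1 a d)) J1 ->
  (forall m, (m <= 2)%N -> J1 0%N m = J2 m 0%N) ->
  gluing_jet al1 al2 (al1 * be2 + al2 * be1) J1 J2 ->
  side_matches (side_jet (trace_poly a) (cross_poly (- al2) be2 a d)) (fun m1 m2 => J2 m2 m1).
Proof.
move=> al0 H M [g0 g1] m1 m2.
have hA m : (m <= 2)%N -> (trace_poly a)^`(m).[0] = J1 0%N m.
  by move=> m3; rewrite -(H 0%N m) // side_jet0.
have h10 : (cross_poly al1 be1 a d).[0] = J1 1%N 0%N by rewrite -(H 1%N 0%N) // side_jet1.
have h11 : (cross_poly al1 be1 a d)^`().[0] = J1 1%N 1%N by rewrite -(H 1%N 1%N) // side_jet1.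
have E : al1 * cross_poly (- al2) be2 a d = - (al2 * cross_poly al1 be1 a d
    + (al1 * be2 + al2 * be1) * (trace_poly a)^`()).
  by rewrite /cross_poly; ring.
have [e0 e1] := glued_poly_jet al0 E h10 h11 (hA 1%N isT) (hA 2%N isT) g0 g1.
by case: m1 => [|[|//]] _ m12; [rewrite side_jet0 hA // M|
  rewrite side_jet1; case: m2 m12 => [|[|//]] _; rewrite ?derivn0 ?derivn1].
Qed.

(** Trace and transversal derivative on the side where the first coordinate is 0, read from the germ
    at positive [x] only: on the side itself [glue] may have chosen another patch. *)
Definition trace_at (g : plane R -> R^o) A B := forall y, 0 < y < 1 -> exists q : {poly R},
  [/\ (exists2 e, 0 < e & forall x, 0 < x < e -> g (x, y) = q.[x]),
      q.[0] = A y & q^`().[0] = B y].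

Lemma trace_at_lin (c : R) g g' A B A' B' : trace_at g A B -> trace_at g' A' B' ->
  trace_at (fun xi => c * g xi + g' xi) (fun y => c * A y + A' y) (fun y => c * B y + B' y).
Proof.
move=> H H' y y01; have [q [[e e0 E] <- <-]] := H y y01; have [q' [[e' e'0 E'] <- <-]] := H' y y01.
exists (c *: q + q'); rewrite derivD derivZ !hornerD !hornerZ; split=> //.
have [k k0 Hk] := pos_minP e0 e'0; exists k => // x /andP[x0 /Hk[xe xe']].
by rewrite hornerD hornerZ E ?x0 // E' ?x0.
Qed.

Lemma eq_trace_at g g' A B A' B' : trace_at g A B ->
  {in open_unit_square, g =1 g'} -> A =1 A' -> B =1 B' -> trace_at g' A' B'.
Proof.
move=> H gg AA BB y y01; have [q [[e e0 E] h1 h2]] := H y y01.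
exists q; rewrite -AA -BB; split => //.
have [k k0 Hk] := pos_minP e0 (@ltr01 R); exists k => // x /andP[x0 /Hk[xe x1]].
by rewrite -gg ?E ?x0 // inE; split; rewrite /= ?x0.
Qed.

Lemma trace_at0 : trace_at (fun=> 0) (fun=> 0) (fun=> 0).
Proof. by move=> y _; exists 0; rewrite deriv0 !horner0; split => //; exists 1 => // x _;
  rewrite horner0. Qed.

Lemma trace_at_sum (J : Type) (s : seq J) (P : pred J) (c : J -> R) (g : J -> plane R -> R^o) :
  (forall j, P j -> trace_at (g j) (fun=> 0) (fun=> 0)) ->
  trace_at (fun xi => \sum_(j <- s | P j) c j * g j xi) (fun=> 0) (fun=> 0).
Proof.
move=> H; elim: s => [|j s IH].
  by apply: (eq_trace_at trace_at0) => // xi _; rewrite big_nil.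
case Pj: (P j); last by apply: (eq_trace_at IH) => // xi _; rewrite big_cons Pj.
apply: (eq_trace_at (trace_at_lin (c j) (H j Pj) IH)).
- by move=> xi _; rewrite big_cons Pj.
- by move=> y; rewrite mulr0 addr0.
- by move=> y; rewrite mulr0 addr0.
Qed.

Lemma trace_at_uniq0 g A B : trace_at g A B -> {in open_unit_square, g =1 fun=> 0} ->
  forall y, 0 < y < 1 -> A y = 0 /\ B y = 0.
Proof.
move=> H g0 y y01; have [q [[e e0 E] <- <-]] := H y y01.
have [k k0 Hk] := pos_minP e0 (@ltr01 R).
suff -> : q = 0 by rewrite deriv0 horner0.
apply: (poly0_of_interval k0) => x /andP[x0 /[dup] xk /Hk[xe x1]].
by rewrite -E ?x0 // g0 // inE; split; rewrite /= ?x0.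
Qed.

Lemma trace_at_tens u v q : germ u q ->
  trace_at (tens u v) (fun y => q.[0] * v y) (fun y => q^`().[0] * v y).
Proof.
move=> [e e0 E] y _; exists (v y *: q); rewrite derivZ !hornerZ; split; rewrite 1?mulrC //.
by exists e => // x /andP[x0 xe]; rewrite hornerZ /tens /= E ?(ltW x0) // mulrC.
Qed.

Lemma trace_at_tens0 s s' u v : end_orders s s' u -> (2 <= s)%N ->
  trace_at (tens u v) (fun=> 0) (fun=> 0).
Proof.
move=> [q [_ [g _ o _]]] s2; apply: (eq_trace_at (trace_at_tens v g)) => // y.
  by have := o 0%N (ltnW s2); rewrite derivn0 => ->; rewrite mul0r.
by have := o 1%N s2; rewrite derivn1 => ->; rewrite mul0r.
Qed.

(** The list gives the order of the factor that becomes a function of the first variable after [m]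
    turns; order 2 removes value and slope. *)
Lemma trace_at_tens_corner s s' k k' u v m : end_orders s s' u -> end_orders k k' v ->
  (m < 4)%N -> (2 <= nth 0 [:: s; k; s'; k'] m)%N ->
  trace_at (fun xi => tens u v (iter m quarter_turn xi)) (fun=> 0) (fun=> 0).
Proof.
move=> ou ov; case: m => [|[|[|[|//]]]] _ /= sk.
- exact: trace_at_tens0 ou sk.
- by apply: (eq_trace_at (trace_at_tens0 (fun t => u (1 - t)) ov sk)) => // xi _; rewrite tens_turn.
- exact: (trace_at_tens0 (fun t => v (1 - t)) (end_orders_rev ou) sk).
- by apply: (eq_trace_at (trace_at_tens0 u (end_orders_rev ov) sk)) => // xi _; rewrite tens_turn3.
Qed.

Lemma trace_at_side1 A B : trace_at (side1_fun A B) A B.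
Proof.
have [h1 h2 h3 h4] := qc_values.
apply: (eq_trace_at (trace_at_lin 1 (trace_at_tens A germ_c0) (trace_at_tens B germ_c1))).
- by move=> xi _; rewrite mul1r.
- by move=> y; rewrite h1 h3 !mul1r mul0r addr0.
- by move=> y; rewrite h2 h4 !mul1r mul0r add0r.
Qed.

Lemma trace_at_side1_corner A B (a0 a1 b0 b1 m : nat) :
  end_orders a0 a1 A -> end_orders b0 b1 B -> (m < 4)%N -> m <> 0%N ->
  (2 <= a0)%N && (2 <= a1)%N && (2 <= b0)%N && (2 <= b1)%N ->
  trace_at (fun xi => side1_fun A B (iter m quarter_turn xi)) (fun=> 0) (fun=> 0).
Proof.
move=> oA oB m4 m0 o2.
have h1 : trace_at (fun xi => tens c0 A (iter m quarter_turn xi)) (fun=> 0) (fun=> 0).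
  by apply: (trace_at_tens_corner end_orders_c0 oA m4); case: m m4 m0 => [|[|[|[|//]]]] _ m0 //=;
    lia.
have h2 : trace_at (fun xi => tens c1 B (iter m quarter_turn xi)) (fun=> 0) (fun=> 0).
  by apply: (trace_at_tens_corner end_orders_c1 oB m4); case: m m4 m0 {h1} => [|[|[|[|//]]]] _ m0
    //=; lia.
by apply: (eq_trace_at (trace_at_lin 1 h1 h2)) => [xi _|y|y]; rewrite mul1r ?addr0.
Qed.

Lemma trace_at_side2_corner A B (a0 a1 b0 b1 m : nat) :
  end_orders a0 a1 A -> end_orders b0 b1 B -> (m < 4)%N -> m <> 1%N ->
  (2 <= a0)%N && (2 <= a1)%N && (2 <= b0)%N && (2 <= b1)%N ->
  trace_at (fun xi => side2_fun A B (iter m quarter_turn xi)) (fun=> 0) (fun=> 0).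
Proof.
move=> oA oB m4 m0 o2.
have h1 : trace_at (fun xi => tens A c0 (iter m quarter_turn xi)) (fun=> 0) (fun=> 0).
  by apply: (trace_at_tens_corner oA end_orders_c0 m4); case: m m4 m0 => [|[|[|[|//]]]] _ m0 //=;
    lia.
have h2 : trace_at (fun xi => tens B c1 (iter m quarter_turn xi)) (fun=> 0) (fun=> 0).
  by apply: (trace_at_tens_corner oB end_orders_c1 m4); case: m m4 m0 {h1} => [|[|[|[|//]]]] _ m0
    //=; lia.
by apply: (eq_trace_at (trace_at_lin 1 h1 h2)) => [xi _|y|y]; rewrite mul1r ?addr0.
Qed.

End SideFunctions.

(** * Edge functions as pairs of side functions with arbitrary coefficients *)

Section EdgeElements.
Context {R : realType} {I : finType}.
Variables (Omega : set (plane R)) (F : I -> plane R -> plane R).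
Variable gd : rpatch I -> rpatch I -> gluing R.
Variables (p r n : nat).

Local Notation Nm := (spline_dim p.-1 r n).
Local Notation Np := (spline_dim p r.+1 n).
Local Notation b := (@bspline R p r n).
Local Notation bplus := (@bspline R p r.+1 n).
Local Notation bminus := (@bspline R p.-1 r n).
Local Notation broken := (I -> plane R -> R^o).

Hypotheses (rp : (r.+1 < p)%N) (n0 : (0 < n)%N) (hN : (5 <= Nm)%N).
Hypothesis hdom : multipatch_domain Omega F p r n.

Implicit Types (a d : nat -> R) (e : edge_form I) (h : rpatch I) (al be : {poly R}).

Lemma on_patchD h (g g' : plane R -> R) :
  on_patch F h (fun xi => g xi + g' xi) = on_patch F h g + on_patch F h g' :> broken.
Proof.
rewrite -[on_patch F h g]scale1r -on_patch_lin; congr on_patch.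
by apply/funext => xi; rewrite mul1r.
Qed.

Definition side1_elem h al be a d : broken :=
  on_patch F h (side1_fun p r n (trace_fun p r n a) (cross_fun p r n al be a d)).
Definition side2_elem h al be a d : broken :=
  on_patch F h (side2_fun p r n (trace_fun p r n a) (cross_fun p r n al be a d)).

Lemma cross_sum_identity (M M' : nat) (x0 x1 y z k : R) (a d f f' g : nat -> R) :
  x0 * (\sum_(j < M) a j * f j) + x1 * (- y * (\sum_(j < M) a j * f' j) + z * (k * (\sum_(j < M') d
    j * g j)))
  = \sum_(j < M) a j * (f j * x0 - y * f' j * x1) + \sum_(j < M') d j * (z * g j * (k * x1)).
Proof.
have -> : \sum_(j < M) a j * (f j * x0 - y * f' j * x1)
    = x0 * (\sum_(j < M) a j * f j) - (x1 * y) * (\sum_(j < M) a j * f' j).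
  by rewrite !mulr_sumr -sumrB; apply: eq_bigr => j _; ring.
have -> : \sum_(j < M') d j * (z * g j * (k * x1)) = (x1 * z * k) * \sum_(j < M') d j * g j.
  by rewrite mulr_sumr; apply: eq_bigr => j _; ring.
ring.
Qed.

Lemma side1_elemE h al be a d : side1_elem h al be a d =
  \sum_(j < Np) a j *: on_patch F h (fun xi => bplus j xi.2 * c0 p r n xi.1
     - be.[xi.2] * deriv01 (bplus j) xi.2 * c1 p r n xi.1)
  + \sum_(j < Nm) d j *: on_patch F h (fun xi => al.[xi.2] * bminus j xi.2 * b 1 xi.1).
Proof.
rewrite -!on_patch_sum -on_patchD; congr on_patch; apply/funext => xi.
rewrite (b1E rp n0) -(cross_sum_identity _ _ (c0 p r n xi.1) (c1 p r n xi.1) be.[xi.2] al.[xi.2]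
  (kappa p n) a d (fun j => bplus j xi.2)
 (fun j => deriv01 (bplus j) xi.2) (fun j => bminus j xi.2)).
by rewrite /side1_fun /tens /cross_fun /trace_fun /dtrace_fun /normal_fun.
Qed.

Lemma side2_elemE h al be a d : side2_elem h al be a d =
  \sum_(j < Np) a j *: on_patch F h (fun xi => bplus j xi.1 * c0 p r n xi.2
     - be.[xi.1] * deriv01 (bplus j) xi.1 * c1 p r n xi.2)
  + \sum_(j < Nm) d j *: on_patch F h (fun xi => al.[xi.1] * bminus j xi.1 * b 1 xi.2).
Proof.
rewrite -!on_patch_sum -on_patchD; congr on_patch; apply/funext => xi.
rewrite (b1E rp n0) -(cross_sum_identity _ _ (c0 p r n xi.2) (c1 p r n xi.2) be.[xi.1] al.[xi.1]
  (kappa p n) a d (fun j => bplus j xi.1)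
 (fun j => deriv01 (bplus j) xi.1) (fun j => bminus j xi.1)).
by rewrite /side2_fun /tens /cross_fun /trace_fun /dtrace_fun /normal_fun ![_ * c0 _ _ _ _]mulrC
  ![_ * c1 _ _ _ _]mulrC.
Qed.

(** A boundary edge is treated as an interface with [al = 1] and [be = 0], and the sign on the
    second patch is absorbed into its [al], so that interfaces and boundary edges share their
    proofs. *)
Definition first_al e : {poly R} := if e is Interface h1 h2 then al1 (gd h1 h2) else 1.
Definition first_be e : {poly R} := if e is Interface h1 h2 then be1 (gd h1 h2) else 0.
Definition second_al e : {poly R} := if e is Interface h1 h2 then - al2 (gd h1 h2) else 1.
Definition second_be e : {poly R} := if e is Interface h1 h2 then be2 (gd h1 h2) else 0.

Definition first_part e a d : broken :=
  if first_patch e is Some h then side1_elem h (first_al e) (first_be e) a d else 0.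
Definition second_part e a d : broken :=
  if second_patch e is Some h then side2_elem h (second_al e) (second_be e) a d else 0.
Definition edge_elem e a d : broken := first_part e a d + second_part e a d.

Lemma edge_elemE e a d : edge_elem e a d =
  \sum_(j < Np) a j *: edge_fun F gd p r n e (val j, 0%N)
  + \sum_(j < Nm) d j *: edge_fun F gd p r n e (val j, 1%N).
Proof.
rewrite /edge_elem /first_part /second_part; case: e => [h1 h2|h|h] /=.
- rewrite side1_elemE side2_elemE addrACA -!big_split /=; congr (_ + _); apply: eq_bigr => j _.
    by rewrite -scalerDr.
  rewrite -scalerDr; congr (_ *: (_ + on_patch _ _ _)); apply/funext => xi.
  by rewrite hornerN !mulNr.
- rewrite addr0 side1_elemE; congr (_ + _); apply: eq_bigr => j _; congr (_ *: on_patch _ _ _);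
  apply/funext => xi.
    by rewrite horner0 !mul0r subr0.
  by rewrite hornerC mul1r.
- rewrite add0r side2_elemE; congr (_ + _); apply: eq_bigr => j _; congr (_ *: on_patch _ _ _);
  apply/funext => xi.
    by rewrite horner0 !mul0r subr0.
  by rewrite hornerC mul1r.
Qed.

Lemma edge_elem_lin e (K : finType) (s : K -> R) (a d : K -> nat -> R) :
  edge_elem e (fun j => \sum_k s k * a k j) (fun j => \sum_k s k * d k j)
  = \sum_k s k *: edge_elem e (a k) (d k).
Proof.
rewrite edge_elemE; under [RHS]eq_bigr do rewrite edge_elemE scalerDr !scaler_sumr.
rewrite big_split /=; congr (_ + _); rewrite exchange_big /=; apply: eq_bigr => j _;
  by rewrite scaler_suml; apply: eq_bigr => k _; rewrite scalerA.
Qed.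

(** With distinct patches, each half of an edge function can be read off alone on its patch. *)
Definition distinct_patches e := if e is Interface h1 h2 then h1.1 <> h2.1 else True.

Lemma pull_side1 i' k' i k al be a d xi : unit_square xi ->
  pull F (side1_elem (i', k') al be a d) (i, k) xi =
  if i == i' then side1_fun p r n (trace_fun p r n a) (cross_fun p r n al be a d) (iter (turns k'
    k) quarter_turn xi) else 0.
Proof. by move=> u; rewrite (pull_on_patch hdom). Qed.

Lemma pull_side2 i' k' i k al be a d xi : unit_square xi ->
  pull F (side2_elem (i', k') al be a d) (i, k) xi =
  if i == i' then side2_fun p r n (trace_fun p r n a) (cross_fun p r n al be a d) (iter (turns k'
    k) quarter_turn xi) else 0.
Proof. by move=> u; rewrite (pull_on_patch hdom). Qed.

Lemma pullD (U U' : broken) h xi : pull F (U + U') h xi = pull F U h xi + pull F U' h xi.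
Proof. by []. Qed.

Lemma cjet_edge_first e h a d : distinct_patches e -> first_patch e = Some h ->
  cjet (pull F (edge_elem e a d) h)
    (side_jet p r n (trace_poly p r n a) (cross_poly p r n (first_al e) (first_be e) a d)).
Proof.
move=> de fe.
apply: (eq_cjet (cjet_side1 rp n0 (germ_trace rp n0 a) (germ_cross rp n0 hN _ _ a d))) => // xi.
rewrite inE => u; rewrite /edge_elem pullD /first_part fe.
case: h fe => i k fe; rewrite pull_side1 // eqxx turnsxx /=.
rewrite -[LHS]addr0; congr (_ + _).
case: e fe de => [h1 h2|h1|h1] //= [->] /= de.
by case: h2 de => i2 k2 /= /eqP/negbTE de; rewrite /second_part /= pull_side2 // de.
Qed.

Lemma cjet_edge_second e h a d : distinct_patches e -> second_patch e = Some h ->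
  cjet (pull F (edge_elem e a d) h)
    (fun m1 m2 => side_jet p r n (trace_poly p r n a) (cross_poly p r n (second_al e) (second_be e)
      a d) m2 m1).
Proof.
move=> de fe.
apply: (eq_cjet (cjet_side2 rp n0 (germ_trace rp n0 a) (germ_cross rp n0 hN _ _ a d))) => // xi.
rewrite inE => u; rewrite /edge_elem pullD /second_part fe.
case: h fe => i k fe; rewrite pull_side2 // eqxx turnsxx /=.
rewrite -[LHS]add0r; congr (_ + _).
case: e fe de => [h1 h2|h1|h1] //= [->] /= de.
case: h1 de => i1 k1 /= /eqP de; rewrite /first_part /= pull_side1 //.
by rewrite eq_sym (negbTE de).
Qed.

Lemma edge_span e u :
  lspan [set w | exists j : nat * nat, [/\ (j.2 <= 1)%N, (j.1 + j.2 <= 2)%N & w = edge_fun F gd p r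
    n e j]] u ->
  exists a d, vertex_coefs a d /\ u = edge_elem e a d.
Proof.
move=> [m [c [w [Hw ->]]]].
have /choice[j Hj] : forall i, exists j : nat * nat, [/\ (j.2 <= 1)%N,
  (j.1 + j.2 <= 2)%N & w i = edge_fun F gd p r n e j].
  by move=> i; exact: Hw.
(* A generator may occur several times among the [w i]; the indicators collect the coefficients of
   each index pair. *)
exists (fun k => \sum_(i < m) c i * (j i == (k, 0%N))%:R), (fun k => \sum_(i < m) c i * (j i == (k,
  1%N))%:R).
split.
  split=> k k3; rewrite big1 // => i _; have [h1 h2 _] := Hj i;
  case: eqP => [E|]; rewrite ?mulr0 //; move: h2; rewrite E /= => h2; exfalso; lia.
rewrite (edge_elem_lin e c (fun i k => (j i == (k, 0%N))%:R) (fun i k => (j i == (k, 1%N))%:R)).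
apply: eq_bigr => i _; congr (_ *: _); rewrite edge_elemE.
have [h1 h2 ->] := Hj i; move: h1 h2; case: (j i) => j1 j2 /= h1 h2.
have hp := NpE rp; have N5 := hN.
case: j2 h1 h2 => [|[|//]] _ h2.
- have j1N : (j1 < Np)%N by rewrite hp; lia.
  rewrite (bigD1 (Ordinal j1N)) //= eqxx scale1r !big1 ?addr0 //.
    by move=> k _; rewrite xpair_eqE andbF scale0r.
  move=> k; rewrite -val_eqE /= => /negbTE kj; rewrite xpair_eqE eq_sym kj scale0r //.
- have j1N : (j1 < Nm)%N by lia.
  rewrite big1 ?add0r; last by move=> k _; rewrite xpair_eqE andbF scale0r.
  rewrite (bigD1 (Ordinal j1N)) //= eqxx scale1r big1 ?addr0 //.
  move=> k; rewrite -val_eqE /= => /negbTE kj; rewrite xpair_eqE eq_sym kj scale0r //.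
Qed.

Lemma edge_span_elem e a d : vertex_coefs a d ->
  lspan [set w | exists j : nat * nat, [/\ (j.2 <= 1)%N, (j.1 + j.2 <= 2)%N & w = edge_fun F gd p r
    n e j]] (edge_elem e a d).
Proof.
move=> [a0 d0]; have hp := NpE rp; have N5 := hN.
pose js := [:: (0, 0); (1, 0); (2, 0); (0, 1); (1, 1)]%N.
pose cs := [:: a 0; a 1; a 2; d 0; d 1]%N.
exists 5%N, (fun i : 'I_5 => nth 0 cs i), (fun i : 'I_5 => edge_fun F gd p r n e (nth (0,
  0)%N js i)); split.
  move=> i; exists (nth (0, 0)%N js i); split => //; case: i => [[|[|[|[|[|]]]]]] //.
rewrite edge_elemE (@sum_trunc _ _ Np 3 a (fun j => edge_fun F gd p r n e (j, 0%N))) //;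
  last by rewrite hp; lia.
rewrite (@sum_trunc _ _ Nm 2 d (fun j => edge_fun F gd p r n e (j, 1%N))) //; last by lia.
by rewrite !big_ord_recl !big_ord0 /= !addr0 -!addrA.
Qed.

End EdgeElements.

(** * Vertex functions *)

Section Projections.
Context {R : realType} {I : finType}.
Variables (Omega : set (plane R)) (F : I -> plane R -> plane R).
Variable gd : rpatch I -> rpatch I -> gluing R.
Variables (p r n : nat).

Local Notation Nm := (spline_dim p.-1 r n).
Local Notation b := (@bspline R p r n).
Local Notation broken := (I -> plane R -> R^o).
Local Notation Q := (@bspline_poly0 R p r n).

Hypotheses (rp : (r.+1 < p)%N) (n0 : (0 < n)%N) (hN : (5 <= Nm)%N).
Hypothesis hdom : multipatch_domain Omega F p r n.
Hypothesis hG1 : analysis_suitable_G1 Omega F gd.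

Implicit Types (a d : nat -> R) (e : edge_form I) (h : rpatch I) (S : nat -> nat -> R)
  (phi : plane R -> R^o) (c : nat -> nat -> R) (J : nat -> nat -> R).

Definition patch_sum c : plane R -> R^o := fun xi =>
  \sum_(j1 < 2) \sum_(j2 < 2) c j1 j2 * tens (b j1) (b j2) xi.
Definition patch_elem h c : broken := on_patch F h (patch_sum c).
Definition patch_jet c (m1 m2 : nat) : R :=
  \sum_(j1 < 2) \sum_(j2 < 2) c j1 j2 * ((Q j1)^`(m1).[0] * (Q j2)^`(m2).[0]).

Lemma patch_elemE h c :
  patch_elem h c = \sum_(j : 'I_2 * 'I_2) c j.1 j.2 *: patch_fun F p r n h (val j.1, val j.2).
Proof.
rewrite /patch_elem -on_patch_sum; congr on_patch; apply/funext => xi.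
by rewrite /patch_sum pair_big.
Qed.

Lemma cjet_patch_sum c : cjet (patch_sum c) (patch_jet c).
Proof.
have := @cjet_sum R ('I_2 * 'I_2)%type (index_enum _) xpredT (fun j => c j.1 j.2)
  (fun j xi => b j.1 xi.1 * b j.2 xi.2) (fun j m1 m2 => (Q j.1)^`(m1).[0] * (Q j.2)^`(m2).[0]).
move=> H; apply: (eq_cjet (H _)).
- by move=> j _; apply: cjet_tensor; exact: germ_bspline (ltrp rp) n0 _.
- by move=> xi _; rewrite /patch_sum pair_big.
- by move=> m1 m2 _; rewrite /patch_jet pair_big.
Qed.

Lemma cjet_patch_corner c m : (m < 4)%N -> m <> 0%N ->
  cjet (fun xi => patch_sum c (iter m quarter_turn xi)) (fun _ _ => 0).
Proof.
move=> m4 m0; have N6 := N_ge6 rp n0 hN.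
have H := @cjet_sum R ('I_2 * 'I_2)%type (index_enum _) xpredT (fun j => c j.1 j.2)
  (fun j xi => tens (b j.1) (b j.2) (iter m quarter_turn xi)) (fun _ _ _ => 0).
apply: (eq_cjet (H _)).
- move=> [j1 j2] _ /=.
  have o1 : end_orders j1 3 (b j1).
    apply: end_orders_le (end_orders_bspline (R := R) (ltrp rp) n0 _) => //; have := ltn_ord j1;
      lia.
  have o2 : end_orders j2 3 (b j2).
    apply: end_orders_le (end_orders_bspline (R := R) (ltrp rp) n0 _) => //; have := ltn_ord j2;
      lia.
  apply: (cjet_tens_corner o1 o2 m4).
  by case: m m4 m0 {H} => [|[|[|[|//]]]] _ m0 //=; lia.
- by move=> xi _; rewrite /patch_sum pair_big.
- by move=> m1 m2 _; rewrite big1 // => j _; rewrite mulr0.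
Qed.

(** [b 0] and [b 1] lie in the span of [c0] and [c1], and the 1-jet at 0 gives the coordinates in
    this Hermite pair. *)
Lemma Q_second (j : 'I_2) :
  (Q j)^`(2).[0] = (qc0 p r n)^`(2).[0] * (Q j)^`(0).[0] + (qc1 p r n)^`(2).[0] * (Q j)^`(1).[0].
Proof.
have [h1 h2 h3 h4] := bspline_poly0_first (R := R) (ltrp rp) n0 (p_gt0 rp).
have k0 := kappa_neq0 (R := R) rp n0; rewrite /kappa in k0.
have [pR nR] : p%:R != 0 :> R /\ n%:R != 0 :> R.
  by move: k0; rewrite mulf_eq0 negb_or => /andP[].
rewrite /qc0 /qc1 derivnD derivnZ hornerD hornerZ !derivn0 !derivn1.
case: j => [[|[|//]] ?] /=; rewrite ?h1 ?h2 ?h3 ?h4.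
  by move: (_^`(2).[0]) (_^`(2).[0]) => x y; field; apply/andP.
by move: (_^`(2).[0]) (_^`(2).[0]) => x y; field; apply/andP.
Qed.

Lemma patch_jet_second1 c m : patch_jet c 2 m =
  (qc0 p r n)^`(2).[0] * patch_jet c 0 m + (qc1 p r n)^`(2).[0] * patch_jet c 1 m.
Proof.
rewrite /patch_jet !mulr_sumr -big_split /=; apply: eq_bigr => j1 _.
rewrite !mulr_sumr -big_split /=; apply: eq_bigr => j2 _.
rewrite Q_second; ring.
Qed.

Lemma patch_jet_second2 c m : patch_jet c m 2 =
  (qc0 p r n)^`(2).[0] * patch_jet c m 0 + (qc1 p r n)^`(2).[0] * patch_jet c m 1.
Proof.
rewrite /patch_jet !mulr_sumr -big_split /=; apply: eq_bigr => j1 _.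
rewrite !mulr_sumr -big_split /=; apply: eq_bigr => j2 _.
rewrite (Q_second j2); ring.
Qed.

Definition patch_matches J J' :=
  forall m1 m2, (m1 <= 1)%N -> (m2 <= 1)%N -> J m1 m2 = J' m1 m2.

Lemma Q_order j : (j < 2)%N -> order_ge j (Q j).
Proof. by move=> _; apply: bspline_poly0_order; rewrite ?n0 // ltrp. Qed.

Lemma Q_lead j : (j < 2)%N -> (Q j)^`(j).[0] != 0.
Proof. by move=> j2; apply: bspline_poly0_lead (ltrp rp) n0 _ _; move: rp; lia. Qed.

(** Tensor product interpolation: the triangular system is solved first in one variable and then in
    the other. *)
Lemma patch_solve J : exists c, patch_matches (patch_jet c) J.
Proof.
have tri := @triangular_solve R 2 Q Q_order Q_lead.
have /choice[u Hu] : forall m2, exists u : nat -> R, forall m1, (m1 < 2)%N ->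
    \sum_(j < 2) u j * (Q j)^`(m1).[0] = J m1 m2.
  by move=> m2; have [u _ Hu] := tri (fun m1 => J m1 m2); exists u.
have /choice[c Hc] : forall j1 : nat, exists c : nat -> R, forall m2, (m2 < 2)%N ->
    \sum_(j < 2) c j * (Q j)^`(m2).[0] = u m2 j1.
  by move=> j1; have [c _ Hc] := tri (fun m2 => u m2 j1); exists c.
exists c => m1 m2 h1 h2; rewrite /patch_jet -(Hu m2 m1) //.
apply: eq_bigr => j1 _; rewrite -(Hc j1 m2) // mulr_suml.
by apply: eq_bigr => j2 _; rewrite mulrCA mulrC -mulrA.
Qed.

Lemma patch_uniq c : patch_matches (patch_jet c) (fun _ _ => 0) ->
  forall j1 j2, (j1 < 2)%N -> (j2 < 2)%N -> c j1 j2 = 0.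
Proof.
move=> H j1 j2 h1 h2.
have uni := @triangular_uniq R 2 Q Q_order Q_lead.
apply: (uni (c j1)) => // m2 m22.
apply: (uni (fun j1 => \sum_(j < 2) c j1 j * (Q j)^`(m2).[0])) => // m1 m12.
rewrite -[RHS](H m1 m2) // /patch_jet; apply: eq_bigr => k _.
by rewrite mulr_suml; apply: eq_bigr => l _; rewrite [in RHS]mulrCA [in RHS]mulrC -mulrA.
Qed.

Lemma patch_elem_lin h (K : finType) (s : K -> R) (c : K -> nat -> nat -> R) :
  patch_elem h (fun j1 j2 => \sum_k s k * c k j1 j2) = \sum_k s k *: patch_elem h (c k).
Proof.
rewrite patch_elemE; under [RHS]eq_bigr do rewrite patch_elemE scaler_sumr.
rewrite exchange_big; apply: eq_bigr => j _.
by rewrite scaler_suml; apply: eq_bigr => k _; rewrite scalerA.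
Qed.

Lemma patch_jet_lin (K : finType) (s : K -> R) (c : K -> nat -> nat -> R) m1 m2 :
  patch_jet (fun j1 j2 => \sum_k s k * c k j1 j2) m1 m2 = \sum_k s k * patch_jet (c k) m1 m2.
Proof.
rewrite /patch_jet; under [RHS]eq_bigr do rewrite pair_big mulr_sumr.
rewrite pair_big exchange_big; apply: eq_bigr => j _ /=.
by rewrite mulr_suml; apply: eq_bigr => k _; rewrite mulrA.
Qed.

Lemma patch_elem_eq h c c' J : patch_matches (patch_jet c) J -> patch_matches (patch_jet c') J ->
  patch_elem h c = patch_elem h c'.
Proof.
move=> H H'.
(* The difference is written as a linear combination over [bool], so that the linearity lemma for
   finite sums applies. *)
have D : patch_matches (patch_jet (fun j1 j2 => \sum_(k : bool) (if k then 1 else -1) * (if k then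
  c else c') j1 j2)) (fun _ _ => 0).
  move=> m1 m2 h1 h2; rewrite (patch_jet_lin (fun k : bool => if k then 1 else -1) (fun k => if k
    then c else c')).
  by rewrite big_bool /= H // H' // mul1r mulN1r subrr.
rewrite !patch_elemE; apply: eq_bigr => -[j1 j2] _ /=; congr (_ *: _).
have := patch_uniq D (ltn_ord j1) (ltn_ord j2).
by rewrite big_bool /= mul1r mulN1r => /eqP; rewrite subr_eq0 => /eqP.
Qed.

Lemma pull_patch_elem h c xi : unit_square xi -> pull F (patch_elem h c) h xi = patch_sum c xi.
Proof. by case: h => i k u; rewrite (pull_on_patch hdom) // eqxx turnsxx. Qed.

Lemma cjet_pull_patch_elem h c : cjet (pull F (patch_elem h c) h) (patch_jet c).
Proof.
apply: (eq_cjet (cjet_patch_sum c)) => // xi; rewrite inE => u.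
by rewrite pull_patch_elem.
Qed.

(** Solvability makes the set under [xget] nonempty; whichever element is returned lies in the span
    and has the required jet. *)
Lemma patch_projP h phi J : cjet (phi \o param F h) J ->
  exists2 c, patch_proj F p r n h phi = patch_elem h c & patch_matches (patch_jet c) J.
Proof.
move=> HJ; rewrite /patch_proj; set T := [set u | _].
have [c Hc] := patch_solve J.
have ne : exists u, T u.
  exists (patch_elem h c); split.
    rewrite patch_elemE.
    apply: lspan_sum => -[j1 j2]; exists (val j1, val j2).
    by split; rewrite //= -ltnS; exact: ltn_ord.
  move=> m1 m2 h1 h2; rewrite /same_corner_derivs (cjet_dmix (cjet_pull_patch_elem h c))
    ?(cjet_dmix HJ) ?Hc //; lia.
have [[m [c' [w [Hw E]]]] Hu] := xgetPex 0 ne.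
have /choice[j Hj] : forall i, exists j : nat * nat, [/\ (j.1 <= 1)%N,
  (j.2 <= 1)%N & w i = patch_fun F p r n h j].
  by move=> i; exact: Hw.
have E' : xget 0 T = patch_elem h (fun j1 j2 => \sum_(i < m) c' i * (j i == (j1, j2))%:R).
  rewrite E (patch_elem_lin h c' (fun i j1 j2 => (j i == (j1, j2))%:R)).
  apply: eq_bigr => i _; congr (_ *: _); rewrite patch_elemE.
  have [h1 h2 ->] := Hj i; move: h1 h2; case: (j i) => j1 j2 /= h1 h2.
  rewrite -ltnS in h1; rewrite -ltnS in h2.
  rewrite (bigD1 (Ordinal h1, Ordinal h2)) //= eqxx scale1r big1 ?addr0 //.
  move=> [k1 k2]; rewrite !xpair_eqE -!val_eqE /= => /negbTE kj.
  by rewrite [j1 == _]eq_sym [j2 == _]eq_sym kj scale0r.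
eexists; first exact: E'.
move=> m1 m2 h1 h2; have := Hu m1 m2 h1 h2.
rewrite /same_corner_derivs E' (cjet_dmix (cjet_pull_patch_elem h _)) ?(cjet_dmix HJ) //; lia.
Qed.

Variables (Pj Qj : rpatch I -> nat -> nat -> R).
Hypothesis HPQ : forall h, [/\
  cjet (fun xi => (param F h xi).1 : R^o) (Pj h),
  cjet (fun xi => (param F h xi).2 : R^o) (Qj h) &
  Pj h 1%N 0%N * Qj h 0%N 1%N - Pj h 0%N 1%N * Qj h 1%N 0%N != 0].

Definition pulled_jet S h := chain S (Pj h) (Qj h).

Lemma interface_jets h1 h2 S : standard_interface Omega F h1 h2 ->
  [/\ (al1 (gd h1 h2)).[0] != 0, (al2 (gd h1 h2)).[0] != 0,
      (forall m, (m <= 2)%N -> pulled_jet S h1 0%N m = pulled_jet S h2 m 0%N) &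
      gluing_jet (al1 (gd h1 h2)) (al2 (gd h1 h2)) (gluing_beta (gd h1 h2))
        (pulled_jet S h1) (pulled_jet S h2)].
Proof.
move=> st; have [_ _ pos G1 _] := hG1 st.
have := pos 0; rewrite lexx ler01 => /(_ isT) pos0.
have [P1 Q1 _] := HPQ h1; have [P2 Q2 _] := HPQ h2.
have [_ _ E] := st.
have MP m : (m <= 2)%N -> Pj h1 0%N m = Pj h2 m 0%N.
  by apply: (cjet_edge_match P1 P2) => t t01; rewrite E.
have MQ m : (m <= 2)%N -> Qj h1 0%N m = Qj h2 m 0%N.
  by apply: (cjet_edge_match Q1 Q2) => t t01; rewrite E.
have [gP gQ] := gluing_jet_plane P1 Q1 P2 Q2 G1.
split.
- by apply: contraTneq pos0 => ->; rewrite mul0r ltxx.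
- by apply: contraTneq pos0 => ->; rewrite mulr0 ltxx.
- have /= p1 := MP 1%N isT; have /= p2 := MP 2%N isT.
  have /= q1 := MQ 1%N isT; have /= q2 := MQ 2%N isT.
  by case=> [|[|[|//]]] _; rewrite /pulled_jet /= ?p1 ?p2 ?q1 ?q2.
- exact: gluing_jet_chain.
Qed.

Definition edge_std e := if e is Interface h1 h2 then standard_interface Omega F h1 h2 else True.

Lemma edge_std_distinct e : edge_std e -> distinct_patches e.
Proof. by case: e => //= h1 h2 []. Qed.

Lemma first_al_neq0 e : edge_std e -> (first_al gd e).[0] != 0.
Proof.
case: e => [h1 h2|h|h] /=; rewrite ?hornerC ?oner_eq0 //.
by move=> /(interface_jets (fun _ _ => 0))[].
Qed.

Lemma second_al_neq0 e : edge_std e -> (second_al gd e).[0] != 0.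
Proof.
case: e => [h1 h2|h|h] /=; rewrite ?hornerC ?oner_eq0 //.
by move=> /(interface_jets (fun _ _ => 0))[]; rewrite hornerN oppr_eq0.
Qed.

Definition first_jet e a d :=
  side_jet p r n (trace_poly p r n a) (cross_poly p r n (first_al gd e) (first_be gd e) a d).
Definition second_jet e a d :=
  side_jet p r n (trace_poly p r n a) (cross_poly p r n (second_al gd e) (second_be gd e) a d).

Definition edge_matches e a d (T : rpatch I -> nat -> nat -> R) :=
  [/\ vertex_coefs a d,
      (forall h, first_patch e = Some h -> side_matches (first_jet e a d) (T h)) &
      (forall h, second_patch e = Some h -> side_matches (second_jet e a d) (fun m1 m2 => T h m2
        m1))].

Lemma edge_solve e S : edge_std e -> exists a d, edge_matches e a d (pulled_jet S).
Proof.
case: e => [h1 h2|h|h] /= st.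
- have [al0 _ M G] := interface_jets S st.
  have [a [d [V H]]] := side_solve rp n0 hN (be1 (gd h1 h2)) (pulled_jet S h1) al0.
  exists a, d; split => //= _ [<-] //.
  (* The coefficients were found on the first patch alone; the conditions on the second patch follow
     from the gluing relation. *)
  exact: (side_glue rp n0 al0 H M G).
- have al0 : (1 : {poly R}).[0] != 0 by rewrite hornerC oner_eq0.
  have [a [d [V H]]] := side_solve rp n0 hN 0 (pulled_jet S h) al0.
  by exists a, d; split => //= _ [<-].
- have al0 : (1 : {poly R}).[0] != 0 by rewrite hornerC oner_eq0.
  have [a [d [V H]]] := side_solve rp n0 hN 0 (fun m1 m2 => pulled_jet S h m2 m1) al0.
  by exists a, d; split => //= _ [<-].
Qed.

Lemma edge_projP e phi S : edge_std e ->
  (forall h, first_patch e = Some h \/ second_patch e = Some h ->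
     cjet (phi \o param F h) (pulled_jet S h)) ->
  exists a d, edge_proj F gd p r n e phi = edge_elem F gd p r n e a d /\
    edge_matches e a d (pulled_jet S).
Proof.
move=> st HJ; have de := edge_std_distinct st.
have [a [d [V H1 H2]]] := edge_solve S st.
rewrite /edge_proj; set T := [set u | _].
have ne : exists u, T u.
  exists (edge_elem F gd p r n e a d); split.
  - exact: edge_span_elem.
  - move=> h m1 m2 fe m12 m1l; rewrite /same_corner_derivs.
    rewrite (cjet_dmix (cjet_edge_first gd rp n0 hN hdom a d de fe) m12).
    by rewrite (cjet_dmix (HJ h (or_introl fe)) m12); exact: H1.
  - move=> h m1 m2 fe m12 m1l; rewrite /same_corner_derivs.
    rewrite (cjet_dmix (cjet_edge_second gd rp n0 hN hdom a d de fe) m12).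
    by rewrite (cjet_dmix (HJ h (or_intror fe)) m12); apply: (H2 h fe); rewrite // addnC.
have [span h1 h2] := xgetPex 0 ne.
have [a' [d' [V' E]]] := edge_span rp n0 hN span.
exists a', d'; split; first exact: E.
split => // h fe m1 m2 m1l m12.
- have := h1 h m1 m2 fe m12 m1l; rewrite /same_corner_derivs E.
  rewrite (cjet_dmix (cjet_edge_first gd rp n0 hN hdom a' d' de fe) m12).
  by rewrite (cjet_dmix (HJ h (or_introl fe)) m12).
- have m21 : (m2 + m1 <= 2)%N by rewrite addnC.
  have := h2 h m2 m1 fe m21 m1l; rewrite /same_corner_derivs E.
  rewrite (cjet_dmix (cjet_edge_second gd rp n0 hN hdom a' d' de fe) m21).
  by rewrite (cjet_dmix (HJ h (or_intror fe)) m21).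
Qed.

Lemma side_jet_lin (al be : {poly R}) (K : finType) (s : K -> R) (a d : K -> nat -> R) m1 m2 :
  side_jet p r n (trace_poly p r n (fun j => \sum_k s k * a k j))
    (cross_poly p r n al be (fun j => \sum_k s k * a k j) (fun j => \sum_k s k * d k j)) m1 m2
  = \sum_k s k * side_jet p r n (trace_poly p r n (a k)) (cross_poly p r n al be (a k) (d k)) m1 m2.
Proof.
have tE : trace_poly p r n (fun j => \sum_k s k * a k j) = \sum_k s k *: trace_poly p r n (a k).
  rewrite /trace_poly; under [RHS]eq_bigr do rewrite scaler_sumr.
  rewrite exchange_big; apply: eq_bigr => j _; rewrite scaler_suml.
  by apply: eq_bigr => k _; rewrite scalerA.
have nE : normal_poly p r n (fun j => \sum_k s k * d k j) = \sum_k s k *: normal_poly p r n (d k).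
  rewrite /normal_poly; under [RHS]eq_bigr do rewrite scaler_sumr.
  rewrite exchange_big; apply: eq_bigr => j _; rewrite scaler_suml.
  by apply: eq_bigr => k _; rewrite scalerA.
have cE : cross_poly p r n al be (fun j => \sum_k s k * a k j) (fun j => \sum_k s k * d k j)
    = \sum_k s k *: cross_poly p r n al be (a k) (d k).
  rewrite /cross_poly tE nE linear_sum !mulr_sumr scaler_sumr mulr_sumr -big_split /=.
  apply: eq_bigr => k _; rewrite linearZ /= scalerDr -!scalerAr; congr (_ + _ ).
  by rewrite !scalerA mulrC.
have horner_lin (q : K -> {poly R}) m : (\sum_k s k *: q k)^`(m).[0] = \sum_k s k * (q k)^`(m).[0].
  by rewrite linear_sum horner_sum; apply: eq_bigr => k _; rewrite linearZ hornerZ.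
rewrite /side_jet tE cE !horner_lin !mulr_sumr -big_split /=.
by apply: eq_bigr => k _; rewrite mulrDr; congr (_ + _); rewrite mulrCA.
Qed.

Lemma edge_elem_eq e a d a' d' (T : rpatch I -> nat -> nat -> R) : edge_std e ->
  edge_matches e a d T -> edge_matches e a' d' T ->
  edge_elem F gd p r n e a d = edge_elem F gd p r n e a' d'.
Proof.
move=> st [[Va Vd] H1 H2] [[Va' Vd'] H1' H2'].
pose s (k : bool) : R := if k then 1 else -1.
pose A (k : bool) := if k then a else a'; pose D (k : bool) := if k then d else d'.
have V : vertex_coefs (fun j => \sum_k s k * A k j) (fun j => \sum_k s k * D k j).
  by split=> j j3; rewrite big_bool /= ?Va ?Va' ?Vd ?Vd' // !mulr0 addr0.
have key al be J : al.[0] != 0 ->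
    side_matches (side_jet p r n (trace_poly p r n a) (cross_poly p r n al be a d)) J ->
    side_matches (side_jet p r n (trace_poly p r n a') (cross_poly p r n al be a' d')) J ->
    a = a' /\ d = d'.
  move=> al0 M M'.
  have [|Z1 Z2] := side_uniq rp n0 hN al0 V (be := be).
    move=> m1 m2 h1 h2; rewrite side_jet_lin big_bool /= M // M' // mul1r mulN1r subrr //.
  split; apply/funext => j; apply/eqP; rewrite -subr_eq0; apply/eqP.
    by rewrite -[RHS](Z1 j) big_bool /= mul1r mulN1r.
  by rewrite -[RHS](Z2 j) big_bool /= mul1r mulN1r.
(* One patch is enough to fix all coefficients, and every edge form has at least one. *)
have [h [fe|se]] : exists h, first_patch e = Some h \/ second_patch e = Some h.
  by case: (e) => [h1 h2|h|h] /=; [exists h1; left|exists h; left|exists h; right].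
- by have [-> ->] := key _ _ _ (first_al_neq0 st) (H1 h fe) (H1' h fe).
- by have [-> ->] := key _ _ _ (second_al_neq0 st) (H2 h se) (H2' h se).
Qed.

End Projections.

(** * Linearity and corner jets of the vertex projection *)

Section VertexSpace.
Context {R : realType} {I : finType}.
Variables (Omega : set (plane R)) (F : I -> plane R -> plane R).
Variable gd : rpatch I -> rpatch I -> gluing R.
Variables (p r n : nat).

Local Notation Nm := (spline_dim p.-1 r n).
Local Notation broken := (I -> plane R -> R^o).

Hypotheses (rp : (r.+1 < p)%N) (n0 : (0 < n)%N) (hN : (5 <= Nm)%N).
Hypothesis hdom : multipatch_domain Omega F p r n.
Hypothesis hG1 : analysis_suitable_G1 Omega F gd.
Variables (Pj Qj : rpatch I -> nat -> nat -> R).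
Hypothesis HPQ : forall h, [/\
  cjet (fun xi => (param F h xi).1 : R^o) (Pj h),
  cjet (fun xi => (param F h xi).2 : R^o) (Qj h) &
  Pj h 1%N 0%N * Qj h 0%N 1%N - Pj h 0%N 1%N * Qj h 1%N 0%N != 0].

Local Notation pulled_jet := (pulled_jet Pj Qj).
Implicit Types (a d : nat -> R) (e : edge_form I) (h : rpatch I) (S : nat -> nat -> R)
  (phi psi : plane R -> R^o) (J : nat -> nat -> R).

Lemma chain_ext S S' P Q m1 m2 :
  (forall m1 m2, (m1 + m2 <= 2)%N -> S m1 m2 = S' m1 m2) ->
  chain S P Q m1 m2 = chain S' P Q m1 m2.
Proof.
move=> E.
by case: m1 m2 => [|[|[|m1]]] [|[|[|m2]]] //=; rewrite ?(E 0%N 0%N) ?(E 1%N 0%N) ?(E 0%N 1%N) ?(E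
  2%N 0%N) ?(E 1%N 1%N) ?(E 0%N 2%N).
Qed.

Lemma chain_lin (c : R) S S' P Q m1 m2 :
  chain (fun m1 m2 => c * S m1 m2 + S' m1 m2) P Q m1 m2
  = c * chain S P Q m1 m2 + chain S' P Q m1 m2.
Proof. case: m1 m2 => [|[|[|m1]]] [|[|[|m2]]] //=; ring. Qed.

Lemma chain_sum (K : Type) (s : seq K) (c : K -> R) (T : K -> nat -> nat -> R) P Q m1 m2 :
  chain (fun m1 m2 => \sum_(k <- s) c k * T k m1 m2) P Q m1 m2
  = \sum_(k <- s) c k * chain (T k) P Q m1 m2.
Proof.
elim: s => [|k s IH].
  rewrite big_nil (@chain_ext _ (fun _ _ => 0)) => [|? ? _]; last by rewrite big_nil.
  by case: m1 m2 => [|[|[|m1]]] [|[|[|m2]]] //=; rewrite !mulr0 ?addr0.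
rewrite big_cons -IH -chain_lin; apply: chain_ext => ? ? _.
by rewrite big_cons.
Qed.

Lemma corner_jets h : corner F h = (Pj h 0%N 0%N, Qj h 0%N 0%N).
Proof.
have [HP HQ _] := HPQ h.
have := cjet_dmix HP (isT : (0 + 0 <= 2)%N); have := cjet_dmix HQ (isT : (0 + 0 <= 2)%N).
by rewrite /dmix /= /corner => <- <-; exact: surjective_pairing.
Qed.

Lemma closed_patch_param h xi : unit_square xi -> closed_patch F h.1 (param F h xi).
Proof. by move=> u; exists (iter h.2 quarter_turn xi) => //; exact: unit_square_turn. Qed.

Lemma cjet_smooth_param phi psi h x : smooth psi -> corner F h = x ->
  (forall y, closed_patch F h.1 y -> phi y = psi y) ->
  cjet (phi \o param F h) (pulled_jet (fun m1 m2 => iterated_partial psi m1 m2 x) h).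
Proof.
move=> sm cx E; have [HP HQ _] := HPQ h.
apply: (eq_cjet (cjet_comp (smooth_C2plane sm) erefl HP HQ)).
  move=> xi; rewrite inE => u /=.
  rewrite E; last exact: closed_patch_param.
  by rewrite [in RHS](surjective_pairing (param F h xi)).
by move=> m1 m2 _; rewrite -corner_jets cx.
Qed.

Lemma C2_at_jet phi x h0 : C2_at F x phi -> corner F h0 = x ->
  exists S, forall h, corner F h = x -> cjet (phi \o param F h) (pulled_jet S h).
Proof.
move=> [psi [sm E M]] c0.
have cl h : corner F h = x -> closed_patch F h.1 x.
  by move=> <-; apply: closed_patch_param; split; rewrite /= lexx ler01.
(* The jet of one extension serves all patches at [x], because the derivatives up to order 2 match
   there. *)
exists (fun m1 m2 => iterated_partial (psi h0.1) m1 m2 x) => h cx.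
have H := cjet_smooth_param (sm h.1) cx (E h.1).
apply: (eq_cjet H) => [xi _|m1 m2 _]; first exact: erefl.
apply: chain_ext => k1 k2 k.
apply: (M _ _ _ (cl _ cx) (cl _ c0)).
by rewrite size_cat !size_nseq.
Qed.

Lemma cjet_quad_param T x h : corner F h = x ->
  cjet (quad x T \o param F h) (pulled_jet T h).
Proof.
move=> cx.
have H := cjet_smooth_param (smooth_quad x T) cx (fun _ _ => erefl).
apply: (eq_cjet H) => [xi _|m1 m2 _]; first exact: erefl.
apply: chain_ext => k1 k2 k.
exact: iterated_partial_quad.
Qed.

Variables (x : plane R) (v : vertex_form I).
Hypothesis hv : standard_vertex Omega F x v.

Local Notation nu := (valence v).
Local Notation hh := (vpatch v).

Hypothesis nu0 : (0 < nu)%N.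

Lemma vpatch_corner l : (l < nu)%N -> corner F (hh l) = x.
Proof. by have [_ _ H _] := hv; exact: H. Qed.

(** The edges in which patch [l] is the first patch, here, and the second patch, in [edge_before].
    At a boundary vertex the outermost ones are boundary edges. *)
Definition edge_after l : edge_form I :=
  if interior_vertex v then Interface (hh l) (hh (l.+1 %% nu)%N)
  else if (l.+1 < nu)%N then Interface (hh l) (hh l.+1) else Boundary1 (hh l).

Definition edge_before l : edge_form I :=
  if interior_vertex v then Interface (hh ((l + nu.-1) %% nu)%N) (hh l)
  else if l == 0%N then Boundary2 (hh 0%N) else Interface (hh l.-1) (hh l).

Definition around_vertex e := edge_std Omega F e /\
  forall h, first_patch e = Some h \/ second_patch e = Some h -> exists2 l, (l < nu)%N & h = hh l.

Lemma edge_after_around l : (l < nu)%N -> around_vertex (edge_after l).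
Proof.
move=> ln; have [_ _ _ st] := hv; rewrite /edge_after.
case: (interior_vertex v) st => [[_ st]|[_ st _ _]].
  split => [|h /= [[<-]|[<-]]]; first exact: st.
    by exists l.
  by exists (l.+1 %% nu)%N => //; rewrite ltn_mod.
case: ltnP => l1.
  split => [|h /= [[<-]|[<-]]]; first exact: st.
    by exists l.
  by exists l.+1.
by split => // h /= [[<-]|//]; exists l.
Qed.

Lemma edge_before_around l : (l < nu)%N -> around_vertex (edge_before l).
Proof.
move=> ln; have [_ _ _ st] := hv; rewrite /edge_before.
case: (interior_vertex v) st => [[_ st]|[_ st _ _]].
  have ll : ((l + nu.-1) %% nu < nu)%N by rewrite ltn_mod.
  split => [|h /= [[<-]|[<-]]].
  - have := st _ ll; suff -> : (((l + nu.-1) %% nu).+1 %% nu = l)%N by [].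
    by rewrite -addn1 modnDml -addnA addn1 prednK // modnDr modn_small.
  - by exists ((l + nu.-1) %% nu)%N.
  - by exists l.
case: eqP => [_|/eqP l0].
  by split => // h /= [//|[<-]]; exists 0%N.
rewrite -lt0n in l0; split => [|h /= [[<-]|[<-]]].
- by have := st l.-1; rewrite prednK //; apply.
- by exists l.-1 => //; exact: leq_ltn_trans (leq_pred _) ln.
- by exists l.
Qed.

Lemma edge_after_first l : (l < nu)%N -> first_patch (edge_after l) = Some (hh l).
Proof. by move=> ln; rewrite /edge_after; case: ifP => // _; case: ifP. Qed.

Lemma edge_before_second l : (l < nu)%N -> second_patch (edge_before l) = Some (hh l).
Proof. by move=> ln; rewrite /edge_before; case: ifP => // _; case: eqP => // ->. Qed.

(** Regroups the sum over edges by patches: [f] is the contribution on the first patch of an edge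
    and [g] that on the second, and boundary edges lack one of them. *)
Lemma sum_vertex_edges (V : zmodType) (f g : edge_form I -> V) :
  (forall h, f (Boundary2 h) = 0) -> (forall h, g (Boundary1 h) = 0) ->
  \sum_(e <- vertex_edges v) (f e + g e)
  = \sum_(l < nu) (f (edge_after l) + g (edge_before l)).
Proof.
move=> f2 g1; rewrite !big_split /=.
rewrite /vertex_edges /edge_after /edge_before; case: (interior_vertex v).
  rewrite !big_map -(big_mkord xpredT (fun l => f (Interface (hh l) (hh (l.+1 %% nu)%N)))) /=.
  rewrite /index_iota subn0; congr (_ + _).
  rewrite -{1}(subn0 nu) -/(index_iota 0 nu) big_mkord.
  (* Around an interior vertex the regrouping is a cyclic shift of the patches. *)
  pose s (l : 'I_nu) : 'I_nu := Ordinal (ltn_pmod l.+1 nu0).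
  have s_inj : injective s.
    move=> [i hi] [j hj] /(congr1 val) /= E; apply: val_inj => /=.
    by move: E; rewrite -(addn1 i) -(addn1 j) => /eqP; rewrite eqn_modDr (modn_small hi)
      (modn_small hj) => /eqP.
  rewrite [RHS](reindex_inj s_inj) /=; apply: eq_bigr => l _.
  congr (g (Interface (hh _) _)).
  by rewrite modnDml addSn -addnS prednK // modnDr modn_small.
rewrite !big_cons f2 add0r -!cats1 !big_cat /= !big_seq1 g1 addr0 !big_map.
rewrite -[X in iota 0 X]subn0 -/(index_iota 0 nu.-1) !big_mkord.
rewrite -[in RHS](prednK nu0) big_ord_recr big_ord_recl /= ltnn; congr (_ + _).
by congr (_ + _); apply: eq_bigr => l _; rewrite ltnS ltn_ord.
Qed.

Lemma vertex_edges_around i : (i < size (vertex_edges v))%N ->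
  around_vertex (nth (Boundary2 (hh 0%N)) (vertex_edges v) i).
Proof.
have [_ _ _ st] := hv; rewrite /vertex_edges.
have A := edge_after_around; have B := edge_before_around.
rewrite /edge_after in A; rewrite /edge_before in B.
case: (interior_vertex v) A B => A B.
  by rewrite size_map size_iota => iv; rewrite (nth_map 0%N) ?size_iota // nth_iota // add0n;
    exact: A.
rewrite /= size_rcons size_map size_iota.
case: i => [_|i] /=; first exact: (B 0%N nu0).
rewrite ltnS nth_rcons size_map size_iota ltnS leq_eqVlt => /orP[/eqP ->|il].
  rewrite ltnn eqxx; have := A nu.-1; rewrite prednK // ltnn; apply.
  exact: leqnn.
rewrite il (nth_map 0%N) ?size_iota // nth_iota // add0n.
have i1 : (i.+1 < nu)%N by rewrite -(prednK nu0) ltnS.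
by have := A i (ltnW i1); rewrite i1.
Qed.

Lemma eq_sum_vertex_edges (V : zmodType) (f g : edge_form I -> V) :
  (forall e, around_vertex e -> f e = g e) ->
  \sum_(e <- vertex_edges v) f e = \sum_(e <- vertex_edges v) g e.
Proof.
move=> H; rewrite !(big_nth (Boundary2 (hh 0%N))) !big_mkord; apply: eq_bigr => i _.
by apply: H; exact: vertex_edges_around.
Qed.

Definition vertex_jet phi S := forall h, corner F h = x -> cjet (phi \o param F h) (pulled_jet S h).

Lemma around_projP e phi S : around_vertex e -> vertex_jet phi S ->
  exists a d, edge_proj F gd p r n e phi = edge_elem F gd p r n e a d /\
    edge_matches gd p r n e a d (pulled_jet S).
Proof.
move=> [st ar] HJ; apply: (edge_projP rp n0 hN hdom hG1 HPQ st) => h /ar[l ln ->].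
exact/HJ/vpatch_corner.
Qed.

Section Linearity.
Variables (K : finType) (c : K -> R) (T : K -> nat -> nat -> R) (f : K -> plane R -> R^o).
Variables (phi : plane R -> R^o) (S : nat -> nat -> R).
Hypothesis phiS : vertex_jet phi S.
Hypothesis fT : forall k, vertex_jet (f k) (T k).
Hypothesis ST : forall m1 m2, (m1 + m2 <= 2)%N -> S m1 m2 = \sum_k c k * T k m1 m2.

Lemma pulled_sum h m1 m2 : pulled_jet S h m1 m2 = \sum_k c k * pulled_jet (T k) h m1 m2.
Proof. by rewrite /pulled_jet (chain_ext _ _ _ _ ST) chain_sum. Qed.

(** Both sides are edge elements matching the same jets, so uniqueness identifies them. The
    hypotheses compare 2-jets only; the projection therefore depends on nothing else of [phi]. *)
Lemma edge_proj_lin e : around_vertex e ->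
  edge_proj F gd p r n e phi = \sum_k c k *: edge_proj F gd p r n e (f k).
Proof.
move=> ar.
have [a [d [-> M]]] := around_projP ar phiS.
have /choice[ad Had] : forall k, exists ad : (nat -> R) * (nat -> R),
    edge_proj F gd p r n e (f k) = edge_elem F gd p r n e ad.1 ad.2 /\
    edge_matches gd p r n e ad.1 ad.2 (pulled_jet (T k)).
  by move=> k; have [a' [d' H]] := around_projP ar (fT k); exists (a', d').
under eq_bigr => k _ do rewrite (Had k).1.
rewrite -edge_elem_lin //.
apply: (edge_elem_eq rp n0 hN hG1 HPQ ar.1 M).
split.
- split=> j j3; rewrite big1 // => k _; have [_ [[a0 d0] _ _]] := Had k.
    by rewrite a0 ?mulr0.
  by rewrite d0 ?mulr0.
- move=> h fe m1 m2 h1 h2; rewrite /first_jet side_jet_lin pulled_sum.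
  by apply: eq_bigr => k _; congr (_ * _); have [_ [_ H _]] := Had k; exact: H.
- move=> h fe m1 m2 h1 h2; rewrite /second_jet side_jet_lin pulled_sum.
  by apply: eq_bigr => k _; congr (_ * _); have [_ [_ _ H]] := Had k; exact: (H h fe m1 m2).
Qed.

Lemma patch_proj_lin l : (l < nu)%N ->
  patch_proj F p r n (hh l) phi = \sum_k c k *: patch_proj F p r n (hh l) (f k).
Proof.
move=> ln; have cx := vpatch_corner ln.
have [q -> M] := patch_projP rp n0 hN hdom (phiS cx).
have /choice[q' Hq] : forall k, exists q',
    patch_proj F p r n (hh l) (f k) = patch_elem F p r n (hh l) q' /\
    patch_matches (patch_jet p r n q') (pulled_jet (T k) (hh l)).
  by move=> k; have [q' E H] := patch_projP rp n0 hN hdom (fT k cx); exists q'.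
under eq_bigr => k _ do rewrite (Hq k).1.
rewrite -patch_elem_lin.
apply: (patch_elem_eq F rp n0 hN (hh l) M) => m1 m2 h1 h2.
rewrite patch_jet_lin pulled_sum; apply: eq_bigr => k _; congr (_ * _).
by have [_ H] := Hq k; exact: H.
Qed.

Lemma vertex_proj_lin :
  vertex_proj F gd p r n v phi = \sum_k c k *: vertex_proj F gd p r n v (f k).
Proof.
rewrite /vertex_proj; under [RHS]eq_bigr do rewrite scalerBr !scaler_sumr.
rewrite sumrB; congr (_ - _).
  rewrite exchange_big /=; apply: eq_sum_vertex_edges => e; exact: edge_proj_lin.
by rewrite exchange_big /=; apply: eq_bigr => l _; exact: patch_proj_lin.
Qed.

End Linearity.

(** Indices [j <= 2] of the trace and [j <= 1] of the normal part leave orders 3 and 2 at the other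
    end of the edge, thanks to [hN]. *)
Lemma vertex_end_orders (al be : {poly R}) a d : vertex_coefs a d ->
  end_orders 0 3 (trace_fun p r n a) /\ end_orders 0 2 (cross_fun p r n al be a d).
Proof.
move=> [a0 d0].
have sa j : a j != 0 -> (3 <= Nm - j)%N.
  by have [/a0 ->|j3 _] := leqP 3 j; [rewrite eqxx|move: hN; lia].
have sd j : d j != 0 -> (2 <= Nm.-1 - j)%N.
  by have [/d0 ->|j3 _] := leqP 2 j; [rewrite eqxx|move: hN; lia].
split; first by apply: end_orders_trace => // j /sa.
apply: end_orders_cross => // [j /sa -> //|]; first by rewrite orbT.
by apply: end_orders_normal => // j /sd.
Qed.

Lemma on_patch_combination h (g1 g2 g3 : plane R -> R) :
  on_patch F h (fun xi => g1 xi + (g2 xi + -1 * g3 xi))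
  = on_patch F h g1 + on_patch F h g2 - on_patch F h g3 :> broken.
Proof.
rewrite (on_patchD F h g1 (fun xi => g2 xi + -1 * g3 xi)) (on_patchD F h g2) -addrA.
congr (_ + (_ + _)).
have := on_patch_lin F h (-1) g3 (fun=> 0); rewrite on_patch0 addr0 scaleN1r => <-.
by congr on_patch; apply/funext => xi; rewrite addr0.
Qed.

(** On one patch only its two edges at the vertex and the patch itself contribute. The jet at the
    own corner comes from inclusion and exclusion, the jets at the other three from orders of
    vanishing. *)
Lemma vertex_proj_struct phi S : vertex_jet phi S -> exists G : nat -> plane R -> R^o,
  [/\ vertex_proj F gd p r n v phi = \sum_(l < nu) on_patch F (hh l) (G l),
      (forall l, (l < nu)%N -> cjet (G l) (pulled_jet S (hh l))) &
      (forall l m, (l < nu)%N -> (m < 4)%N -> m <> 0%N ->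
         cjet (fun xi => G l (iter m quarter_turn xi)) (fun _ _ => 0))].
Proof.
move=> HJ.
have /choice[ad Had] : forall e, exists ad : (nat -> R) * (nat -> R), around_vertex e ->
    edge_proj F gd p r n e phi = edge_elem F gd p r n e ad.1 ad.2 /\
    edge_matches gd p r n e ad.1 ad.2 (pulled_jet S).
  move=> e; have [ar|nar] := pselect (around_vertex e); last by exists (fun=> 0, fun=> 0).
  by have [a [d H]] := around_projP ar HJ; exists (a, d).
have /choice[q Hq] : forall l, exists q, (l < nu)%N ->
    patch_proj F p r n (hh l) phi = patch_elem F p r n (hh l) q /\
    patch_matches (patch_jet p r n q) (pulled_jet S (hh l)).
  move=> l; have [ln|_] := boolP (l < nu)%N; last by exists (fun _ _ => 0).
  by have [q E H] := patch_projP rp n0 hN hdom (HJ _ (vpatch_corner ln)); exists q.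
pose fa e := trace_fun p r n (ad e).1.
pose f1 e := cross_fun p r n (first_al gd e) (first_be gd e) (ad e).1 (ad e).2.
pose f2 e := cross_fun p r n (second_al gd e) (second_be gd e) (ad e).1 (ad e).2.
exists (fun l xi => side1_fun p r n (fa (edge_after l)) (f1 (edge_after l)) xi
  + (side2_fun p r n (fa (edge_before l)) (f2 (edge_before l)) xi + -1 * patch_sum p r n (q l) xi)).
have after l (ln : (l < nu)%N) := (Had _ (edge_after_around ln)).2.
have before l (ln : (l < nu)%N) := (Had _ (edge_before_around ln)).2.
split.
- rewrite /vertex_proj (eq_sum_vertex_edges (g := fun e =>
    first_part F gd p r n e (ad e).1 (ad e).2 + second_part F gd p r n e (ad e).1 (ad e).2));
      last first.
    by move=> e /Had[-> _].
  rewrite sum_vertex_edges // -sumrB; apply: eq_bigr => l _.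
  rewrite (Hq l (ltn_ord l)).1 /first_part /second_part edge_after_first // edge_before_second //.
  by rewrite on_patch_combination.
- move=> l ln.
  have [_ M1 _] := after l ln; have [_ _ M2] := before l ln; have M3 := (Hq l ln).2.
  have {}M1 := M1 _ (edge_after_first ln); have {}M2 := M2 _ (edge_before_second ln).
  have j1 := cjet_side1 rp n0 (germ_trace rp n0 (ad (edge_after l)).1)
    (germ_cross rp n0 hN (first_al gd (edge_after l)) (first_be gd (edge_after l)) (ad (edge_after
      l)).1 (ad (edge_after l)).2).
  have j2 := cjet_side2 rp n0 (germ_trace rp n0 (ad (edge_before l)).1)
    (germ_cross rp n0 hN (second_al gd (edge_before l)) (second_be gd (edge_before l)) (ad
      (edge_before l)).1 (ad (edge_before l)).2).
  have j3 := cjet_patch_sum rp n0 (q l).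
  apply: (eq_cjet (cjet_lin 1 j1 (cjet_lin 1 j2 (cjet_lin (-1) j3 (cjet0 (R := R)))))).
    by move=> xi _; rewrite !mul1r addr0.
  rewrite -/(first_jet gd p r n (edge_after l) (ad (edge_after l)).1 (ad (edge_after l)).2) in M1 *.
  rewrite -/(second_jet gd p r n (edge_before l) (ad (edge_before l)).1 (ad (edge_before l)).2) in
    M2 *.
  move=> m1 m2 m; rewrite !mul1r mulN1r addr0.
  set J := pulled_jet S (hh l) in M1 M2 M3 *.
  set J1 := first_jet _ _ _ _ _ _ _ in M1 *; set J2 := second_jet _ _ _ _ _ _ _ in M2 *.
  set J3 := patch_jet _ _ _ _ in M3 *.
  (* Where both orders are at most 1 all three interpolants are right, so the alternating sum is
     right as well. *)
  have low k1 k2 : (k1 <= 1)%N -> (k2 <= 1)%N -> [/\ J1 k1 k2 = J k1 k2,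
    J2 k2 k1 = J k1 k2 & J3 k1 k2 = J k1 k2].
    by move=> h1 h2; split; [apply: M1|apply: (M2 k2 k1)|apply: M3] => //; lia.
  have [m1l|m1l] := leqP m1 1.
    have [m2l|m2l] := leqP m2 1.
      by have [-> -> ->] := low m1 m2 m1l m2l; rewrite subrr addr0.
    have [-> ->] : m1 = 0%N /\ m2 = 2%N by split; lia.
    (* [J1] is right at order [(0, 2)]; [J2] and [J3] express it by the same combination of lower
       orders, where they agree, and so cancel. *)
    rewrite [J1 0%N 2%N]M1 // /J2 /J3 /second_jet side_jet_normal2 // patch_jet_second2 //.
    rewrite -/(second_jet gd p r n (edge_before l) (ad (edge_before l)).1 (ad (edge_before l)).2)
      -/J2 -/J3.
    have [_ -> ->] := low 0%N 0%N isT isT; have [_ -> ->] := low 0%N 1%N isT isT.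
    by rewrite subrr addr0.
  have [-> ->] : m1 = 2%N /\ m2 = 0%N by split; lia.
  rewrite [J2 0%N 2%N](M2 0%N 2%N) // /J1 /J3 /first_jet side_jet_normal2 // patch_jet_second1 //.
  rewrite -/(first_jet gd p r n (edge_after l) (ad (edge_after l)).1 (ad (edge_after l)).2) -/J1
    -/J3.
  have [-> _ ->] := low 0%N 0%N isT isT; have [-> _ ->] := low 1%N 0%N isT isT.
  by rewrite addrCA subrr addr0.
- move=> l m ln m4 m0.
  have [V1 _ _] := after l ln; have [V2 _ _] := before l ln.
  have [oa1 ob1] := vertex_end_orders (first_al gd (edge_after l)) (first_be gd (edge_after l)) V1.
  have [oa2 ob2] := vertex_end_orders (second_al gd (edge_before l)) (second_be gd (edge_before l))
    V2.
  have m0' (P : Prop) : m = 0%N -> P by move=> /m0.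
  have k1 := cjet_side1_corner rp n0 hN oa1 ob1 m4 (m0' _) (fun _ => isT).
  have k2 := cjet_side2_corner rp n0 hN oa2 ob2 m4 (m0' _) (fun _ => isT).
  have k3 := cjet_patch_corner rp n0 hN (q l) m4 m0.
  apply: (eq_cjet (cjet_lin 1 k1 (cjet_lin 1 k2 (cjet_lin (-1) k3 (cjet0 (R := R)))))).
    by move=> xi _; rewrite !mul1r addr0.
  by move=> m1 m2 _; rewrite !mulr0 !addr0.
Qed.

End VertexSpace.

(** * The basis of the Argyris space *)

Section Argyris.
Context {R : realType} {I : finType}.
Variables (Omega : set (plane R)) (F : I -> plane R -> plane R).
Variable gd : rpatch I -> rpatch I -> gluing R.
Variables (p r n : nat).

Local Notation N := (spline_dim p r n).
Local Notation Nm := (spline_dim p.-1 r n).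
Local Notation Np := (spline_dim p r.+1 n).
Local Notation b := (@bspline R p r n).
Local Notation broken := (I -> plane R -> R^o).

Hypotheses (rp : (r.+1 < p)%N) (n0 : (0 < n)%N) (hN : (5 <= Nm)%N).
Hypothesis hdom : multipatch_domain Omega F p r n.
Hypothesis hG1 : analysis_suitable_G1 Omega F gd.
Variables (Pj Qj : rpatch I -> nat -> nat -> R).
Hypothesis HPQ : forall h, [/\
  cjet (fun xi => (param F h xi).1 : R^o) (Pj h),
  cjet (fun xi => (param F h xi).2 : R^o) (Qj h) &
  Pj h 1%N 0%N * Qj h 0%N 1%N - Pj h 0%N 1%N * Qj h 1%N 0%N != 0].

Implicit Types (a d : nat -> R) (e : edge_form I) (h : rpatch I) (i : I).

(** Coefficients of a shifted index range, extended by zero, so that independence of all B-splines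
    applies to subfamilies. *)
Definition shift_coef (K s : nat) (c : 'I_K -> R) (j : nat) : R :=
  \sum_(k < K) c k * (j == k + s)%N%:R.

Lemma shift_coef_eq (K s : nat) (c : 'I_K -> R) (k : 'I_K) : shift_coef s c (k + s) = c k.
Proof.
rewrite /shift_coef (bigD1 k) //= eqxx mulr1 big1 ?addr0 // => l lk.
by rewrite eqn_add2r eq_sym val_eqE (negbTE lk) mulr0.
Qed.

Lemma shift_coef_supp (K s : nat) (c : 'I_K -> R) j : shift_coef s c j != 0 -> (s <= j < K + s)%N.
Proof.
move=> H; apply: contraNT H => js; rewrite /shift_coef big1 // => k _.
case: eqP => [E|]; last by rewrite mulr0.
by move: js; rewrite E leq_addl ltn_add2r ltn_ord.
Qed.

Lemma sum_shift (V : lmodType R) (K s M : nat) (c : 'I_K -> R) (f : nat -> V) : (K + s <= M)%N ->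
  \sum_(j < M) shift_coef s c j *: f j = \sum_(k < K) c k *: f (k + s)%N.
Proof.
move=> KM; rewrite /shift_coef; under eq_bigr do rewrite scaler_suml.
rewrite exchange_big /=; apply: eq_bigr => k _.
have ks : (k + s < M)%N by apply: leq_trans KM; rewrite ltn_add2r.
rewrite (bigD1 (Ordinal ks)) //= eqxx mulr1 big1 ?addr0 // => j.
by rewrite -val_eqE /= => /negbTE ->; rewrite mulr0 scale0r.
Qed.

Lemma bspline_shift_free (K s : nat) (c : 'I_K -> R) : (K + s <= N)%N ->
  (forall x, 0 < x < 1 -> \sum_(k < K) c k * b (k + s) x = 0) -> forall k : 'I_K, c k = 0.
Proof.
move=> KN H k; rewrite -(shift_coef_eq s c k).
apply: (bspline_free (ltrp rp) n0 (c := shift_coef s c)); last first.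
  by apply: leq_trans KN; rewrite ltn_add2r.
move=> x x01; rewrite -[RHS](H x x01).
exact: (@sum_shift R^o K s N c (fun j => b j x) KN).
Qed.

Definition patch_index := ('I_(N - 4) * 'I_(N - 4))%type.
(** The index [j.1] runs from 3 to [Nm - 3] for traces and from 2 to [Nm - 3] for normal parts. *)
Definition edge_index := ('I_(Nm - 5) + 'I_(Nm - 4))%type.

Definition patch_pair (k : patch_index) : nat * nat := (k.1 + 2, k.2 + 2)%N.
Definition edge_pair (k : edge_index) : nat * nat :=
  match k with inl k => (k + 3, 0)%N | inr k => (k + 2, 1)%N end.

Lemma patch_spaceE i : patch_space F p r n i =
  lspan (range (fun k : patch_index => Defs.glue F (patch_fun F p r n (i, 0) (patch_pair k)))).
Proof.
have N6 := N_ge6 rp n0 hN.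
congr lspan; apply/seteqP; split=> [f [[j1 j2] [/= h1 h2 ->]]|f [[k1 k2] _ <-]].
  have l1 : (j1 - 2 < N - 4)%N by lia.
  have l2 : (j2 - 2 < N - 4)%N by lia.
  exists (Ordinal l1, Ordinal l2) => //; congr (Defs.glue _ (patch_fun _ _ _ _ _ (_, _))) => /=;
    lia.
exists (patch_pair (k1, k2)); rewrite /patch_pair /=.
by have := ltn_ord k1; have := ltn_ord k2; split => //; lia.
Qed.

Lemma edge_spaceE e : edge_space F gd p r n e =
  lspan (range (fun k : edge_index => Defs.glue F (edge_fun F gd p r n e (edge_pair k)))).
Proof.
have N5 := hN.
congr lspan; apply/seteqP; split=> [f [[j1 j2] [/= h1 h2 h3 ->]]|f [k _ <-]].
  case: j2 h1 h2 => [|[|//]] _ h2.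
    have l1 : (j1 - 3 < Nm - 5)%N by lia.
    exists (inl (Ordinal l1)) => //; congr (Defs.glue _ (edge_fun _ _ _ _ _ _ (_, _))) => /=; lia.
  have l1 : (j1 - 2 < Nm - 4)%N by lia.
  exists (inr (Ordinal l1)) => //; congr (Defs.glue _ (edge_fun _ _ _ _ _ _ (_, _))) => /=; lia.
exists (edge_pair k); case: k => k /=; have := ltn_ord k; split => //; lia.
Qed.

Section VertexBasis.
Variables (x : plane R) (v : vertex_form I).
Hypothesis hv : standard_vertex Omega F x v.
Hypothesis nu0 : (0 < valence v)%N.

Definition vertex_poly (k : 'I_6) : plane R -> R^o := quad x (jet_of (fun l => (l == k)%:R)).

Lemma vertex_jet_quad T : vertex_jet F Pj Qj x (quad x T) T.
Proof. by move=> h; exact: cjet_quad_param. Qed.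

Lemma jet_of_sum (c : 'I_6 -> R) m1 m2 :
  jet_of c m1 m2 = \sum_k c k * jet_of (fun l => (l == k)%:R) m1 m2.
Proof.
rewrite /jet_of; apply: eq_bigr => k _; congr (_ * _).
by rewrite (bigD1 k) //= eqxx mul1r big1 ?addr0 // => l /negbTE ->; rewrite mul0r.
Qed.

Lemma vertex_proj_quad (c : 'I_6 -> R) :
  \sum_k c k *: vertex_proj F gd p r n v (vertex_poly k) = vertex_proj F gd p r n v (quad x (jet_of
    c)).
Proof.
apply/esym/(vertex_proj_lin rp n0 hN hdom hG1 HPQ hv nu0 (vertex_jet_quad _)) => [k|m1 m2 _].
  exact: vertex_jet_quad.
exact: jet_of_sum.
Qed.

(** The projection factors through the 2-jet at [x], so the quadratic polynomials already reach the
    whole image. *)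
Lemma vertex_spaceE : vertex_space F gd p r n x v =
  lspan (range (fun k => Defs.glue F (vertex_proj F gd p r n v (vertex_poly k)))).
Proof.
apply/seteqP; split=> [_ [phi C2 <-]|f].
  have [S HS] := C2_at_jet HPQ C2 (vpatch_corner hv nu0).
  apply/lspan_range; exists (fun k => S (jet_index k).1 (jet_index k).2).
  rewrite -glue_lin; congr Defs.glue.
  apply: (vertex_proj_lin rp n0 hN hdom hG1 HPQ hv nu0 HS) => [k|m1 m2 m].
    exact: vertex_jet_quad.
  by rewrite -jet_of_sum jet_of_jet.
move=> /lspan_range[c ->]; rewrite -glue_lin vertex_proj_quad.
by exists (quad x (jet_of c)) => //; exact: quad_C2_at.
Qed.

Lemma turn_corner_inj (m m' : nat) : (m < 4)%N -> (m' < 4)%N ->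
  iter m quarter_turn (0, 0) = iter m' quarter_turn (0, 0) :> plane R -> m = m'.
Proof.
have o : (1 : R) <> 0 by apply/eqP; exact: oner_neq0.
have o' : (0 : R) <> 1 by apply/eqP; rewrite eq_sym; exact: oner_neq0.
by case: m m' => [|[|[|[|//]]]] [|[|[|[|//]]]] //= _ _;
  rewrite /quarter_turn /= ?subr0 ?subrr => -[] *; exfalso; auto.
Qed.

Lemma corner_inj i k k' : corner F (i, k) = corner F (i, k') -> k = k'.
Proof.
have u0 : unit_square (0 : R, 0 : R) by split; rewrite /= lexx ler01.
move=> /(F_inj hdom (unit_square_turn _ u0) (unit_square_turn _ u0)) E.
exact/val_inj/(turn_corner_inj (ltn_ord k) (ltn_ord k') E).
Qed.

Lemma cjet_vertex_own S phi i k : vertex_jet F Pj Qj x phi S -> corner F (i, k) = x ->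
  cjet (pull F (vertex_proj F gd p r n v phi) (i, k)) (pulled_jet Pj Qj S (i, k)).
Proof.
move=> HJ cx; have [G [-> H1 H2]] := vertex_proj_struct rp n0 hN hdom hG1 HPQ hv nu0 HJ.
have [inj cl cor _] := hv.
have /cl[l0 l0n El0] : closed_patch F i x.
  rewrite -cx; apply: (@closed_patch_param R I F (i, k)).
  by split; rewrite /= lexx ler01.
(* A patch has distinct corners, so lying at [x] determines the rotation. *)
have hl0 : vpatch v l0 = (i, k).
  rewrite [LHS]surjective_pairing El0; congr (_, _); apply: (@corner_inj i).
  by rewrite cx -[in RHS](cor l0 l0n); congr corner; rewrite [RHS]surjective_pairing El0.
apply: (eq_cjet (H1 l0 l0n)); last by rewrite hl0.
move=> xi; rewrite inE => u.
have := @pull_sum R I F 'I_(valence v) (index_enum _) xpredT (fun=> 1) (fun l => on_patch F (vpatch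
  v l) (G l)) (i, k) xi.
under [X in pull F X]eq_bigr do rewrite scale1r.
move=> ->; rewrite (bigD1 (Ordinal l0n)) //= big1 ?addr0.
  by rewrite hl0 (pull_on_patch hdom) // eqxx turnsxx mul1r.
move=> l ll0; rewrite mul1r.
case E : (vpatch v l) => [i' k']; rewrite (pull_on_patch hdom) //; case: eqP => // ii'.
move: ll0; rewrite -val_eqE /= => /eqP[]; apply: inj => //.
by rewrite E hl0.
Qed.

(** This includes the other corners of patches around [x], where the number of turns is not 0. *)
Lemma cjet_vertex_other S phi i k : vertex_jet F Pj Qj x phi S -> corner F (i, k) <> x ->
  cjet (pull F (vertex_proj F gd p r n v phi) (i, k)) (fun _ _ => 0).
Proof.
move=> HJ cx; have [G [-> H1 H2]] := vertex_proj_struct rp n0 hN hdom hG1 HPQ hv nu0 HJ.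
have [inj cl cor _] := hv.
have H := @cjet_sum R 'I_(valence v) (index_enum _) xpredT (fun=> 1)
  (fun l => pull F (on_patch F (vpatch v l) (G l)) (i, k)) (fun _ _ _ => 0).
apply: (eq_cjet (H _)).
- move=> l _; case E : (vpatch v l) => [i' k'].
  have [ii'|ii'] := eqVneq i i'; last first.
    by apply: (eq_cjet (cjet0 (R := R))) => // xi; rewrite inE => u;
      rewrite (pull_on_patch hdom) // (negbTE ii').
  apply: (eq_cjet (H2 l (turns k' k) (ltn_ord l) (turns_lt _ _) _)) => //.
    move=> /turns_eq0 kk'; apply: cx; rewrite -(cor l (ltn_ord l)) E; congr corner.
    by rewrite ii' kk'.
  by move=> xi; rewrite inE => u; rewrite (pull_on_patch hdom) // ii' eqxx.
- move=> xi _; have := @pull_sum R I F 'I_(valence v) (index_enum _) xpredT (fun=> 1) (fun l =>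
  on_patch F (vpatch v l) (G l)) (i, k) xi.
  by under [X in pull F X]eq_bigr do rewrite scale1r.
- by move=> m1 m2 _; rewrite big1 // => l _; rewrite mulr0.
Qed.

Lemma vertex_jet_eq0 (c : 'I_6 -> R) h :
  (forall m1 m2, (m1 + m2 <= 2)%N -> pulled_jet Pj Qj (jet_of c) h m1 m2 = 0) -> forall k : 'I_6,
    c k = 0.
Proof.
have [_ _ det] := HPQ h => /(chain_eq0 det) H k.
by rewrite -jet_of_index H //; exact: jet_index_le.
Qed.

End VertexBasis.

Definition patch_comb (c : patch_index -> R) : plane R -> R^o := fun xi =>
  \sum_k c k * tens (b (k.1 + 2)) (b (k.2 + 2)) xi.

Lemma patch_combE i (c : patch_index -> R) :
  \sum_k c k *: patch_fun F p r n (i, 0) (patch_pair k) = on_patch F (i, 0) (patch_comb c).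
Proof. by rewrite -on_patch_sum. Qed.

Lemma edge_combE e (c : edge_index -> R) :
  \sum_k c k *: edge_fun F gd p r n e (edge_pair k)
  = edge_elem F gd p r n e (shift_coef 3 (fun k => c (inl k))) (shift_coef 2 (fun k => c (inr k))).
Proof.
have N5 := hN; have hp := NpE rp n0 hN.
rewrite (edge_elemE F gd rp n0) big_sumType /=; congr (_ + _).
  by rewrite (@sum_shift _ (Nm - 5) 3 Np _ (fun j => edge_fun F gd p r n e (j, 0%N))) // hp; lia.
by rewrite (@sum_shift _ (Nm - 4) 2 Nm _ (fun j => edge_fun F gd p r n e (j, 1%N))) //; lia.
Qed.

Lemma patch_basis_orders (k : 'I_(N - 4)) : end_orders 2 2 (b (k + 2)).
Proof.
have N6 := N_ge6 rp n0 hN; have kN := ltn_ord k.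
by apply: end_orders_le (end_orders_bspline (R := R) (ltrp rp) n0 _) => //; lia.
Qed.

Lemma cjet_patch_comb i' (c : patch_index -> R) i k :
  cjet (pull F (on_patch F (i', 0) (patch_comb c)) (i, k)) (fun _ _ => 0).
Proof.
have [ii'|ii'] := eqVneq i i'; last first.
  by apply: (eq_cjet (cjet0 (R := R))) => // xi; rewrite inE => u;
    rewrite (pull_on_patch hdom) // (negbTE ii').
have H := @cjet_sum R patch_index (index_enum _) xpredT c
  (fun l xi => tens (b (l.1 + 2)) (b (l.2 + 2)) (iter (turns 0 k) quarter_turn xi)) (fun _ _ _ =>
    0).
apply: (eq_cjet (H _)).
- move=> [l1 l2] _ /=.
  apply: (cjet_tens_corner (patch_basis_orders l1) (patch_basis_orders l2) (turns_lt 0 k)).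
  by case: (turns 0 k) (turns_lt 0 k) => [|[|[|[|//]]]].
- by move=> xi; rewrite inE => u; rewrite (pull_on_patch hdom) // ii' eqxx.
- by move=> m1 m2 _; rewrite big1 // => l _; rewrite mulr0.
Qed.

Lemma trace_patch_comb i' (c : patch_index -> R) i k :
  trace_at (pull F (on_patch F (i', 0) (patch_comb c)) (i, k)) (fun=> 0) (fun=> 0).
Proof.
have [ii'|ii'] := eqVneq i i'; last first.
  apply: (eq_trace_at (trace_at0 (R := R))) => // xi; rewrite inE => /open_unit_square_unit u.
  by rewrite (pull_on_patch hdom) // (negbTE ii').
have H := @trace_at_sum R patch_index (index_enum _) xpredT c
  (fun l xi => tens (b (l.1 + 2)) (b (l.2 + 2)) (iter (turns 0 k) quarter_turn xi)).
apply: (eq_trace_at (H _)) => //.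
- move=> [l1 l2] _ /=.
  apply: (trace_at_tens_corner (patch_basis_orders l1) (patch_basis_orders l2) (turns_lt 0 k)).
  by case: (turns 0 k) (turns_lt 0 k) => [|[|[|[|//]]]].
- by move=> xi; rewrite inE => /open_unit_square_unit u; rewrite (pull_on_patch hdom) // ii' eqxx.
Qed.

Section EdgeCoefs.
Variables (e : edge_form I) (c : edge_index -> R).

Let a := shift_coef 3 (fun k => c (inl k)).
Let d := shift_coef 2 (fun k => c (inr k)).

(** The index ranges of the edge space are made for this: orders 3 and 2 at both ends kill the
    2-jets at all corners. *)
Lemma edge_trace_orders : end_orders 3 3 (trace_fun p r n a).
Proof. by apply: end_orders_trace => // j /shift_coef_supp; have N5 := hN; lia. Qed.

Lemma edge_cross_orders (al be : {poly R}) : end_orders 2 2 (cross_fun p r n al be a d).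
Proof.
have N5 := hN; apply: end_orders_cross => // [j /shift_coef_supp H|].
  by split; [apply/orP; left|]; lia.
by apply: end_orders_normal => // j /shift_coef_supp; lia.
Qed.

Lemma cjet_edge_elem i k : cjet (pull F (edge_elem F gd p r n e a d) (i, k)) (fun _ _ => 0).
Proof.
have oa := edge_trace_orders.
have h1 : cjet (pull F (first_part F gd p r n e a d) (i, k)) (fun _ _ => 0).
  rewrite /first_part; case: (first_patch e) => [[i' k']|]; last exact: cjet0.
  have [ii'|ii'] := eqVneq i i'; last first.
    by apply: (eq_cjet (cjet0 (R := R))) => // xi; rewrite inE => u;
      rewrite (pull_side1 hdom) // (negbTE ii').
  have ob := edge_cross_orders (first_al gd e) (first_be gd e).
  apply: (eq_cjet (cjet_side1_corner rp n0 hN oa ob (turns_lt k' k) (fun=> isT) (fun=> isT))) => //.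
  by move=> xi; rewrite inE => u; rewrite (pull_side1 hdom) // ii' eqxx.
have h2 : cjet (pull F (second_part F gd p r n e a d) (i, k)) (fun _ _ => 0).
  rewrite /second_part; case: (second_patch e) => [[i' k']|]; last exact: cjet0.
  have [ii'|ii'] := eqVneq i i'; last first.
    by apply: (eq_cjet (cjet0 (R := R))) => // xi; rewrite inE => u;
      rewrite (pull_side2 hdom) // (negbTE ii').
  have ob := edge_cross_orders (second_al gd e) (second_be gd e).
  apply: (eq_cjet (cjet_side2_corner rp n0 hN oa ob (turns_lt k' k) (fun=> isT) (fun=> isT))) => //.
  by move=> xi; rewrite inE => u; rewrite (pull_side2 hdom) // ii' eqxx.
by apply: (eq_cjet (cjet_lin 1 h1 h2)) => [xi _|m1 m2 _]; rewrite mul1r ?addr0.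
Qed.

(** The hypotheses exclude that [side1] of [(i, k)] is the side carrying the edge function; for a
    second patch that happens after exactly one quarter turn. *)
Lemma trace_edge_other i k :
  (forall k', first_patch e = Some (i, k') -> k' <> k) ->
  (forall k', second_patch e = Some (i, k') -> turns k' k <> 1%N) ->
  trace_at (pull F (edge_elem F gd p r n e a d) (i, k)) (fun=> 0) (fun=> 0).
Proof.
move=> f1 f2; have oa := edge_trace_orders.
have h1 : trace_at (pull F (first_part F gd p r n e a d) (i, k)) (fun=> 0) (fun=> 0).
  rewrite /first_part; case: (first_patch e) f1 => [[i' k']|]; last by move=> _; exact: trace_at0.
  have [<-|ii'] := eqVneq i i' => f1; last first.
    by apply: (eq_trace_at (trace_at0 (R := R))) => // xi; rewrite inE => /open_unit_square_unit u;
      rewrite (pull_side1 hdom) // (negbTE ii').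
  have ob := edge_cross_orders (first_al gd e) (first_be gd e).
  have t0 : turns k' k <> 0%N by move=> /turns_eq0; exact: f1.
  apply: (eq_trace_at (trace_at_side1_corner rp n0 hN oa ob (turns_lt k' k) t0 isT)) => //.
  by move=> xi; rewrite inE => /open_unit_square_unit u; rewrite (pull_side1 hdom) // eqxx.
have h2 : trace_at (pull F (second_part F gd p r n e a d) (i, k)) (fun=> 0) (fun=> 0).
  rewrite /second_part; case: (second_patch e) f2 => [[i' k']|]; last by move=> _; exact: trace_at0.
  have [<-|ii'] := eqVneq i i' => f2; last first.
    by apply: (eq_trace_at (trace_at0 (R := R))) => // xi; rewrite inE => /open_unit_square_unit u;
      rewrite (pull_side2 hdom) // (negbTE ii').
  have ob := edge_cross_orders (second_al gd e) (second_be gd e).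
  apply: (eq_trace_at (trace_at_side2_corner rp n0 hN oa ob (turns_lt k' k) (f2 _ erefl) isT)) =>
    //.
  by move=> xi; rewrite inE => /open_unit_square_unit u; rewrite (pull_side2 hdom) // eqxx.
by apply: (eq_trace_at (trace_at_lin 1 h1 h2)) => [xi _|y|y]; rewrite mul1r ?addr0.
Qed.

Lemma trace_edge_own h : distinct_patches e -> first_patch e = Some h ->
  trace_at (pull F (edge_elem F gd p r n e a d) h) (trace_fun p r n a)
    (cross_fun p r n (first_al gd e) (first_be gd e) a d).
Proof.
move=> de fe.
apply: (eq_trace_at (trace_at_side1 rp n0 (trace_fun p r n a)
  (cross_fun p r n (first_al gd e) (first_be gd e) a d))) => // xi.
rewrite inE => /open_unit_square_unit u; rewrite /edge_elem pullD /first_part fe.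
case: h fe => i k fe; rewrite (pull_side1 hdom) // eqxx turnsxx /=.
rewrite -[LHS]addr0; congr (_ + _).
case: e fe de => [h1 h2|h1|h1] //= [->] /= de.
by case: h2 de => i2 k2 /= /eqP/negbTE de; rewrite /second_part /= (pull_side2 hdom) // de.
Qed.

Lemma edge_coefs_eq0 : (forall t, 0 < t < 1 -> (first_al gd e).[t] != 0) ->
  (forall t, 0 < t < 1 -> trace_fun p r n a t = 0 /\
     cross_fun p r n (first_al gd e) (first_be gd e) a d t = 0) ->
  forall k : edge_index, c k = 0.
Proof.
move=> al0 H; have N5 := hN; have hp := NpE rp n0 hN.
have a0 j : (j < Np)%N -> a j = 0.
  by apply: (bspline_free rp n0) => t t01; have [] := H t t01.
have d0 j : (j < Nm)%N -> d j = 0.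
  (* Once the trace coefficients are zero, [cross_fun] is the normal part times [al] and [kappa],
     which do not vanish. *)
  apply: (bspline_free (ltrp1 rp n0 hN) n0) => t t01; have [_] := H t t01.
  rewrite /cross_fun /dtrace_fun big1 => [|l _]; last by rewrite a0 // mul0r.
  rewrite mulr0 add0r => /eqP; rewrite mulf_eq0 (negbTE (al0 t t01)) mulf_eq0.
  by rewrite (negbTE (kappa_neq0 rp n0)) => /eqP.
case=> k; have kl := ltn_ord k.
  by have := a0 (k + 3)%N; rewrite /a shift_coef_eq; apply; lia.
by have := d0 (k + 2)%N; rewrite /d shift_coef_eq; apply; lia.
Qed.

End EdgeCoefs.

Variables (E X : finType) (edge : E -> set (plane R)) (vert : X -> plane R)
  (eform : E -> edge_form I) (vform : X -> vertex_form I).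
Hypotheses (hedge : indexes_edges F edge) (hvert : indexes_vertices F vert)
  (heform : forall e : E, standard_edge Omega F (edge e) (eform e))
  (hvform : forall x : X, standard_vertex Omega F (vert x) (vform x)).

Lemma vertex_valence (x : X) : (0 < valence (vform x))%N.
Proof.
have [_ rg] := hvert; have [_ cl _ _] := hvform x.
have [h _ hx] : range (corner F) (vert x) by rewrite -rg; exists x.
have /cl[l] : closed_patch F h.1 (vert x).
  by rewrite -hx; apply: closed_patch_param; split; rewrite /= lexx ler01.
by move=> lv _; exact: leq_ltn_trans lv.
Qed.

Definition basis_index (s : I + E + X) : finType :=
  match s with
  | inl (inl _) => patch_index
  | inl (inr _) => edge_index
  | inr _ => 'I_6
  end.

Definition broken_basis (s : I + E + X) : basis_index s -> broken :=
  match s return basis_index s -> broken with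
  | inl (inl i) => fun k => patch_fun F p r n (i, 0) (patch_pair k)
  | inl (inr e) => fun k => edge_fun F gd p r n (eform e) (edge_pair k)
  | inr x => fun k => vertex_proj F gd p r n (vform x) (vertex_poly (vert x) k)
  end.

Definition argyris_basis (s : I + E + X) (k : basis_index s) : plane R -> R^o :=
  Defs.glue F (broken_basis k).

Lemma argyris_summandE (s : I + E + X) :
  argyris_summand F gd p r n vert eform vform s = lspan (range (@argyris_basis s)).
Proof.
case: s => [[i|e]|x] /=.
- exact: patch_spaceE.
- exact: edge_spaceE.
- exact: vertex_spaceE (hvform x) (vertex_valence x).
Qed.

Lemma standard_edge_first (e : E) : exists h, [/\ first_patch (eform e) = Some h,
  edge e = side1 F h & edge_std Omega F (eform e)].
Proof.
have := heform e; case: (eform e) => [h1 h2|h|h] //=.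
- by move=> [S st]; exists h1; split.
- by move=> [S _]; exists h; split.
Qed.

Lemma standard_edge_second (e : E) h : second_patch (eform e) = Some h -> edge e = side2 F h.
Proof.
have := heform e; case: (eform e) => [h1 h2|h'|h'] //= [-> [_ _ E12]] [<-].
apply/seteqP; split=> _ [t /= t01 <-]; exists t => //;
  by rewrite E12 //; move: t01; rewrite in_itv /= => /andP[/ltW -> /ltW ->].
Qed.

Lemma side1_turn i k k' : turns k' k = 1%N -> side1 F (i, k) = side2 F (i, k').
Proof.
move=> tk; have P t : param F (i, k) (0, t) = param F (i, k') (1 - t, 0).
  by rewrite (param_turns F i k') tk.
apply/seteqP; split=> _ [t /= t01 <-]; exists (1 - t).
- by move: t01; rewrite /= !in_itv /= subr_gt0 gtrBl andbC.
- by rewrite P.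
- by move: t01; rewrite /= !in_itv /= subr_gt0 gtrBl andbC.
- by rewrite P subKr.
Qed.

(** * Linear independence of the whole family *)

Section Freeness.
Variable c : forall s, basis_index s -> R.
Hypothesis c0 : \sum_s \sum_k @c s k *: argyris_basis k = 0.

Let U (s : I + E + X) : broken := \sum_k @c s k *: broken_basis k.

(** Over an open square gluing loses nothing, so the relation between glued functions holds patch by
    patch. *)
Lemma pull_total i k xi : open_unit_square xi -> \sum_s pull F (U s) (i, k) xi = 0.
Proof.
move=> o.
have := @pull_sum R I F (I + E + X)%type (index_enum _) xpredT (fun=> 1) U (i, k) xi.
under eq_bigr do rewrite scale1r; under [RHS]eq_bigr do rewrite mul1r.
move=> <-; rewrite -(glue_pull hdom) //.
suff -> : Defs.glue F (\sum_s U s) = 0 by [].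
have := glue_lin F (fun=> 1) U; under eq_bigr do rewrite scale1r.
move=> ->; rewrite -[RHS]c0; apply: eq_bigr => s _.
by rewrite scale1r /U glue_lin.
Qed.

Lemma cjet_not_vertex s i k : (if s is inr _ then False else True) ->
  cjet (pull F (U s) (i, k)) (fun _ _ => 0).
Proof.
case: s => [[i'|e]|//] _; rewrite /U /=.
- by rewrite patch_combE; exact: cjet_patch_comb.
- by rewrite edge_combE; exact: cjet_edge_elem.
Qed.

(** At a corner mapped to the vertex, all other summands have zero 2-jet; injectivity of [vert]
    rules out a second index for the same vertex. *)
Lemma vertex_coef0 (x : X) (k : 'I_6) : @c (inr x) k = 0.
Proof.
have [inj rg] := hvert.
have [[i k0] _ cx] : range (corner F) (vert x) by rewrite -rg; exists x.
have VQ y := vertex_proj_quad (hvform y) (vertex_valence y).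
pose T y := jet_of (@c (inr y)).
have own : cjet (pull F (U (inr x)) (i, k0)) (pulled_jet Pj Qj (T x) (i, k0)).
  rewrite /U /= VQ; apply: (cjet_vertex_own (hvform x) (vertex_valence x)) => //.
  exact: vertex_jet_quad.
have other s : s != inr x -> cjet (pull F (U s) (i, k0)) (fun _ _ => 0).
  case: s => [s|y] sx; first exact: cjet_not_vertex.
  rewrite /U /= VQ; apply: (cjet_vertex_other (hvform y) (vertex_valence y));
    first exact: vertex_jet_quad.
  by rewrite cx => /inj xy; move: sx; rewrite xy eqxx.
have sum0 := @cjet_sum R (I + E + X)%type (index_enum _) (fun s => s != inr x) (fun=> 1) (fun s =>
  pull F (U s) (i, k0)) (fun _ _ _ => 0) other.
have tot := cjet_lin 1 own sum0.
apply: (vertex_jet_eq0 (c := @c (inr x)) (h := (i, k0))) => m1 m2 m.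
have := cjet_open0 tot _ m; rewrite mul1r big1 ?addr0 => [|s _]; last by rewrite mulr0.
apply=> xi; rewrite inE => o; rewrite -[RHS](pull_total i k0 o) [RHS](bigD1 (inr x)) //= mul1r.
by congr (_ + _); apply: eq_bigr => s _; rewrite mul1r.
Qed.

Lemma vertex_part0 x : U (inr x) = 0.
Proof. by rewrite /U big1 // => k _; rewrite vertex_coef0 scale0r. Qed.

(** Along the edge, seen from its first patch, which a standard edge always has, no other summand
    has a trace or slope; injectivity of [edge] excludes a second index for the same side. *)
Lemma edge_coef0 (e : E) (k : edge_index) : @c (inl (inr e)) k = 0.
Proof.
have [inj _] := hedge.
have [[i k0] [fe Ee st]] := standard_edge_first e.
have := @trace_edge_own (eform e) (@c (inl (inr e))) (i, k0) (edge_std_distinct st) fe.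
rewrite -edge_combE -[\sum_k _]/(U (inl (inr e))) => own.
have other s : s != inl (inr e) -> trace_at (pull F (U s) (i, k0)) (fun=> 0) (fun=> 0).
  case: s => [[i'|e']|x] se.
  - by rewrite /U /= patch_combE; exact: trace_patch_comb.
  - have ee' : edge e' <> edge e by move=> /inj ee'; move: se; rewrite ee' eqxx.
    rewrite /U /= edge_combE; apply: trace_edge_other => k' fe'.
    + move=> kk'; apply: ee'; have [h [fh -> _]] := standard_edge_first e'.
      by move: fh; rewrite fe' kk' => -[<-].
    + by move=> /side1_turn S; apply: ee'; rewrite (standard_edge_second fe') Ee S.
  - by rewrite vertex_part0; exact: trace_at0.
have sum0 := @trace_at_sum R (I + E + X)%type (index_enum _) (fun s => s != inl (inr e)) (fun=> 1)
  (fun s => pull F (U s) (i, k0)) other.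
have tot := trace_at_lin 1 own sum0.
have z : {in open_unit_square, (fun xi => 1 * pull F (U (inl (inr e))) (i, k0) xi
    + \sum_(s | s != inl (inr e)) 1 * pull F (U s) (i, k0) xi) =1 fun=> 0}.
  move=> xi; rewrite inE => o; rewrite -[RHS](pull_total i k0 o) [RHS](bigD1 (inl (inr e))) //=
    mul1r.
  by congr (_ + _); apply: eq_bigr => s _; rewrite mul1r.
have Z := trace_at_uniq0 tot z.
apply: (edge_coefs_eq0 (e := eform e) (c := @c (inl (inr e)))).
  move=> t /andP[t0 t1]; case: (eform e) st {fe own tot z Z} => [h1 h2|h|h] /=;
    rewrite ?hornerC ?oner_eq0 //.
  move=> /hG1[_ _ pos _ _]; have := pos t; rewrite (ltW t0) (ltW t1) => /(_ isT).
  by apply: contraTneq => ->; rewrite mul0r ltxx.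
by move=> t t01; have [] := Z t t01; rewrite !mul1r !addr0.
Qed.

Lemma edge_part0 (e : E) : U (inl (inr e)) = 0.
Proof. by rewrite /U big1 // => k _; rewrite edge_coef0 scale0r. Qed.

Lemma patch_coef0 i (k : patch_index) : @c (inl (inl i)) k = 0.
Proof.
have N6 := N_ge6 rp n0 hN.
have Z xi : open_unit_square xi -> patch_comb (@c (inl (inl i))) xi = 0.
  move=> o; have u := open_unit_square_unit o.
  rewrite -[RHS](pull_total i 0 o) (bigD1 (inl (inl i))) //= big1 ?addr0.
    by rewrite /U /= patch_combE (pull_on_patch hdom) // eqxx turnsxx.
  case=> [[i'|e]|x] si.
  - rewrite /U /= patch_combE (pull_on_patch hdom) //; case: eqP => // ii'.
    by move: si; rewrite ii' eqxx.
  - by rewrite edge_part0.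
  - by rewrite vertex_part0.
case: k => k1 k2.
have KN : (N - 4 + 2 <= N)%N by lia.
(* Independence of the tensor products, one variable at a time. *)
apply: (bspline_shift_free (c := fun k2 => @c (inl (inl i)) (k1, k2)) KN) => y y01.
apply: (bspline_shift_free (c := fun k1 => \sum_k2 @c (inl (inl i)) (k1,
  k2) * b (k2 + 2) y) KN) => z z01.
rewrite -[RHS](Z (z, y) (conj z01 y01)).
transitivity (\sum_l1 \sum_l2 @c (inl (inl i)) (l1, l2) * tens (b (l1 + 2)) (b (l2 + 2)) (z, y));
  last first.
  by rewrite pair_bigA /=; apply: eq_bigr => -[].
by apply: eq_bigr => l _; rewrite mulr_suml; apply: eq_bigr => l' _;
  rewrite /tens /= -mulrA [b _ y * _]mulrC.
Qed.

End Freeness.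

Lemma argyris_basis_free (c : forall s, basis_index s -> R) :
  \sum_s \sum_k c s k *: argyris_basis k = 0 -> forall s (k : basis_index s), c s k = 0.
Proof.
move=> H [[i|e]|x] k.
- exact: patch_coef0.
- exact: edge_coef0.
- exact: vertex_coef0.
Qed.

End Argyris.

(** With [d = p - r - 1] the dimension is [d * n + r + 1], and the hypothesis cleared of its
    denominator reads [4 <= d * n + r]. *)
Lemma spline_dim_ge5 (p r n : nat) : (1 <= r)%N -> (r <= p - 2)%N -> (1 <= n)%N ->
  (4 - r%:R) / (p%:R - r%:R - 1) <= n%:R :> rat -> (5 <= spline_dim p.-1 r n)%N.
Proof.
move=> r1 rp n1; have [d [d0 ->]] : exists d, (0 < d)%N /\ p = (d + r + 1)%N.
  by exists (p - r - 1)%N; split; lia.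
rewrite (_ : _ - _ - 1 = d%:R :> rat); last by rewrite !natrD; ring.
rewrite ler_pdivrMr ?ltr0n // lerBlDr -natrM -natrD ler_nat /spline_dim.
rewrite (_ : (d + r + 1).-1 - r = d)%N ?mulnBr ?muln1 ?[(n * d)%N]mulnC; last by lia.
have : (d <= d * n)%N by rewrite leq_pmulr.
by move: (d * n)%N => m; lia.
Qed.

Lemma card_patch_index (p r n : nat) : #|{: patch_index p r n}| = (((p - r) * (n - 1) + p - 3) ^
  2)%N.
Proof. by rewrite card_prod card_ord /spline_dim -mulnn addn1 subSS. Qed.

(** The count is [(Nm - 5) + (Nm - 4)]; [5 <= Nm] keeps the subtractions from truncating. *)
Lemma card_edge_index (p r n : nat) : (r.+1 < p)%N -> (5 <= spline_dim p.-1 r n)%N ->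
  #|{: edge_index p r n}| = (2 * (p - r - 1) * (n - 1) + 2 * p - 9)%N.
Proof.
rewrite card_sum !card_ord /spline_dim -mulnA (_ : p - r - 1 = p.-1 - r)%N; last by lia.
by move: ((p.-1 - r) * (n - 1))%N => m; lia.
Qed.

Unset Implicit Arguments.
Set Strict Implicit.
Set Printing Implicit Defensive.

Theorem mainTheorem1 (R : realType) (p r n : nat)
  (hr : (1 <= r)%N) (hrp : (r <= p - 2)%N) (hn : (1 <= n)%N)
  (hn4 : (4 - r%:R) / (p%:R - r%:R - 1) <= n%:R :> rat)
  (I E X : finType) (Omega : set (plane R)) (F : I -> plane R -> plane R)
  (edge : E -> set (plane R)) (vert : X -> plane R)
  (eform : E -> edge_form I) (vform : X -> vertex_form I)
  (gd : rpatch I -> rpatch I -> gluing R)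
  (hdom : multipatch_domain Omega F p r n)
  (hedge : indexes_edges F edge) (hvert : indexes_vertices F vert)
  (heform : forall e, standard_edge Omega F (edge e) (eform e))
  (hvform : forall x, standard_vertex Omega F (vert x) (vform x))
  (hG1 : analysis_suitable_G1 Omega F gd) :
  [/\ (forall i, has_dim (patch_space F p r n i)
         (((p - r) * (n - 1) + p - 3) ^ 2)%N),
      (forall e, has_dim (edge_space F gd p r n (eform e))
         (2 * (p - r - 1) * (n - 1) + 2 * p - 9)%N),
      (forall x, has_dim (vertex_space F gd p r n (vert x) (vform x)) 6),
      independent_subspaces (argyris_summand F gd p r n vert eform vform) &
      has_dim (argyris_space F gd p r n vert eform vform)
        (#|I| * ((p - r) * (n - 1) + p - 3) ^ 2
         + #|E| * (2 * (p - r - 1) * (n - 1) + 2 * p - 9) + 6 * #|X|)%N].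
Proof.
have rp : (r.+1 < p)%N by lia.
have hN := spline_dim_ge5 hr hrp hn hn4.
(* The jets of all rotated parametrizations are fixed once, since the sections on vertices take them
   as parameters. *)
have /choice[J HJ] : forall h : rpatch I, exists J : (nat -> nat -> R) * (nat -> nat -> R), [/\
    cjet (fun xi => (param F h xi).1 : R^o) J.1, cjet (fun xi => (param F h xi).2 : R^o) J.2 &
    J.1 1%N 0%N * J.2 0%N 1%N - J.1 0%N 1%N * J.2 1%N 0%N != 0].
  by case=> i k; have [P [Q H]] := param_jets hn hdom i k; exists (P, Q).
have summandE := argyris_summandE rp hn hN hdom hG1 HJ eform hvert hvform.
have free := @argyris_basis_free _ _ _ _ _ _ _ _ rp hn hN hdom hG1 _ _ HJ _ _ _ _ _ _ hedge hvert
  heform hvform.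
have dim s : has_dim (argyris_summand F gd p r n vert eform vform s) #|basis_index p r n s|.
  by apply: (has_dim_range (summandE s)) => // c; exact: (free_block free).
have cP := card_patch_index p r n.
have cE := card_edge_index rp hN.
split.
- by move=> i; rewrite -cP; exact: (dim (inl (inl i))).
- by move=> e; rewrite -cE; exact: (dim (inl (inr e))).
- by move=> x; have := dim (inr x); rewrite /= card_ord.
- by rewrite (funext summandE); exact: independent_lspan free.
- rewrite /argyris_space (funext summandE); apply: (has_dim_sum free).
  by rewrite !big_sumType /= !sum_nat_const cP cE card_ord [(6 * _)%N]mulnC.
Qed.
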